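(* Let $d\in\mathbb{N}$ and let $\mu_\Psi^d$ be the $d$-dimensional generalized Wright measure, with parameters as described in the context. Then $\mu_\Psi^d$ has moments of any order. More precisely, for $n_1,\dots,n_d\in\mathbb{N}_0$ set $$M^{\mu_\Psi^d}(n_1,\dots,n_d):=\int_{\mathbb{R}^d}x_1^{n_1}\cdots x_d^{n_d}\,\mathrm{d}\mu_\Psi^d(x).$$ Then $M^{\mu_\Psi^d}(n_1,\dots,n_d)=0$ if any of the $n_i$ is odd, and for the even moments $$M^{\mu_\Psi^d}(2n_1,\dots,2n_d)=\frac1K\,\frac{\prod_{j=1}^m\Gamma(b_j+\beta_j(n+1))}{\prod_{i=1}^p\Gamma(a_i+\alpha_i(n+1))}\,\frac{(2n_1)!\cdots(2n_d)!}{n_1!\cdots n_d!\,2^n},\qquad n=n_1+\dots+n_d.$$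
   Context: Parameters. $m,p\in\mathbb{N}_0=\{0,1,2,\dots\}$; $a_i\in\mathbb{R}$, $\alpha_i>0$, $a_i+\alpha_i>0$ for $i=1,\dots,p$; $b_j\in\mathbb{R}$, $\beta_j>0$, $b_j+\beta_j>0$ for $j=1,\dots,m$. Put $a^*:=\sum_{j=1}^m\beta_j-\sum_{i=1}^p\alpha_i$ and $\mu:=\sum_{j=1}^m b_j-\sum_{i=1}^p a_i+(p-m)/2$. It is assumed that either $a^*>0$, or $a^*=0$ and $\mu<-1$, and that the Fox-$H$ function $$H^{m,0}_{p,m}(\tau):=\frac{1}{2\pi\mathrm{i}}\int_{\gamma-\mathrm{i}\infty}^{\gamma+\mathrm{i}\infty}\frac{\prod_{j=1}^m\Gamma(b_j+\beta_js)}{\prod_{i=1}^p\Gamma(a_i+\alpha_is)}\,\tau^{-s}\,\mathrm{d}s,\qquad \tau>0,$$ is non-negative on $(0,\infty)$; here $\gamma\in(0,1)$ is such that all poles of the numerator lie to the left of the contour. Put $K:=\prod_{j=1}^m\Gamma(b_j+\beta_j)\big/\prod_{i=1}^p\Gamma(a_i+\alpha_i)$. Generalized Wright function. $\Psi$ is formally the power series $\Psi(z)=\sum_{k\ge0}\frac{\prod_{j=1}^m\Gamma(b_j+\beta_j(k+1))}{\prod_{i=1}^p\Gamma(a_i+\alpha_i(k+1))}\frac{z^k}{k!}$ (which is entire if $a^*<1$); in general, for $z>0$, $\Psi(-z)$ is understood through its Fox-$H$ representation $\Psi(-z)=\frac{1}{2\pi\mathrm{i}}\int_{\gamma-\mathrm{i}\infty}^{\gamma+\mathrm{i}\infty}\Gamma(s)\frac{\prod_{j=1}^m\Gamma(b_j+\beta_j-\beta_js)}{\prod_{i=1}^p\Gamma(a_i+\alpha_i-\alpha_is)}z^{-s}\,\mathrm{d}s$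 with $0<\gamma<\min\{1,\min_j(b_j+\beta_j)/\beta_j\}$, and $\Psi(0)=K$. (These agree when $a^*<1$.) The measure $\mu_\Psi^d$ is the unique probability measure on $\mathbb{R}^d$ with $\int_{\mathbb{R}^d}\mathrm{e}^{\mathrm{i}(y,x)}\,\mathrm{d}\mu_\Psi^d(x)=\frac1K\Psi\big(-\tfrac{(y,y)}{2}\big)$, $y\in\mathbb{R}^d$, where $(\cdot,\cdot)$ is the Euclidean inner product. *)

(* Defs.v *)
From HB Require Import structures.
From mathcomp Require Import all_boot all_order all_algebra.
From mathcomp Require Import all_classical all_reals all_analysis.
From mathcomp Require Import complex.

Set Implicit Arguments.
Unset Strict Implicit.
Unset Printing Implicit Defensive.

Import Order.TTheory GRing.Theory Num.Theory.

Local Open Scope classical_set_scope.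
Local Open Scope ring_scope.
Local Open Scope complex_scope.

Definition cexp (R : realType) (z : R[i]) : R[i] :=
  (expR (complex.Re z))%:C * (cos (complex.Im z) +i* sin (complex.Im z)).

(* [cpow x s] is x^s = exp (s ln x), used only for x > 0. *)
Definition cpow (R : realType) (x : R) (s : R[i]) : R[i] :=
  cexp (s * (ln x)%:C).

Definition cintegral (d : measure_display) (T : measurableType d)
    (R : realType) (mu : {measure set T -> \bar R}) (D : set T) (f : T -> R[i]) : R[i] :=
  (Rintegral mu D (fun x => complex.Re (f x))) +i*
  (Rintegral mu D (fun x => complex.Im (f x))).

(* Euler's integral; it is the Gamma function on Re z > 0. *)
Definition euler_gamma (R : realType) (z : R[i]) : R[i] :=
  cintegral (@lebesgue_measure R) `]0, +oo[
    (fun t => cpow t (z - 1) * (expR (- t))%:C).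

(* The meromorphic continuation, by Gamma(z) = Gamma(z+n) / (z(z+1)...(z+n-1))
   with the least n such that Re z + n > 0. At the poles 0, -1, -2, ... one of
   the factors z + k is 0, so that Gamma takes the value 0 there and
   (Gamma z)^-1 = 0 is the correct value of the entire function 1/Gamma. *)
Definition Gamma (R : realType) (z : R[i]) : R[i] :=
  let n := if 0 < complex.Re z then 0%N
           else (Num.truncn (- complex.Re z)).+1 in
  euler_gamma (z + n%:R) / \prod_(k < n) (z + k%:R).

(* (2 pi i)^-1 times the integral of Phi(s) z^(-s) ds along the line
   s = gamma + i t, for which ds = i dt. *)
Definition mellin_barnes (R : realType) (gamma : R) (Phi : R[i] -> R[i])
    (z : R) : R[i] :=
  (2 * (pi : R)%:C * 'i)^-1 *
  cintegral (@lebesgue_measure R) setT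
    (fun t => let s := gamma +i* t in Phi s * cpow z (- s) * 'i).

Definition astar (R : realType) (p m : nat)
    (alpha : 'I_p -> R) (beta : 'I_m -> R) : R :=
  \sum_(j < m) beta j - \sum_(i < p) alpha i.

Definition mustar (R : realType) (p m : nat)
    (a : 'I_p -> R) (b : 'I_m -> R) : R :=
  \sum_(j < m) b j - \sum_(i < p) a i + (p%:R - m%:R) / 2.

Definition gamma_ratio (R : realType) (p m : nat) (a alpha : 'I_p -> R)
    (b beta : 'I_m -> R) (s : R[i]) : R[i] :=
  (\prod_(j < m) Gamma ((b j)%:C + (beta j)%:C * s)) /
  (\prod_(i < p) Gamma ((a i)%:C + (alpha i)%:C * s)).

(* The Fox-H function H^{m,0}_{p,m}. *)
Definition foxH (R : realType) (p m : nat) (a alpha : 'I_p -> R)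
    (b beta : 'I_m -> R) (gamma : R) (tau : R) : R[i] :=
  mellin_barnes gamma (gamma_ratio a alpha b beta) tau.

Definition wrightK (R : realType) (p m : nat) (a alpha : 'I_p -> R)
    (b beta : 'I_m -> R) : R[i] :=
  (\prod_(j < m) Gamma ((b j + beta j)%:C)) /
  (\prod_(i < p) Gamma ((a i + alpha i)%:C)).

(* The generalized Wright function Psi on the half-line x <= 0, through its
   Fox-H representation; the values for x > 0 are not meaningful. *)
Definition wrightPsi (R : realType) (p m : nat) (a alpha : 'I_p -> R)
    (b beta : 'I_m -> R) (gamma : R) (x : R) : R[i] :=
  if x == 0 then wrightK a alpha b beta
  else mellin_barnes gamma
    (fun s => Gamma s *
      ((\prod_(j < m) Gamma ((b j + beta j)%:C - (beta j)%:C * s)) /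
       (\prod_(i < p) Gamma ((a i + alpha i)%:C - (alpha i)%:C * s))))
    (- x).

Definition inner (R : realType) (d : nat) (y x : d.-tuple R) : R :=
  \sum_(i < d) tnth y i * tnth x i.

Definition charfun (R : realType) (d : nat)
    (P : probability (d.-tuple R) R) (y : d.-tuple R) : R[i] :=
  cintegral P setT (fun x => cexp ('i * (inner y x)%:C)).

Definition is_wright_measure (R : realType) (p m : nat) (a alpha : 'I_p -> R)
    (b beta : 'I_m -> R) (gamma : R) (d : nat)
    (P : probability (d.-tuple R) R) : Prop :=
  forall y : d.-tuple R,
    charfun P y = (wrightK a alpha b beta)^-1 *
                  wrightPsi a alpha b beta gamma (- (inner y y / 2)).

Definition monomial (R : realType) (d : nat) (n : 'I_d -> nat)
    (x : d.-tuple R) : R :=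
  \prod_(i < d) tnth x i ^+ n i.

Definition moment (R : realType) (d : nat)
    (P : probability (d.-tuple R) R) (n : 'I_d -> nat) : R :=
  Rintegral P setT (monomial n).

(* Main.v *)
Require Import Defs.
From HB Require Import structures.
From mathcomp Require Import all_boot all_order all_algebra.
From mathcomp Require Import all_classical all_reals all_analysis.
From mathcomp Require Import complex.
From mathcomp Require Import measurable_realfun ring lra.

Set Implicit Arguments.
Unset Strict Implicit.
Unset Printing Implicit Defensive.

Import Order.TTheory GRing.Theory Num.Theory.
Import numFieldNormedType.Exports.

Local Open Scope classical_set_scope.
Local Open Scope ring_scope.
Local Open Scope complex_scope.

(** Only the characteristic function of the measure is known, so the moments
    have to be read off its behaviour at the origin, and in general there is no
    convergent power series to work with.  The argument goes as follows.

    The function Psi(-z) is a Mellin-Barnes integral whose integrand has simple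
    poles at s = 0, -1, -2, ..., coming from the factor Gamma(s); the other
    factor is the ratio of Gamma functions [dual_ratio], regular for
    Re s <= gamma.  Moving the line of integration from Re s = gamma to
    Re s = - n - 1/2 picks up the residues at 0, -1, ..., -n, which are the
    terms (-z)^k / k! * c_k, k <= n, of the formal power series, and leaves an
    integral of size z^(n + 1/2) ([wrightPsi_expansion]).  This needs decay of
    the integrand on vertical lines: Gamma(x + i t) has size exp(- pi |t| / 2)
    up to factors exp(e |t|), both from above and from below
    ([euler_gamma_upper], [euler_gamma_lower]), so that the ratio [dual_ratio]
    is at most exp(e |t|) as soon as a* >= 0, and the factor Gamma(s) supplies
    the decay.

    For a fixed vector y, the random variable X = (y, x) therefore has
    E cos(h X) equal to an even polynomial in h up to O(h^(2n+1)) for every n,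
    and E sin(h X) = O(h^(2n+1)) for every n.  The Taylor remainders of the
    cosine, with alternating signs, are nonnegative; dividing by h^(2n) and
    letting h tend to 0, Fatou's lemma gives E X^(2n) < +oo, dominated
    convergence gives its value, and the sine gives E X^(2n+1) = 0
    ([even_moments_of_charfun], [odd_moments_of_charfun]).  Consequently
    E (y, x)^(2n) is a constant times (y, y)^n.

    A monomial in x_1, ..., x_d of degree M is a linear combination of powers
    (y, x)^M with y in {0, ..., M}^d, and the same combination of the values
    (y, y)^(M/2) is a coefficient of (y_1^2 + ... + y_d^2)^(M/2)
    ([monomial_polarization]).  This turns the moments of the projections into
    the mixed moments ([moments_of_projections]). *)

Local Notation Re := complex.Re.
Local Notation Im := complex.Im.
Local Notation normc := ComplexField.Normc.normc.

Implicit Type R : realType.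

Lemma le_of_eq R (x y : R) : x = y -> x <= y.
Proof. by move=> ->. Qed.

(** * Complex numbers and the complex exponential *)

Lemma normcD_le R (x y : R[i]) : normc (x + y) <= normc x + normc y.
Proof. exact: le_normcD. Qed.

Lemma normc_ge0 R (x : R[i]) : 0 <= normc x.
Proof. by case: x => x y; rewrite sqrtr_ge0. Qed.

Lemma normcN1 R (x : R[i]) : normc (- x) = normc x.
Proof. exact: (normcN (x : Rcomplex R)). Qed.

Lemma normcB_le R (x y : R[i]) : normc (x - y) <= normc x + normc y.
Proof. by apply: le_trans (normcD_le _ _) _; rewrite normcN1. Qed.

Lemma normc_distC R (x y : R[i]) : normc (x - y) = normc (y - x).
Proof. by rewrite -normcN1 opprB. Qed.

Lemma normc_real R (x : R) : normc x%:C = `|x|.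
Proof. by rewrite /= expr0n addr0 sqrtr_sqr. Qed.

Lemma Re_le_normc R (z : R[i]) : `|Re z| <= normc z.
Proof. by case: z => x y /=; rewrite -sqrtr_sqr ler_wsqrtr// lerDl sqr_ge0. Qed.

Lemma Im_le_normc R (z : R[i]) : `|Im z| <= normc z.
Proof. by case: z => x y /=; rewrite -sqrtr_sqr ler_wsqrtr// lerDr sqr_ge0. Qed.

Lemma ReIm_split R (z : R[i]) : z = (Re z)%:C + (Im z)%:C * 'i.
Proof. by case: z => x y; simpc. Qed.

Lemma normc_i R : normc ('i : R[i]) = 1.
Proof. by rewrite /= expr0n add0r expr1n sqrtr1. Qed.

Lemma normc_le_ReIm R (z : R[i]) : normc z <= `|Re z| + `|Im z|.
Proof.
rewrite {1}(ReIm_split z); apply: le_trans (normcD_le _ _) _.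
by rewrite normc_real Normc.normcM normc_real normc_i mulr1.
Qed.

Lemma normc_eq0P R (z : R[i]) : (normc z == 0) = (z == 0).
Proof.
by apply/eqP/eqP => [/Normc.eq0_normc//|->]; rewrite Normc.normc0.
Qed.

Lemma normc_gt0 R (z : R[i]) : z != 0 -> 0 < normc z.
Proof. by move=> z0; rewrite lt_def normc_eq0P z0 normc_ge0. Qed.

Lemma sqr_normcE R (z : R[i]) : normc z ^+ 2 = Re z ^+ 2 + Im z ^+ 2.
Proof. by case: z => x y /=; rewrite sqr_sqrtr// addr_ge0 ?sqr_ge0. Qed.

Lemma ReM R (x y : R[i]) : Re (x * y) = Re x * Re y - Im x * Im y.
Proof. by case: x => a b; case: y => c d. Qed.

Lemma ImM R (x y : R[i]) : Im (x * y) = Re x * Im y + Im x * Re y.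
Proof. by case: x => a b; case: y => c d. Qed.

Lemma ReD R (x y : R[i]) : Re (x + y) = Re x + Re y.
Proof. by case: x => a b; case: y => c d. Qed.

Lemma ImD R (x y : R[i]) : Im (x + y) = Im x + Im y.
Proof. by case: x => a b; case: y => c d. Qed.

Lemma ReN R (x : R[i]) : Re (- x) = - Re x.
Proof. by case: x => a b. Qed.

Lemma ImN R (x : R[i]) : Im (- x) = - Im x.
Proof. by case: x => a b. Qed.

Lemma complexP R (x y : R[i]) : Re x = Re y -> Im x = Im y -> x = y.
Proof. by move: x y => [a b] [c d] /= -> ->. Qed.

Definition cE R := (@ReM R, @ImM R, @ReD R, @ImD R, @ReN R, @ImN R).

Lemma normc_cexp R (z : R[i]) : normc (cexp z) = expR (Re z).
Proof.
rewrite /cexp Normc.normcM normc_real ger0_norm ?expR_ge0//=.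
by rewrite cos2Dsin2 sqrtr1 mulr1.
Qed.

Lemma cexpD R (z w : R[i]) : cexp (z + w) = cexp z * cexp w.
Proof.
rewrite /cexp; apply: complexP; rewrite !cE /= expRD.
  by rewrite cosD; ring.
by rewrite sinD; ring.
Qed.

Lemma cexp0 R : cexp (0 : R[i]) = 1.
Proof. by rewrite /cexp /= expR0 cos0 sin0 mul1r. Qed.

Lemma cexp_real R (x : R) : cexp x%:C = (expR x)%:C.
Proof. by rewrite /cexp /= cos0 sin0 mulr1. Qed.

(** * Taylor remainders of cosine and sine *)

Definition cos_taylor R (n : nat) (u : R) : R :=
  \sum_(k < n) (-1) ^+ k * u ^+ (2 * k) / ((2 * k)`!)%:R.
Definition sin_taylor R (n : nat) (u : R) : R :=
  \sum_(k < n) (-1) ^+ k * u ^+ (2 * k).+1 / ((2 * k).+1`!)%:R.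
(** The sign makes the remainder nonnegative for n > 0. *)
Definition cos_rest R (n : nat) (u : R) : R :=
  (-1) ^+ n * (cos u - cos_taylor n u).
Definition sin_rest R (n : nat) (u : R) : R :=
  (-1) ^+ n * (sin u - sin_taylor n u).

Lemma is_derive_expn_div_fact R (n : nat) (c u : R) :
  is_derive u 1 (fun x : R => c * x ^+ n.+1 / (n.+1`!)%:R) (c * u ^+ n / (n`!)%:R).
Proof.
have h : is_derive u 1 (fun x : R => x ^+ n.+1) (n.+1%:R * u ^+ n).
  apply: DeriveDef; first exact: exprn_derivable.
  by rewrite exp_derive /= /GRing.scale/= mulr1.
have -> : (fun x : R => c * x ^+ n.+1 / (n.+1`!)%:R) =
   (c / (n.+1`!)%:R) \*: (fun x : R => x ^+ n.+1).
  by apply/funext => x /=; rewrite /GRing.scale/= -!mulrA [_^-1 * _]mulrC.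
apply: is_derive_eq; rewrite /GRing.scale/= factS natrM invfM.
have n0 : n.+1%:R != 0 :> R by rewrite pnatr_eq0.
have n1 : (n`!)%:R != 0 :> R by rewrite pnatr_eq0 -lt0n fact_gt0.
move: (n.+1%:R : R) ((n`!)%:R : R) n0 n1 => N M n0 n1.
by field; rewrite n1 n0.
Qed.

Lemma is_derive_bigsum R (n : nat) (f df : nat -> R -> R) (u : R) :
  (forall k, is_derive u 1 (f k) (df k u)) ->
  is_derive u 1 (fun x => \sum_(k < n) f k x) (\sum_(k < n) df k u).
Proof.
move=> h; elim: n => [|n IH].
  have -> : (fun x => \sum_(k < 0) f k x) = cst 0 by apply/funext => x; rewrite big_ord0.
  by rewrite big_ord0; exact: is_derive_cst.
have -> : (fun x => \sum_(k < n.+1) f k x) = (fun x => \sum_(k < n) f k x) + f n.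
  by apply/funext => x; rewrite big_ord_recr.
by rewrite big_ord_recr; exact: is_deriveD.
Qed.

(** The signs are chosen so that each remainder is a primitive of the previous
    one, which is what propagates nonnegativity. *)
Lemma is_derive_sin_rest R (n : nat) (u : R) :
  is_derive u 1 (@sin_rest R n) (cos_rest n u).
Proof.
have h : is_derive u 1 (@sin_taylor R n) (cos_taylor n u).
  apply: (@is_derive_bigsum R n (fun k x => (-1) ^+ k * x ^+ (2 * k).+1 / ((2 * k).+1`!)%:R)
   (fun k x => (-1) ^+ k * x ^+ (2 * k) / ((2 * k)`!)%:R)) => k.
  exact: is_derive_expn_div_fact.
have -> : @sin_rest R n = ((-1) ^+ n : R) \*: (@sin R \- @sin_taylor R n).
  by apply/funext => x; rewrite /sin_rest /=.
by apply: is_derive_eq.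
Qed.

Lemma is_derive_cos_rest R (n : nat) (u : R) :
  is_derive u 1 (@cos_rest R n.+1) (sin_rest n u).
Proof.
have -> : @cos_rest R n.+1 =
   ((-1) ^+ n.+1 : R) \*: (@cos R \- (fun x => 1 + \sum_(k < n)
     (- (-1) ^+ k) * x ^+ (2 * k).+2 / ((2 * k).+2`!)%:R)).
  apply/funext => x; rewrite /cos_rest /cos_taylor big_ord_recl /= muln0 !expr0 fact0 mulr1 divr1.
  rewrite /GRing.scale/=; congr (_ * (_ - (_ + _))).
  apply: eq_bigr => i _; by rewrite /bump !add1n mulnS !add2n exprS mulN1r.
have h : is_derive u 1 (fun x : R => \sum_(k < n)
     (- (-1) ^+ k) * x ^+ (2 * k).+2 / ((2 * k).+2`!)%:R) (- sin_taylor n u).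
  rewrite /sin_taylor -sumrN.
  rewrite (eq_bigr (fun i : 'I_n => (- (-1) ^+ i) * u ^+ (2 * i).+1 / ((2 * i).+1`!)%:R)); last first.
    by move=> i _; rewrite !mulNr.
  apply: (@is_derive_bigsum R n
     (fun k x => (- (-1) ^+ k) * x ^+ (2 * k).+2 / ((2 * k).+2`!)%:R)
     (fun k x => (- (-1) ^+ k) * x ^+ (2 * k).+1 / ((2 * k).+1`!)%:R)) => k.
  exact: is_derive_expn_div_fact.
apply: is_derive_eq; rewrite /sin_rest /GRing.scale/= exprS; ring.
Qed.

Lemma cos_rest0 R n : cos_rest n.+1 (0 : R) = 0.
Proof.
rewrite /cos_rest cos0 /cos_taylor big_ord_recl /= muln0 !expr0 fact0 mulr1 divr1.
rewrite big1 ?addr0 ?subrr ?mulr0// => i _.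
by rewrite /bump add1n mulnS expr0n mulr0 mul0r.
Qed.

Lemma sin_rest0 R n : sin_rest n (0 : R) = 0.
Proof.
rewrite /sin_rest sin0 /sin_taylor big1 ?subrr ?mulr0// => i _.
by rewrite exprS mul0r mulr0 mul0r.
Qed.

Lemma ge0_derive_ge0 R (f df : R -> R) :
  (forall x : R, is_derive x 1 f (df x)) -> f 0 = 0 ->
  (forall x, 0 <= x -> 0 <= df x) -> forall u, 0 <= u -> 0 <= f u.
Proof.
move=> fdf f0 df0 u u0.
have [c] := @MVT_segment R f df 0 u u0 (fun x _ => fdf x)
  (continuous_subspaceT (fun x => differentiable_continuous
     (iffLR (derivable1_diffP f x) (@ex_derive _ _ _ _ _ _ _ (fdf x))))).
rewrite in_itv /= f0 !subr0 => /andP[c0 _] ->.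
by rewrite mulr_ge0// df0.
Qed.

(** Starting from cos <= 1, integrate repeatedly from 0. *)
Lemma cos_sin_rest_ge0 R n (u : R) : 0 <= u ->
  0 <= cos_rest n.+1 u /\ 0 <= sin_rest n.+1 u.
Proof.
elim: n u => [|n IH] u u0.
  have c1 (x : R) : 0 <= cos_rest 1 x.
    rewrite /cos_rest /cos_taylor big_ord1 /= muln0 !expr0 fact0 mulr1 divr1 expr1.
    by rewrite mulN1r opprB subr_ge0 cos_le1.
  split => //; apply: (ge0_derive_ge0 (@is_derive_sin_rest R 1)) => //.
  exact: sin_rest0.
have h (x : R) : 0 <= x -> 0 <= cos_rest n.+2 x.
  apply: (@ge0_derive_ge0 R _ _ (@is_derive_cos_rest R n.+1)); first exact: cos_rest0.
  by move=> y /IH[].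
split; first exact: h.
apply: (ge0_derive_ge0 (@is_derive_sin_rest R n.+2)) => //.
exact: sin_rest0.
Qed.

Lemma cos_restN R n (u : R) : cos_rest n (- u) = cos_rest n u.
Proof.
rewrite /cos_rest cosN /cos_taylor; congr (_ * (_ - _)).
by apply: eq_bigr => i _; rewrite !(exprM _ 2) sqrrN.
Qed.

Lemma sin_restN R n (u : R) : sin_rest n (- u) = - sin_rest n u.
Proof.
rewrite /sin_rest sinN /sin_taylor -mulrN opprB; congr (_ * _).
rewrite addrC; congr (_ - _); rewrite -sumrN.
apply: eq_bigr => i _; rewrite !(exprS _ (2 * i)) !(exprM _ 2) sqrrN.
by rewrite mulNr mulrN mulNr opprK.
Qed.

Lemma cos_rest_ge0 R n (u : R) : 0 <= cos_rest n.+1 u.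
Proof.
have [u0|u0] := leP 0 u; first by case: (cos_sin_rest_ge0 n u0).
by rewrite -cos_restN; case: (@cos_sin_rest_ge0 R n (- u)) => //; rewrite oppr_ge0 ltW.
Qed.

Lemma cos_restS R n (u : R) :
  cos_rest n u + cos_rest n.+1 u = u ^+ (2 * n) / ((2 * n)`!)%:R.
Proof.
rewrite /cos_rest /cos_taylor big_ord_recr /= exprS.
have : (-1) ^+ n * (-1) ^+ n = 1 :> R by rewrite -expr2 sqrr_sign.
move: ((-1) ^+ n) => e e1.
transitivity (e * e * (u ^+ (2 * n) / ((2 * n)`!)%:R)); last by rewrite e1 mul1r.
ring.
Qed.

Lemma sin_restS R n (u : R) :
  sin_rest n u + sin_rest n.+1 u = u ^+ (2 * n).+1 / ((2 * n).+1`!)%:R.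
Proof.
rewrite /sin_rest /sin_taylor big_ord_recr /= [(-1) ^+ n.+1]exprS.
have : (-1) ^+ n * (-1) ^+ n = 1 :> R by rewrite -expr2 sqrr_sign.
move: ((-1) ^+ n) => e e1.
transitivity (e * e * (u ^+ (2 * n).+1 / ((2 * n).+1`!)%:R)); last by rewrite e1 mul1r.
ring.
Qed.

Lemma cos_rest_le R n (u : R) :
  cos_rest n u <= u ^+ (2 * n) / ((2 * n)`!)%:R.
Proof. by rewrite -cos_restS lerDl cos_rest_ge0. Qed.

Lemma sin_rest_norm R n (u : R) :
  `|sin_rest n.+1 u| <= `|u| ^+ (2 * n.+1).+1 / ((2 * n.+1).+1`!)%:R.
Proof.
have h (x : R) : 0 <= x -> `|sin_rest n.+1 x| <= `|x| ^+ (2 * n.+1).+1 / ((2 * n.+1).+1`!)%:R.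
  move=> x0; rewrite (ger0_norm x0) -sin_restS.
  have [_ a1] := cos_sin_rest_ge0 n x0; have [_ a2] := cos_sin_rest_ge0 n.+1 x0.
  by rewrite ger0_norm// lerDl.
have [u0|u0] := leP 0 u; first exact: h.
rewrite -[u]opprK sin_restN !normrN -[`|u|]normrN h// oppr_ge0 ltW//.
Qed.

(** * Second order estimate for the complex exponential *)

Lemma expR_sub1_ge0 R (x : R) : 0 <= x * (expR x - 1).
Proof.
have [x0|x0] := leP 0 x; first by rewrite mulr_ge0// subr_ge0 -expR0 ler_expR.
by rewrite -mulrNN mulr_ge0// oppr_ge0 ?(ltW x0)// subr_le0 -expR0 ler_expR ltW.
Qed.

Lemma expR_sub1_norm R (x : R) : `|expR x - 1| <= `|x| * (1 + expR x).
Proof.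
have e0 := expR_gt0 x.
have h1 : 1 + x <= expR x := expR_ge1Dx x.
have h2 : expR x - 1 <= x * expR x.
  have := expR_ge1Dx (- x); rewrite expRN => h.
  have : (1 + - x) * expR x <= (expR x)^-1 * expR x by rewrite ler_pM2r.
  by rewrite mulVf ?gt_eqF//; lra.
rewrite ler_norml; have [x0|x0] := leP 0 x.
  by rewrite ger0_norm//; apply/andP; split; nra.
by rewrite ltr0_norm//; apply/andP; split; nra.
Qed.

Lemma expR_taylor1 R (x : R) :
  `|expR x - 1 - x| <= x ^+ 2 * (1 + expR x).
Proof.
have e0 := expR_gt0 x.
have h1 : 1 + x <= expR x := expR_ge1Dx x.
have h2 : expR x - 1 <= x * expR x.
  have := expR_ge1Dx (- x); rewrite expRN => h.
  have : (1 + - x) * expR x <= (expR x)^-1 * expR x by rewrite ler_pM2r.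
  by rewrite mulVf ?gt_eqF//; lra.
rewrite ger0_norm; last by lra.
have h3 := expR_sub1_norm x.
have : expR x - 1 - x <= `|x| * `|expR x - 1|.
  by rewrite -normrM ger0_norm ?expR_sub1_ge0//; lra.
move/le_trans; apply.
by rewrite -real_normK ?num_real// expr2 -mulrA ler_wpM2l.
Qed.

Lemma cos_sub1_norm R (y : R) : `|cos y - 1| <= y ^+ 2.
Proof.
have := cos_rest_ge0 0 y; have := cos_rest_le 1 y.
rewrite /cos_rest /cos_taylor big_ord1 /= muln0 !expr0 fact0 muln1 mulr1 divr1 expr1.
rewrite !mulN1r !opprB => h1 h2.
rewrite distrC ger0_norm//; apply: le_trans h1 _.
by rewrite ler_pdivrMr ?ltr0n// ler_peMr ?sqr_ge0// ler1n.
Qed.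

Lemma sin_sub_norm R (y : R) : `|sin y - y| <= 2 * y ^+ 2.
Proof.
have := sin_rest_norm 0 y.
rewrite /sin_rest /sin_taylor big_ord1 muln0 expr0 !expr1 mul1r muln1
  (_ : (1`!)%:R = 1 :> R)// divr1.
rewrite mulN1r normrN (_ : (3`!)%:R = 6 :> R)// => h.
have s1 : `|sin y| <= 1 by rewrite ler_norml sin_geN1 sin_le1.
have [y1|y1] := leP `|y| 1.
  apply: le_trans h _; rewrite -(real_normK (num_real y)).
  have := normr_ge0 y; move: `|y| y1 => z z1 z0.
  by rewrite exprS; have := sqr_ge0 z; nra.
apply: le_trans (ler_normB _ _) _; rewrite -(real_normK (num_real y)).
by move: `|y| y1 => z z1; nra.
Qed.

(** The factor 1 + exp(Re z) covers both signs of Re z, so that the estimate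
    holds on the whole plane and can be integrated against a weight. *)
Lemma cexp_taylor1 R (z : R[i]) :
  normc (cexp z - 1 - z) <= 5 * normc z ^+ 2 * (1 + expR (Re z)).
Proof.
apply: le_trans (normc_le_ReIm _) _; rewrite sqr_normcE.
case: z => x y; rewrite /cexp !cE /= !mul0r subr0 addr0.
have e0 := expR_gt0 x.
have h1 := expR_taylor1 x; have h2 := cos_sub1_norm y; have h3 := sin_sub_norm y.
have h4 := expR_sub1_norm x.
have E1 : `|expR x * cos y - 1 - x| <= x ^+ 2 * (1 + expR x) + expR x * y ^+ 2.
  rewrite (_ : _ - x = (expR x - 1 - x) + expR x * (cos y - 1)); last by ring.
  apply: le_trans (ler_normD _ _) _; apply: lerD => //.
  by rewrite normrM (ger0_norm (ltW e0)) ler_pM2l.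
have E2 : `|expR x * sin y - 0 - y| <=
    expR x * (2 * y ^+ 2) + (x ^+ 2 + y ^+ 2) * (1 + expR x).
  rewrite (_ : _ - y = expR x * (sin y - y) + (expR x - 1) * y); last by ring.
  apply: le_trans (ler_normD _ _) _; apply: lerD => //.
    by rewrite normrM (ger0_norm (ltW e0)) ler_pM2l.
  rewrite normrM; apply: le_trans (ler_wpM2r (normr_ge0 y) h4) _.
  rewrite mulrAC; apply: ler_wpM2r; first by rewrite addr_ge0// ltW.
  rewrite -(real_normK (num_real x)) -(real_normK (num_real y)).
  by have := sqr_ge0 (`|x| - `|y|); nra.
apply: le_trans (lerD E1 E2) _.
by have := sqr_ge0 x; have := sqr_ge0 y; nra.
Qed.

(** * A class of holomorphic functions *)

(** A quantitative form of holomorphy: uniform bounds for the function and its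
    derivative, and a uniform second order Taylor estimate.  It is stable under
    products, inverses of functions bounded away from zero and integrals depending on a
    parameter, and it allows contours to be moved without Cauchy's theorem. *)
Definition holo_with R (D : set R[i]) (F F' : R[i] -> R[i]) : Prop :=
  exists2 C : R, 0 <= C & forall s w, D s -> D w ->
   [/\ normc (F s) <= C, normc (F' s) <= C,
       normc (F w - F s) <= C * normc (w - s) &
       normc (F w - F s - F' s * (w - s)) <= C * normc (w - s) ^+ 2].

Definition holo R (D : set R[i]) (F : R[i] -> R[i]) : Prop :=
  exists F', holo_with D F F'.

Lemma holo_sub R (D E : set R[i]) F : E `<=` D -> holo D F -> holo E F.
Proof.
move=> ED [F' [C C0 h]]; exists F', C => // s w /ED Ds /ED Dw; exact: h.
Qed.

Lemma eq_holo R (D : set R[i]) F G :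
  (forall s, D s -> F s = G s) -> holo D F -> holo D G.
Proof.
move=> FG [F' [C C0 h]]; exists F', C => // s w Ds Dw; rewrite -!FG//; exact: h.
Qed.

Lemma holo_cst R (D : set R[i]) (c : R[i]) : holo D (fun=> c).
Proof.
exists (fun=> 0), (normc c); first exact: normc_ge0.
move=> s w _ _; rewrite subrr mul0r subrr Normc.normc0.
by split=> //; rewrite ?mulr_ge0 ?exprn_ge0 ?normc_ge0.
Qed.

Lemma holoD R (D : set R[i]) F G :
  holo D F -> holo D G -> holo D (fun s => F s + G s).
Proof.
move=> [F' [C C0 hF]] [G' [K K0 hG]]; exists (fun s => F' s + G' s), (C + K).
  exact: addr_ge0.
move=> s w Ds Dw; have [a1 a2 a3 a4] := hF s w Ds Dw.
have [b1 b2 b3 b4] := hG s w Ds Dw; split.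
- by apply: le_trans (normcD_le _ _) _; apply: lerD.
- by apply: le_trans (normcD_le _ _) _; apply: lerD.
- rewrite opprD addrACA mulrDl.
  by apply: le_trans (normcD_le _ _) _; apply: lerD.
- rewrite (_ : _ - _ = (F w - F s - F' s * (w - s)) + (G w - G s - G' s * (w - s))); last by ring.
  by rewrite mulrDl; apply: le_trans (normcD_le _ _) _; apply: lerD.
Qed.

Lemma holoM R (D : set R[i]) F G :
  holo D F -> holo D G -> holo D (fun s => F s * G s).
Proof.
move=> [F' [C C0 hF]] [G' [K K0 hG]].
exists (fun s => F' s * G s + F s * G' s), (3 * (C * K)).
  by rewrite mulr_ge0// mulr_ge0.
move=> s w Ds Dw; have [a1 a2 a3 a4] := hF s w Ds Dw.
have [b1 b2 b3 b4] := hG s w Ds Dw.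
have [c1 _ _ _] := hG w s Dw Ds.
have CK0 : 0 <= C * K by rewrite mulr_ge0.
have n0 (x : R[i]) := normc_ge0 x.
have d0 : 0 <= C * K * normc (w - s) by rewrite mulr_ge0.
have d20 : 0 <= C * K * normc (w - s) ^+ 2 by rewrite mulr_ge0// exprn_ge0.
have pM (x y : R[i]) (X Y : R) : normc x <= X -> normc y <= Y -> normc (x * y) <= X * Y.
  by move=> hx hy; rewrite Normc.normcM ler_pM.
split.
- by apply: le_trans (pM _ _ _ _ a1 b1) _; lra.
- apply: le_trans (normcD_le _ _) _.
  by have := pM _ _ _ _ a2 b1; have := pM _ _ _ _ a1 b2; lra.
- rewrite (_ : _ - _ = (F w - F s) * G w + F s * (G w - G s)); last by ring.
  apply: le_trans (normcD_le _ _) _.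
  by have := pM _ _ _ _ a3 c1; have := pM _ _ _ _ a1 b3; lra.
- rewrite (_ : _ - _ = (F w - F s - F' s * (w - s)) * G w
     + F s * (G w - G s - G' s * (w - s)) + F' s * (w - s) * (G w - G s)); last by ring.
  apply: le_trans (normcD_le _ _) _.
  apply: le_trans (lerD (normcD_le _ _) (lexx _)) _.
  have := pM _ _ _ _ a4 c1; have := pM _ _ _ _ a1 b4.
  have := pM _ _ _ _ (pM _ _ _ _ a2 (lexx (normc (w - s)))) b3.
  rewrite expr2; lra.
Qed.

Lemma holoV R (D : set R[i]) F (c : R) : 0 < c ->
  (forall s, D s -> c <= normc (F s)) -> holo D F -> holo D (fun s => (F s)^-1).
Proof.
move=> c0 hc [F' [C C0 hF]].
pose A := c^-1.
have A0 : 0 <= A by rewrite invr_ge0 ltW.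
exists (fun s => - F' s * ((F s)^-1 * (F s)^-1)), (A + C * A ^+ 2 + C * A ^+ 2 + C * C * A ^+ 3).
  by rewrite !addr_ge0// !mulr_ge0// ?exprn_ge0.
have n0 (x : R[i]) := normc_ge0 x.
have pM (x y : R[i]) (X Y : R) : normc x <= X -> normc y <= Y -> normc (x * y) <= X * Y.
  by move=> hx hy; rewrite Normc.normcM ler_pM.
have FV s : D s -> normc (F s)^-1 <= A.
  move=> Ds; rewrite Normc.normcV lef_pV2 ?posrE ?hc//.
  exact: lt_le_trans c0 (hc _ Ds).
have Fn0 s : D s -> F s != 0.
  by move=> Ds; rewrite -normc_eq0P gt_eqF// (lt_le_trans c0)// hc.
have P0 : 0 <= C * A ^+ 2 by rewrite mulr_ge0// exprn_ge0.
have P1 : 0 <= C * C * A ^+ 3 by rewrite !mulr_ge0// exprn_ge0.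
move=> s w Ds Dw; have [a1 a2 a3 a4] := hF s w Ds Dw.
have Hs := Fn0 _ Ds; have Hw := Fn0 _ Dw.
have Bs := FV _ Ds; have Bw := FV _ Dw.
split.
- by apply: le_trans Bs _; lra.
- rewrite -normcN1 mulNr opprK; have := pM _ _ _ _ a2 (pM _ _ _ _ Bs Bs).
  by move/le_trans; apply; rewrite -expr2; lra.
- rewrite (_ : _ - _ = - ((F w - F s) * ((F s)^-1 * (F w)^-1))); last first.
    by field; rewrite Hs Hw.
  rewrite normcN1; have := pM _ _ _ _ a3 (pM _ _ _ _ Bs Bw); move/le_trans; apply.
  rewrite -expr2 mulrAC ler_wpM2r//; lra.
- rewrite (_ : _ - _ = (F w - F s) * (F w - F s) * ((F s)^-1 * ((F s)^-1 * (F w)^-1))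
      - (F w - F s - F' s * (w - s)) * ((F s)^-1 * (F s)^-1)); last first.
    by field; rewrite Hs Hw.
  apply: le_trans (normcB_le _ _) _.
  have := pM _ _ _ _ a4 (pM _ _ _ _ Bs Bs).
  have := pM _ _ _ _ (pM _ _ _ _ a3 a3) (pM _ _ _ _ Bs (pM _ _ _ _ Bs Bw)).
  have d2 : 0 <= normc (w - s) ^+ 2 by rewrite exprn_ge0.
  have := mulr_ge0 A0 d2; have := mulr_ge0 P0 d2.
  rewrite !exprS !expr0; set d := normc (w - s); lra.
Qed.

Lemma holo_affine R (D E : set R[i]) F (b c : R[i]) :
  (forall s, E s -> D (b + c * s)) -> holo D F -> holo E (fun s => F (b + c * s)).
Proof.
move=> ED [F' [C C0 hF]].
pose k := normc c.
have k0 : 0 <= k := normc_ge0 c.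
exists (fun s => c * F' (b + c * s)), (C + k * C + C * k ^+ 2).
  by rewrite !addr_ge0// mulr_ge0// exprn_ge0.
move=> s w Es Ew.
have dE : (b + c * w) - (b + c * s) = c * (w - s) by ring.
have n0 := normc_ge0 (w - s).
have [] := hF _ _ (ED _ Es) (ED _ Ew); rewrite dE Normc.normcM -/k.
have d2 : 0 <= normc (w - s) ^+ 2 by rewrite exprn_ge0.
have e1 := mulr_ge0 k0 C0; have e2 := mulr_ge0 e1 k0.
have := mulr_ge0 C0 n0; have := mulr_ge0 C0 d2; have := mulr_ge0 e2 n0; have := mulr_ge0 e1 d2.
rewrite !expr2; move=> q1 q2 q3 q4 a1 a2 a3 a4; split.
- by lra.
- by rewrite Normc.normcM -/k; have := ler_wpM2l k0 a2; lra.
- by lra.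
- rewrite [c * F' _]mulrC -mulrA; lra.
Qed.

Lemma holo_prod R (D : set R[i]) I (r : seq I) (F : I -> R[i] -> R[i]) :
  (forall i, holo D (F i)) -> holo D (fun s => \prod_(i <- r) F i s).
Proof.
move=> h; elim: r => [|i r IH].
  by apply: eq_holo (holo_cst D 1) => s _; rewrite big_nil.
by apply: eq_holo (holoM (h i) IH) => s _; rewrite big_cons.
Qed.

Lemma holo_id R (D : set R[i]) (M : R) :
  (forall s, D s -> normc s <= M) -> holo D id.
Proof.
move=> hM; exists (fun=> 1), (`|M| + 1); first by rewrite addr_ge0.
move=> s w Ds Dw; rewrite mul1r subrr Normc.normc0 Normc.normc1.
have M0 := normr_ge0 M.
split.
- by apply: le_trans (hM _ Ds) _; apply: le_trans (ler_norm _) _; rewrite lerDl.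
- by rewrite lerDr.
- by rewrite ler_peMl ?normc_ge0// lerDr.
- by rewrite mulr_ge0 ?exprn_ge0 ?normc_ge0// addr_ge0.
Qed.

(** * Limits and complex-valued integrals *)

Lemma cvg0_harmonic_bound R (u : nat -> R) (C : R) :
  (forall n, `|u n| <= C * n.+1%:R^-1) -> u @ \oo --> 0.
Proof.
move=> h; have H : (fun n : nat => C * n.+1%:R^-1) @ \oo --> (0 : R).
  by rewrite -(mulr0 C); apply: cvgM; [exact: cvg_cst|exact: cvg_harmonic].
have H' : (fun n : nat => - (C * n.+1%:R^-1)) @ \oo --> (0 : R).
  by rewrite -oppr0; exact: cvgN.
apply: squeeze_cvgr H' H; apply: nearW => n.
by rewrite -ler_norml.
Qed.

Lemma cvg_harmonic_bound R (u : nat -> R) (l C : R) :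
  (forall n, `|u n - l| <= C * n.+1%:R^-1) -> u @ \oo --> l.
Proof.
move=> /cvg0_harmonic_bound H.
have -> : u = (fun n => u n - l) \+ cst l by apply/funext => n /=; rewrite subrK.
rewrite -[X in _ --> X]add0r; apply: cvgD => //; exact: cvg_cst.
Qed.

Definition cintegrable (d : measure_display) (T : measurableType d) R
    (mu : {measure set T -> \bar R}) (D : set T) (f : T -> R[i]) : Prop :=
  mu.-integrable D (EFin \o (fun x => Re (f x))) /\
  mu.-integrable D (EFin \o (fun x => Im (f x))).

Definition cmeasurable (d : measure_display) (T : measurableType d) R
    (D : set T) (f : T -> R[i]) : Prop :=
  measurable_fun D (fun x => Re (f x)) /\ measurable_fun D (fun x => Im (f x)).

Section integrals.
Context (d : measure_display) (T : measurableType d) (R : realType).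
Context (mu : {measure set T -> \bar R}) (D : set T).

Lemma integrable_dominated (f g : T -> R) :
  measurable D -> measurable_fun D f -> mu.-integrable D (EFin \o g) ->
  (forall x, D x -> `|f x| <= g x) -> mu.-integrable D (EFin \o f).
Proof.
move=> mD mf ig fg; apply: le_integrable ig => //.
  exact/measurable_EFinP.
move=> x Dx /=; rewrite lee_fin; apply: le_trans (fg _ Dx) _; exact: ler_norm.
Qed.

Lemma cintegrable_dominated (f : T -> R[i]) (g : T -> R) :
  measurable D -> cmeasurable D f -> mu.-integrable D (EFin \o g) ->
  (forall x, D x -> normc (f x) <= g x) -> cintegrable mu D f.
Proof.
move=> mD [mRe mIm] ig fg; split; apply: integrable_dominated ig _ => // x Dx.
- exact: le_trans (Re_le_normc _) (fg _ Dx).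
- exact: le_trans (Im_le_normc _) (fg _ Dx).
Qed.

Lemma eq_cintegral (f g : T -> R[i]) :
  (forall x, D x -> f x = g x) -> cintegral mu D f = cintegral mu D g.
Proof.
move=> fg; rewrite /cintegral; congr (_ +i* _); apply: eq_Rintegral => x /set_mem Dx;
  by rewrite fg.
Qed.

Lemma cintegralD (f g : T -> R[i]) :
  measurable D -> cintegrable mu D f -> cintegrable mu D g ->
  cintegral mu D (fun x => f x + g x) = cintegral mu D f + cintegral mu D g.
Proof.
move=> mD [f1 f2] [g1 g2]; apply: complexP; rewrite /cintegral !cE /=.
- by rewrite -RintegralD//; apply: eq_Rintegral => x _; rewrite ReD.
- by rewrite -RintegralD//; apply: eq_Rintegral => x _; rewrite ImD.
Qed.

Lemma cintegralZ (c : R[i]) (f : T -> R[i]) :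
  measurable D -> cintegrable mu D f ->
  cintegral mu D (fun x => c * f x) = c * cintegral mu D f.
Proof.
move=> mD [f1 f2]; apply: complexP; rewrite /cintegral !cE /=.
- rewrite -!RintegralZl// -RintegralB//; first by apply: eq_Rintegral => x _; rewrite ReM.
  + exact: (integrableZl mD (Re c) f1).
  + exact: (integrableZl mD (Im c) f2).
- rewrite -!RintegralZl// -RintegralD//; first by apply: eq_Rintegral => x _; rewrite ImM.
  + exact: (integrableZl mD (Re c) f2).
  + exact: (integrableZl mD (Im c) f1).
Qed.

Lemma cintegrableD (f g : T -> R[i]) :
  measurable D -> cintegrable mu D f -> cintegrable mu D g ->
  cintegrable mu D (fun x => f x + g x).
Proof.
move=> mD [f1 f2] [g1 g2]; split.
- have := integrableD mD f1 g1; apply: eq_integrable => // x _; by rewrite /= ReD EFinD.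
- have := integrableD mD f2 g2; apply: eq_integrable => // x _; by rewrite /= ImD EFinD.
Qed.

Lemma cintegrableZ (c : R[i]) (f : T -> R[i]) :
  measurable D -> cintegrable mu D f -> cintegrable mu D (fun x => c * f x).
Proof.
move=> mD [f1 f2]; split.
- have := integrableB mD (integrableZl mD (Re c) f1) (integrableZl mD (Im c) f2).
  by apply: eq_integrable => // x _; rewrite /= ReM EFinB !EFinM.
- have := integrableD mD (integrableZl mD (Re c) f2) (integrableZl mD (Im c) f1).
  by apply: eq_integrable => // x _; rewrite /= ImM EFinD !EFinM.
Qed.

Lemma cintegralB (f g : T -> R[i]) :
  measurable D -> cintegrable mu D f -> cintegrable mu D g ->
  cintegral mu D (fun x => f x - g x) = cintegral mu D f - cintegral mu D g.
Proof.
move=> mD fi gi.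
rewrite (_ : (fun x => f x - g x) = fun x => f x + (-1) * g x); last first.
  by apply/funext => x; rewrite mulN1r.
rewrite cintegralD ?cintegralZ ?mulN1r//; exact: cintegrableZ.
Qed.

Lemma cintegrableB (f g : T -> R[i]) :
  measurable D -> cintegrable mu D f -> cintegrable mu D g ->
  cintegrable mu D (fun x => f x - g x).
Proof.
move=> mD fi gi.
rewrite (_ : (fun x => f x - g x) = fun x => f x + (-1) * g x); last first.
  by apply/funext => x; rewrite mulN1r.
by apply: cintegrableD => //; exact: cintegrableZ.
Qed.

Lemma normr_Rintegral_le (f g : T -> R) :
  measurable D -> mu.-integrable D (EFin \o f) -> mu.-integrable D (EFin \o g) ->
  (forall x, D x -> `|f x| <= g x) ->
  `|Rintegral mu D f| <= Rintegral mu D g.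
Proof.
move=> mD fi gi fg; apply: le_trans (le_normr_Rintegral mD fi) _.
by apply: le_Rintegral => //; exact: (integrable_norm fi).
Qed.

(** The factor 2 is the price for treating the real and the imaginary part
    separately. *)
Lemma normc_cintegral_le (f : T -> R[i]) (g : T -> R) :
  measurable D -> cintegrable mu D f -> mu.-integrable D (EFin \o g) ->
  (forall x, D x -> normc (f x) <= g x) ->
  normc (cintegral mu D f) <= 2 * Rintegral mu D g.
Proof.
move=> mD [f1 f2] gi fg; apply: le_trans (normc_le_ReIm _) _.
rewrite /cintegral /= mulr2n mulrDl !mul1r; apply: lerD; apply: normr_Rintegral_le => // x Dx.
- exact: le_trans (Re_le_normc _) (fg _ Dx).
- exact: le_trans (Im_le_normc _) (fg _ Dx).
Qed.

(** Dominated convergence, with the truncations of f to F n. *)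
Lemma cvg_Rintegral_exhaustion (F : nat -> set T) (f : T -> R) :
  measurable D -> (forall n, measurable (F n)) -> (forall n, F n `<=` D) ->
  (forall x, D x -> \forall n \near \oo, F n x) ->
  mu.-integrable D (EFin \o f) ->
  (fun n => Rintegral mu (F n) f) @ \oo --> Rintegral mu D f.
Proof.
move=> mD mF FD Fx fi.
have mf : measurable_fun D f by apply/measurable_EFinP; exact: measurable_int fi.
have E n : Rintegral mu (F n) f = fine (\int[mu]_(x in D) ((f \_ (F n)) x)%:E)%E.
  rewrite -[in LHS](setIidr (FD n)) /Rintegral integral_mkcondr.
  by congr fine; apply: eq_integral => x _; rewrite restrict_EFin.
under eq_fun do rewrite E.
rewrite /Rintegral; apply: fine_cvg; rewrite fineK; last exact: integrable_fin_num.
apply: (@dominated_cvg _ _ _ _ _ mD _ _ (fun x => `|f x|%:E)) => //.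
- move=> n; apply/measurable_EFinP; apply/measurable_restrict => //.
  by apply: measurable_funS mf => //; exact: subIsetl.
- move=> x Dx; apply: cvg_near_cst; near=> n.
  by rewrite /patch mem_set//; near: n; exact: Fx.
- exact: (integrable_norm fi).
- move=> n x Dx; rewrite lee_fin /patch; case: ifP => // _.
  by rewrite normr0.
Unshelve. all: by end_near. Qed.

Lemma integrable_exhaustion (F : nat -> set T) (f : T -> R) (M : R) :
  measurable D -> (forall n, measurable (F n)) ->
  {homo F : n m / (n <= m)%N >-> (n <= m)%O} -> D = \bigcup_i F i ->
  measurable_fun D f -> (forall x, D x -> 0 <= f x) ->
  (forall n, (\int[mu]_(x in F n) (f x)%:E <= M%:E)%E) ->
  mu.-integrable D (EFin \o f).
Proof.
move=> mD mF hF DE mf f0 hM; apply/integrableP; split; first exact/measurable_EFinP.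
have FD n : F n `<=` D by rewrite DE; exact: bigcup_sup.
rewrite (eq_integral (fun x => (f x)%:E)); last first.
  by move=> x /set_mem Dx; rewrite /= ger0_norm// f0.
apply: (@le_lt_trans _ _ M%:E); last exact: ltry.
have cv : (\int[mu]_(x in F i) (EFin \o f) x)%E @[i --> \oo] -->
    (\int[mu]_(x in D) (EFin \o f) x)%E.
  rewrite DE; apply: ge0_nondecreasing_set_cvg_integral => //.
  - by move=> i; apply/measurable_EFinP; apply: measurable_funS mf.
  - by move=> i x Fx; rewrite lee_fin f0//; exact: FD Fx.
rewrite -(cvg_lim _ cv)//; apply: lime_le; first exact: cvgP cv.
by apply: nearW => n; exact: hM.
Qed.

End integrals.

Lemma is_derive_continuous R (F : R -> R) (f x : R) :
  is_derive x 1 F f -> {for x, continuous F}.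
Proof.
move=> h; apply: differentiable_continuous; apply/derivable1_diffP.
exact: ex_derive.
Qed.

Lemma integral_derivative R (F f : R -> R) (a b : R) : a < b ->
  (forall x, a <= x <= b -> is_derive x 1 F (f x)) ->
  {within `[a, b], continuous f} ->
  (\int[@lebesgue_measure R]_(x in `[a, b]) (f x)%:E)%E = (F b - F a)%:E.
Proof.
move=> ab dF cf; rewrite (@continuous_FTC2 _ f F)// ?EFinB//.
- split.
  + move=> x; rewrite in_itv /= => /andP[/ltW ax /ltW xb].
    by have h := dF x; apply: ex_derive; apply: h; rewrite ax xb.
  + by apply: cvg_at_right_filter; apply: is_derive_continuous (dF _ _); rewrite lexx ltW.
  + by apply: cvg_at_left_filter; apply: is_derive_continuous (dF _ _); rewrite lexx ltW.
- move=> x; rewrite in_itv /= => /andP[/ltW ax /ltW xb].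
  by rewrite derive1E; apply: derive_val; apply: dF; rewrite ax xb.
Qed.

Lemma Rintegral_derivative R (F f : R -> R) (a b : R) : a < b ->
  (forall x, a <= x <= b -> is_derive x 1 F (f x)) ->
  {within `[a, b], continuous f} ->
  Rintegral (@lebesgue_measure R) `[a, b] f = F b - F a.
Proof. by move=> ab dF cf; rewrite /Rintegral (integral_derivative ab dF cf). Qed.

(** * Euler's integral *)

Local Notation leb R := (@lebesgue_measure R).

(** The modulus t^(x-1) exp(-t) of the integrand of Euler's integral. *)
Definition gamma_weight R (x t : R) : R := expR ((x - 1) * ln t - t).

Definition euler_kernel R (s : R[i]) (t : R) : R[i] :=
  cpow t (s - 1) * (expR (- t))%:C.

Lemma gamma_weight_ge0 R (x t : R) : 0 <= gamma_weight x t.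
Proof. exact: expR_ge0. Qed.

Lemma gamma_weightD1 R (x t : R) : 0 < t ->
  gamma_weight (x + 1) t = t * gamma_weight x t.
Proof.
move=> t0; rewrite /gamma_weight.
have -> : t * expR ((x - 1) * ln t - t) = expR (ln t) * expR ((x - 1) * ln t - t).
  by rewrite lnK ?posrE.
by rewrite -expRD; congr expR; ring.
Qed.

Lemma Re_euler_kernel R (s : R[i]) (t : R) :
  Re (euler_kernel s t) = gamma_weight (Re s) t * cos (Im s * ln t).
Proof.
case: s => x y; rewrite /euler_kernel /cpow /cexp /gamma_weight !cE /= oppr0 !mulr0 ?addr0.
by rewrite !add0r !subr0 mul0r !subr0 expRD; ring.
Qed.

Lemma Im_euler_kernel R (s : R[i]) (t : R) :
  Im (euler_kernel s t) = gamma_weight (Re s) t * sin (Im s * ln t).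
Proof.
case: s => x y; rewrite /euler_kernel /cpow /cexp /gamma_weight !cE /= oppr0 !mulr0 ?addr0.
by rewrite !add0r !subr0 mul0r !addr0 expRD; ring.
Qed.

Lemma normc_euler_kernel R (s : R[i]) (t : R) :
  normc (euler_kernel s t) = gamma_weight (Re s) t.
Proof.
rewrite /euler_kernel /cpow Normc.normcM normc_cexp normc_real ger0_norm ?expR_ge0//.
by rewrite !cE /= mulr0 subr0 /gamma_weight expRD.
Qed.

Lemma measurable_gamma_weight R (D : set R) (x : R) :
  measurable_fun D (gamma_weight x).
Proof.
apply: (measurableT_comp (@measurable_expR R)).
apply: measurable_funB => //; apply: measurable_funM => //.
by apply: measurable_funTS; exact: measurable_ln.
Qed.

Lemma measurable_trig_ln R (D : set R) (y : R) :
  measurable_fun D (fun t => cos (y * ln t)) /\ measurable_fun D (fun t => sin (y * ln t)).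
Proof.
have h : measurable_fun D (fun t => y * ln t).
  by apply: measurable_funM => //; apply: measurable_funTS; exact: measurable_ln.
split.
- apply: (measurableT_comp _ h); apply: continuous_measurable_fun; exact: continuous_cos.
- apply: (measurableT_comp _ h); apply: continuous_measurable_fun; exact: continuous_sin.
Qed.

Lemma cmeasurable_euler_kernel R (D : set R) (s : R[i]) :
  cmeasurable D (euler_kernel s).
Proof.
have [m1 m2] := measurable_trig_ln D (Im s).
split.
- under eq_fun do rewrite Re_euler_kernel.
  by apply: measurable_funM => //; exact: measurable_gamma_weight.
- under eq_fun do rewrite Im_euler_kernel.
  by apply: measurable_funM => //; exact: measurable_gamma_weight.
Qed.

(** The tangent of ln at k; it is used to bound t^k exp(-t) by its maximum. *)
Lemma ln_le_linear R (k t : R) : 0 < k -> 0 < t ->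
  k * ln t <= t + (k * ln k - k).
Proof.
move=> k0 t0.
have kn0 : k != 0 by rewrite gt_eqF.
have h : 0 < t / k by rewrite divr_gt0.
have := @le_ln1Dx R (t / k - 1); rewrite (_ : 1 + (t / k - 1) = t / k); last by ring.
rewrite lnM ?posrE// ?invr_gt0// lnV ?posrE// => H.
have : ln t - ln k <= t / k - 1 by apply: H; lra.
rewrite -(ler_pM2l k0) mulrBr mulrBr mulrCA divff// mulr1 mulr1; lra.
Qed.

(** Compact intervals exhausting the half line, symmetric for the logarithm. *)
Definition log_itv R (n : nat) : set R :=
  [set` `[expR (- n.+1%:R), expR n.+1%:R]].

Lemma log_itv_homo R :
  {homo @log_itv R : n m / (n <= m)%N >-> (n <= m)%O}.
Proof.
move=> n m nm; rewrite subsetEset => x; rewrite /log_itv /= !in_itv /= => /andP[a b].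
have h : n.+1%:R <= m.+1%:R :> R by rewrite ler_nat.
by rewrite (le_trans _ a) ?(le_trans b)// ler_expR// lerN2.
Qed.

Lemma log_itv_sub R n : @log_itv R n `<=` `]0, +oo[.
Proof.
move=> x; rewrite /log_itv /= !in_itv /= andbT => /andP[a _].
by rewrite (lt_le_trans _ a)// expR_gt0.
Qed.

Lemma log_itv_in R (x : R) n : 0 < x -> `|ln x| <= n.+1%:R -> @log_itv R n x.
Proof.
move=> x0; rewrite ler_norml => /andP[a b]; rewrite /log_itv /= in_itv /=.
by rewrite -[x](lnK _) ?posrE// !ler_expR a b.
Qed.

Lemma log_itv_near R (x : R) : `]0, +oo[%classic x ->
  \forall n \near \oo, @log_itv R n x.
Proof.
rewrite /= in_itv /= andbT => x0.
exists (Num.truncn `|ln x|) => // n /= hn; apply: log_itv_in => //.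
have := truncnS_gt `|ln x|; move/ltW/le_trans; apply; rewrite ler_nat.
by rewrite ltnS.
Qed.

Lemma bigcup_log_itv R : `]0, +oo[%classic = \bigcup_n @log_itv R n.
Proof.
apply/seteqP; split => x; last by move=> [n _]; exact: log_itv_sub.
by move=> /log_itv_near[n _ h]; exists n => //; exact: (h n (leqnn n)).
Qed.

Lemma is_derive_expR_ln R (c k t : R) : 0 < t ->
  is_derive t 1 (fun t => expR (c * ln t - k * t)) ((c / t - k) * expR (c * ln t - k * t)).
Proof.
move=> t0.
have h : is_derive t 1 (fun t => c * ln t - k * t) (c / t - k).
  have h1 := is_derive1_ln t0.
  have -> : (fun t => c * ln t - k * t) = (c \*: @ln R) - (k \*: id) by [].
  apply: is_derive_eq.
  by rewrite /GRing.scale/= mulr1.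
by rewrite mulrC; exact: (is_derive1_comp (f := expR) (g := fun t => c * ln t - k * t)).
Qed.

(** With p = t^x, the function -1 / (x (1 + p)) is bounded and its derivative
    p / (t (1 + p)^2) is comparable to t^(x-1) near 0. *)
Lemma is_derive_logistic R (x t : R) : 0 < x -> 0 < t ->
  is_derive t 1 (fun t => - (x * (1 + expR (x * ln t - 0 * t)))^-1)
    (expR (x * ln t - 0 * t) / (t * (1 + expR (x * ln t - 0 * t)) ^+ 2)).
Proof.
move=> x0 t0; have h := is_derive_expR_ln x 0 t0.
set p := fun t => _ in h.
have p0 : 0 < p t by exact: expR_gt0.
have n0 : x * (1 + p t) != 0 by rewrite mulf_neq0// gt_eqF// addr_gt0.
have h2 : is_derive t 1 (fun t => x * (1 + p t)) (x * (x / t * p t)).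
  have -> : (fun t => x * (1 + p t)) = x \*: (cst 1 + p) by [].
  apply: is_derive_eq.
  by rewrite /GRing.scale/= add0r subr0.
have h3 := @is_deriveV R (fun t => x * (1 + p t)) t _ 1 n0 h2.
have -> : (fun t => - (x * (1 + p t))^-1) = - (fun t => (x * (1 + p t))^-1) by [].
apply: is_derive_eq; rewrite /GRing.scale/=.
have x1 : x != 0 by rewrite gt_eqF.
have t1 : t != 0 by rewrite gt_eqF.
have p1 : 1 + p t != 0 by rewrite gt_eqF// addr_gt0.
rewrite -/(p t); move: (p t) p1 => q q1; field.
by rewrite t1 x1 q1.
Qed.

(** The weight t^(x-1) exp(-t) is at most a constant times the derivative of
    the bounded function of [is_derive_logistic], because (1 + t^x)^2 is at
    most a constant times exp(t). *)
Lemma gamma_weight_integrable R (x : R) : 0 < x ->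
  (leb R).-integrable `]0, +oo[ (EFin \o gamma_weight x).
Proof.
move=> x0.
pose p t := expR (x * ln t - 0 * t).
pose f t := p t / (t * (1 + p t) ^+ 2).
pose F t := - (x * (1 + p t))^-1.
(* The second summand is twice the maximum of t^(2x) exp(-t). *)
pose C : R := 2 + 2 * expR (2 * x * ln (2 * x) - 2 * x).
have C0 : 0 < C by rewrite addr_gt0// mulr_gt0// expR_gt0.
have p0 t : 0 < p t by exact: expR_gt0.
have pE (t : R) : 0 < t -> p t = t * gamma_weight x t * expR t.
  move=> t0; rewrite -gamma_weightD1// /gamma_weight -expRD /p; congr expR; ring.
have Wf (t : R) : 0 < t -> gamma_weight x t <= C * f t.
  move=> t0.
  have h1 : (1 + p t) ^+ 2 <= C * expR t.
    have h2 : p t ^+ 2 <= expR t * expR (2 * x * ln (2 * x) - 2 * x).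
      rewrite -expRD /p -expRM_natl mul0r subr0 ler_expR mulrA.
      by apply: ln_le_linear => //; rewrite mulr_gt0.
    have h3 : 1 <= expR t by rewrite -expR0 ler_expR ltW.
    by rewrite /C; have := sqr_ge0 (1 - p t); nra.
  rewrite /f {1}pE//.
  have q0 : 0 < (1 + p t) ^+ 2 by rewrite exprn_gt0// addr_gt0.
  rewrite (_ : _ * _ = gamma_weight x t * (C * expR t / (1 + p t) ^+ 2)); last first.
    by field; rewrite (gt_eqF t0)/= gt_eqF// addr_gt0.
  by rewrite ler_peMr ?gamma_weight_ge0// ler_pdivlMr// mul1r.
have dF (t : R) : 0 < t -> is_derive t 1 F (f t) by exact: is_derive_logistic.
have E0 n (t : R) : log_itv n t -> 0 < t.
  by move=> /log_itv_sub; rewrite /= in_itv/= andbT.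
have cp (t : R) : 0 < t -> {for t, continuous p}.
  by move=> t0; exact: is_derive_continuous (is_derive_expR_ln x 0 t0).
have cf n : {within log_itv n, continuous f}.
  apply: continuous_in_subspaceT => t /set_mem/E0 t0.
  apply: cvgM; first exact: cp.
  apply: cvgV; first by rewrite mulf_neq0 ?expf_neq0// gt_eqF// addr_gt0.
  apply: cvgM; first exact: cvg_id.
  by apply: cvgM; (apply: cvgD; [exact: cvg_cst|exact: cp]).
have mE n : measurable (@log_itv R n) by exact: measurable_itv.
apply: (@integrable_exhaustion _ _ R (leb R) `]0, +oo[%classic (@log_itv R) (gamma_weight x) (C * x^-1)) => //.
- exact: log_itv_homo.
- exact: bigcup_log_itv.
- exact: measurable_gamma_weight.
- by move=> t _; exact: gamma_weight_ge0.
move=> n.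
have mf : measurable_fun (log_itv n) f by exact: subspace_continuous_measurable_fun.
apply: (@le_trans _ _ (\int[leb R]_(t in log_itv n) (C%:E * (f t)%:E))%E).
  apply: ge0_le_integral => //.
  - exact: mE.
  - by move=> t _; rewrite lee_fin gamma_weight_ge0.
  - by apply/measurable_EFinP; exact: measurable_gamma_weight.
  - by apply/measurable_EFinP; apply: measurable_funM.
  - by move=> t /E0 t0; rewrite -EFinM lee_fin Wf.
rewrite ge0_integralZl ?lee_fin ?(ltW C0)//; last 3 first.
- exact: mE.
- by apply/measurable_EFinP.
- move=> t /E0 t0; rewrite lee_fin divr_ge0 ?(ltW (p0 t))//.
  by rewrite mulr_ge0 ?(ltW t0)// exprn_ge0// addr_ge0// ltW.
have -> : (\int[leb R]_(t in log_itv n) (f t)%:E)%E =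
    (F (expR n.+1%:R) - F (expR (- n.+1%:R)))%:E.
  apply: integral_derivative.
  - by rewrite ltr_expR; apply: (@lt_trans _ _ 0); rewrite ?oppr_lt0 ltr0n.
  - by move=> t /andP[a _]; apply: dF; apply: lt_le_trans a; exact: expR_gt0.
  - exact: cf.
rewrite -EFinM lee_fin ler_pM2l// /F opprK.
set q := expR n.+1%:R; set r := expR (- n.+1%:R).
have a1 : 0 <= (x * (1 + p q))^-1.
  by rewrite invr_ge0 mulr_ge0// ?(ltW x0)// addr_ge0// ltW.
have : (x * (1 + p r))^-1 <= x^-1.
  rewrite lef_pV2 ?posrE ?mulr_gt0 ?addr_gt0//.
  by rewrite ler_peMr ?(ltW x0)// lerDl ltW.
by move=> a2; lra.
Qed.

(** A dominating function for the second derivative in s of t^(s-1) exp(-t),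
    uniform for Re s in [x0, x1]: the two factors ln t are absorbed by
    t^(x0/2) + t^(-x0/2). *)
Lemma gamma_weight_ln2_le R (x0 x1 x t : R) : 0 < x0 -> x0 <= x <= x1 ->
  (1 + ln t ^+ 2) * gamma_weight x t <= (1 + 16 / x0 ^+ 2) *
    (gamma_weight (x0 / 2) t + gamma_weight (x1 + x0 / 2) t).
Proof.
move=> h0 /andP[h1 h2]; rewrite /gamma_weight; set L := ln t.
pose e := x0 / 2.
have e0 : 0 < e by rewrite divr_gt0.
have s1 : 1 + L ^+ 2 <= (1 + 16 / x0 ^+ 2) * expR (e * `|L|).
  have a0 : 0 <= e * `|L| by rewrite mulr_ge0 ?(ltW e0).
  have a1 : 1 + e * `|L| / 2 <= expR (e * `|L| / 2) := expR_ge1Dx _.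
  have a2 : (1 + e * `|L| / 2) ^+ 2 <= expR (e * `|L|).
    have -> : expR (e * `|L|) = expR (e * `|L| / 2) ^+ 2.
      by rewrite expr2 -expRD; congr expR; lra.
    by rewrite lerXn2r ?nnegrE ?expR_ge0// addr_ge0// divr_ge0.
  have a3 : L ^+ 2 <= 16 / x0 ^+ 2 * expR (e * `|L|).
    rewrite mulrAC ler_pdivlMr ?exprn_gt0//.
    have : x0 = 2 * e by rewrite /e mulrC divfK.
    move=> ->; rewrite -(real_normK (num_real L)); nra.
  have a4 : 1 <= expR (e * `|L|) by rewrite -expR0 ler_expR.
  by rewrite mulrDl mul1r; apply: lerD.
have s2 : expR (e * `|L|) * expR ((x - 1) * L - t) <=
   expR ((x0 / 2 - 1) * L - t) + expR ((x1 + x0 / 2 - 1) * L - t).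
  rewrite -expRD; have [L0|L0] := leP 0 L.
    rewrite ger0_norm//; apply: (@le_trans _ _ (expR ((x1 + x0 / 2 - 1) * L - t))); last first.
      by rewrite lerDr expR_ge0.
    by rewrite ler_expR /e; nra.
  rewrite ltr0_norm//; apply: (@le_trans _ _ (expR ((x0 / 2 - 1) * L - t))); last first.
    by rewrite lerDl expR_ge0.
  by rewrite ler_expR /e; nra.
have K0 : 0 <= 1 + 16 / x0 ^+ 2 by rewrite addr_ge0// divr_ge0// exprn_ge0 ?(ltW h0).
apply: le_trans (ler_wpM2r (expR_ge0 _) s1) _.
by rewrite -mulrA ler_wpM2l.
Qed.

Definition rect R (x0 x1 T : R) : set R[i] :=
  [set s | x0 <= Re s <= x1 /\ `|Im s| <= T].

Lemma rect_diam R (x0 x1 T : R) s w :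
  rect x0 x1 T s -> rect x0 x1 T w -> normc (w - s) <= (x1 - x0) + 2 * T.
Proof.
move=> [/andP[a b] c] [/andP[a' b'] c'].
apply: le_trans (normc_le_ReIm _) _; apply: lerD; rewrite !cE.
  by rewrite ler_norml; apply/andP; split; lra.
by apply: le_trans (ler_normB _ _) _; lra.
Qed.

(** On a bounded set the Lipschitz bound follows from the other ones. *)
Lemma holo_rect R (x0 x1 T C : R) (F F' : R[i] -> R[i]) : 0 <= C ->
  (forall s, rect x0 x1 T s -> normc (F s) <= C /\ normc (F' s) <= C) ->
  (forall s w, rect x0 x1 T s -> rect x0 x1 T w ->
     normc (F w - F s - F' s * (w - s)) <= C * normc (w - s) ^+ 2) ->
  holo (rect x0 x1 T) F.
Proof.
move=> C0 hb hq; pose M := `|(x1 - x0) + 2 * T|.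
have M0 : 0 <= M := normr_ge0 _.
have CM : 0 <= C * M by rewrite mulr_ge0.
exists F', (C + C * M); first by rewrite addr_ge0.
move=> s w Ds Dw; have [a1 a2] := hb s Ds; have a3 := hq s w Ds Dw.
have n0 := normc_ge0 (w - s).
have dM : normc (w - s) <= M by apply: le_trans (rect_diam Ds Dw) (ler_norm _).
split; [lra|lra| |].
- rewrite (_ : F w - F s = (F w - F s - F' s * (w - s)) + F' s * (w - s)); last by ring.
  apply: le_trans (normcD_le _ _) _; rewrite [X in _ + X]Normc.normcM.
  by have := ler_wpM2r n0 a2; have := ler_wpM2l (mulr_ge0 C0 n0) dM; rewrite expr2 in a3; lra.
- by apply: le_trans a3 _; rewrite ler_wpM2r ?exprn_ge0//; lra.
Qed.

Lemma normc_cpow R (t : R) (s : R[i]) :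
  normc (cpow t s) = expR (Re s * ln t).
Proof. by rewrite /cpow normc_cexp !cE /= mulr0 subr0. Qed.

Lemma cpowD R (t : R) (s w : R[i]) : cpow t (s + w) = cpow t s * cpow t w.
Proof. by rewrite /cpow mulrDl cexpD. Qed.

Lemma cpow_taylor1 R (t : R) (s w : R[i]) :
  normc (cpow t w - cpow t s - (ln t)%:C * cpow t s * (w - s)) <=
  5 * (ln t ^+ 2 * (expR (Re s * ln t) + expR (Re w * ln t))) * normc (w - s) ^+ 2.
Proof.
have E : cpow t w = cpow t s * cexp ((w - s) * (ln t)%:C).
  by rewrite -{1}(subrK s w) addrC cpowD.
rewrite E (_ : _ - _ = cpow t s * (cexp ((w - s) * (ln t)%:C) - 1 - (w - s) * (ln t)%:C));
  last by ring.
rewrite Normc.normcM; apply: le_trans (ler_wpM2l (normc_ge0 _) (cexp_taylor1 _)) _.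
rewrite normc_cpow Normc.normcM normc_real.
have -> : expR (Re w * ln t) = expR (Re s * ln t) * expR (Re ((w - s) * (ln t)%:C)).
  by rewrite -expRD; congr expR; rewrite !cE /=; ring.
rewrite exprMn (real_normK (num_real _)).
by apply: le_of_eq; ring.
Qed.

Lemma holo_cpow R (x0 x1 T : R) (z : R) : holo (rect x0 x1 T) (cpow z).
Proof.
pose L := ln z; pose E := expR (x0 * L) + expR (x1 * L).
have E0 : 0 <= E by rewrite addr_ge0 ?expR_ge0.
have hE s : rect x0 x1 T s -> expR (Re s * L) <= E.
  move=> [/andP[a b] _]; have [L0|L0] := leP 0 L.
    apply: (@le_trans _ _ (expR (x1 * L))); last by rewrite lerDr expR_ge0.
    by rewrite ler_expR ler_wpM2r.
  apply: (@le_trans _ _ (expR (x0 * L))); last by rewrite lerDl expR_ge0.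
  by rewrite ler_expR ler_wnM2r// ltW.
have q1 : 0 <= `|L| * E by rewrite mulr_ge0.
have q2 : 0 <= L ^+ 2 * E by rewrite mulr_ge0// sqr_ge0.
apply: (@holo_rect _ _ _ _ (E + `|L| * E + 10 * (L ^+ 2 * E)) _
  (fun s => L%:C * cpow z s)); first by lra.
- move=> s Ds; rewrite normc_cpow [normc (_ * _)]Normc.normcM normc_real normc_cpow -/L.
  by have h := hE s Ds; have := ler_wpM2l (normr_ge0 L) h; split; lra.
- move=> s w Ds Dw; apply: le_trans (cpow_taylor1 _ _ _) _; rewrite -/L.
  rewrite ler_wpM2r ?exprn_ge0 ?normc_ge0//.
  have h := lerD (hE s Ds) (hE w Dw); have := ler_wpM2l (sqr_ge0 L) h; lra.
Qed.

Lemma cintegrable_euler_kernel R (s : R[i]) : 0 < Re s ->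
  cintegrable (leb R) `]0, +oo[ (euler_kernel s).
Proof.
move=> s0; apply: cintegrable_dominated (gamma_weight_integrable s0) _ => //.
  exact: cmeasurable_euler_kernel.
by move=> t _; rewrite normc_euler_kernel.
Qed.

Lemma cmeasurableM_real (d : measure_display) (T : measurableType d) R
    (D : set T) (f : T -> R[i]) (g : T -> R) :
  cmeasurable D f -> measurable_fun D g -> cmeasurable D (fun t => f t * (g t)%:C).
Proof.
move=> [f1 f2] mg; split.
- under eq_fun do rewrite ReM /= mulr0 subr0; exact: measurable_funM.
- under eq_fun do rewrite ImM /= mulr0 add0r; exact: measurable_funM.
Qed.

Lemma euler_gammaE R (s : R[i]) :
  euler_gamma s = cintegral (leb R) `]0, +oo[ (euler_kernel s).
Proof. by []. Qed.

(** Differentiation under the integral sign: the second order estimate for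
    cpow is integrated against exp(-t), with the domination of
    [gamma_weight_ln2_le]. *)
Lemma holo_euler_gamma R (x0 x1 T : R) : 0 < x0 ->
  holo (rect x0 x1 T) (@euler_gamma R).
Proof.
move=> x00.
have [x01|x01] := leP x0 x1; last first.
  exists (fun=> 0), 0 => // s w [/andP[a b] _]; lra.
pose H t := gamma_weight (x0 / 2) t + gamma_weight (x1 + x0 / 2) t.
pose B : R := 1 + 16 / x0 ^+ 2.
have B0 : 0 <= B by rewrite addr_ge0// divr_ge0// exprn_ge0// ltW.
have mD : measurable (`]0, +oo[%classic : set (measurableTypeR R)) by exact: measurable_itv.
have iH : (leb R).-integrable `]0, +oo[ (EFin \o H).
  have := integrableD mD (gamma_weight_integrable (_ : 0 < x0 / 2))
     (gamma_weight_integrable (_ : 0 < x1 + x0 / 2)).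
  by apply; rewrite ?divr_gt0 ?addr_gt0 ?divr_gt0// (lt_le_trans x00).
have H0 t : 0 <= H t by rewrite addr_ge0 ?gamma_weight_ge0.
have WH s t : rect x0 x1 T s -> (1 + ln t ^+ 2) * gamma_weight (Re s) t <= B * H t.
  by move=> [h _]; exact: gamma_weight_ln2_le.
pose k1 (s : R[i]) (t : R) := euler_kernel s t * (ln t)%:C.
have iBH c : (leb R).-integrable `]0, +oo[ (EFin \o (fun t => c * H t)).
  by have := integrableZl mD c iH; apply: eq_integrable.
have RBH c : Rintegral (leb R) `]0, +oo[ (fun t => c * H t) =
    c * Rintegral (leb R) `]0, +oo[ H by rewrite RintegralZl.
have k1_le s t : rect x0 x1 T s -> normc (k1 s t) <= B * H t.
  move=> Ds; rewrite /k1 Normc.normcM normc_euler_kernel normc_real.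
  apply: le_trans _ (WH s t Ds); rewrite mulrC ler_wpM2r ?gamma_weight_ge0//.
  by have := sqr_ge0 (`|ln t| - 1); rewrite -(real_normK (num_real (ln t))); nra.
have k0_le s t : rect x0 x1 T s -> normc (euler_kernel s t) <= B * H t.
  move=> Ds; rewrite normc_euler_kernel; apply: le_trans _ (WH s t Ds).
  by rewrite ler_peMl ?gamma_weight_ge0// lerDl sqr_ge0.
have ik0 s : rect x0 x1 T s -> cintegrable (leb R) `]0, +oo[ (euler_kernel s).
  by move=> [/andP[a _] _]; apply: cintegrable_euler_kernel; apply: lt_le_trans a.
have ik1 s : rect x0 x1 T s -> cintegrable (leb R) `]0, +oo[ (k1 s).
  move=> Ds; apply: (cintegrable_dominated mD _ (iBH B)) => [|t _]; last exact: k1_le.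
  apply: cmeasurableM_real; first exact: cmeasurable_euler_kernel.
  by apply: measurable_funTS; exact: measurable_ln.
pose I := Rintegral (leb R) `]0, +oo[ H.
have I0 : 0 <= I by apply: Rintegral_ge0 => t _; exact: H0.
have BI : 0 <= B * I by rewrite mulr_ge0.
apply: (@holo_rect _ _ _ _ (20 * (B * I)) _
   (fun s => cintegral (leb R) `]0, +oo[ (k1 s))); first by lra.
- move=> s Ds; rewrite euler_gammaE; split.
  + apply: le_trans (normc_cintegral_le mD (ik0 s Ds) (iBH B) _) _.
      by move=> t _; exact: k0_le.
    by rewrite RBH -/I; lra.
  + apply: le_trans (normc_cintegral_le mD (ik1 s Ds) (iBH B) _) _.
      by move=> t _; exact: k1_le.
    by rewrite RBH -/I; lra.
- move=> s w Ds Dw; rewrite !euler_gammaE -cintegralB//; [|exact: ik0|exact: ik0].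
  rewrite [X in _ - X]mulrC -cintegralZ//; last exact: ik1.
  rewrite -cintegralB//; last 2 first.
  + by apply: cintegrableB => //; exact: ik0.
  + by apply: cintegrableZ => //; exact: ik1.
  pose c := 10 * B * normc (w - s) ^+ 2.
  apply: (@le_trans _ _ (2 * Rintegral (leb R) `]0, +oo[ (fun t => c * H t))); last first.
    by rewrite RBH /c -/I; apply: le_of_eq; ring.
  apply: normc_cintegral_le => //.
  + apply: cintegrableB => //; first by apply: cintegrableB => //; exact: ik0.
    by apply: cintegrableZ => //; exact: ik1.
  + move=> t _; rewrite /k1 /euler_kernel.
    rewrite (_ : _ - _ = (cpow t (w - 1) - cpow t (s - 1)
        - (ln t)%:C * cpow t (s - 1) * ((w - 1) - (s - 1))) * (expR (- t))%:C); last by ring.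
    rewrite Normc.normcM normc_real ger0_norm ?expR_ge0//.
    apply: le_trans (ler_wpM2r (expR_ge0 _) (cpow_taylor1 _ _ _)) _.
    have -> : (w - 1) - (s - 1) = w - s by ring.
    have a1 := WH s t Ds; have a2 := WH w t Dw.
    have e1 (x : R[i]) : expR (Re (x - 1) * ln t) * expR (- t) = gamma_weight (Re x) t.
      by rewrite /gamma_weight expRD !cE.
    rewrite (_ : _ * _ = 5 * normc (w - s) ^+ 2 * (ln t ^+ 2 * gamma_weight (Re s) t +
       ln t ^+ 2 * gamma_weight (Re w) t)); last by rewrite -!e1; ring.
    rewrite /c; have d2 : 0 <= normc (w - s) ^+ 2 by rewrite exprn_ge0// normc_ge0.
    have b1 := gamma_weight_ge0 (Re s) t; have b2 := gamma_weight_ge0 (Re w) t.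
    have : ln t ^+ 2 * gamma_weight (Re s) t + ln t ^+ 2 * gamma_weight (Re w) t <=
        2 * (B * H t) by lra.
    by move/(ler_wpM2l d2); lra.
Qed.

(** This is the integration by parts behind the functional equation of Gamma. *)
Lemma is_derive_euler_kernel R (s : R[i]) (t : R) : 0 < t ->
  is_derive t 1 (fun t => Re (euler_kernel (s + 1) t))
    (Re (s * euler_kernel s t - euler_kernel (s + 1) t)) /\
  is_derive t 1 (fun t => Im (euler_kernel (s + 1) t))
    (Im (s * euler_kernel s t - euler_kernel (s + 1) t)).
Proof.
move=> t0; set x := Re s; set y := Im s.
pose W t := expR (x * ln t - 1 * t).
have hW := is_derive_expR_ln x 1 t0; rewrite -/(W t) in hW.
have hl : is_derive t 1 (fun t => y * ln t) (y / t).
  have h1 := is_derive1_ln t0.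
  have -> : (fun t => y * ln t) = y \*: @ln R by [].
  by apply: is_derive_eq.
have hc := is_derive1_comp (f := cos) (g := fun t => y * ln t) _ hl.
have {}hc := hc _ (is_derive_cos _).
have hs := is_derive1_comp (f := sin) (g := fun t => y * ln t) _ hl.
have {}hs := hs _ (is_derive_sin _).
have tn0 : t != 0 by rewrite gt_eqF.
have WE : W t = t * gamma_weight x t.
  by rewrite -gamma_weightD1// /gamma_weight /W; congr expR; ring.
have W1 u : gamma_weight (x + 1) u = W u.
  by rewrite /gamma_weight /W; congr expR; ring.
have s1 : Re (s + 1) = x + 1 by rewrite !cE.
have s2 : Im (s + 1) = y by rewrite !cE /= addr0.
split.
- have -> : (fun t => Re (euler_kernel (s + 1) t)) = W * (cos \o (fun t => y * ln t)).
    by apply/funext => u; rewrite Re_euler_kernel !(s1, s2) W1.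
  apply: is_derive_eq; rewrite /GRing.scale/= ReD ReN [Re (s * _)]ReM !Re_euler_kernel Im_euler_kernel !(s1, s2).
  rewrite W1 WE -/x -/y; field; exact: tn0.
- have -> : (fun t => Im (euler_kernel (s + 1) t)) = W * (sin \o (fun t => y * ln t)).
    by apply/funext => u; rewrite Im_euler_kernel !(s1, s2) W1.
  apply: is_derive_eq; rewrite /GRing.scale/= ImD ImN [Im (s * _)]ImM !Im_euler_kernel Re_euler_kernel !(s1, s2).
  rewrite W1 WE -/x -/y; field; exact: tn0.
Qed.

Lemma continuous_euler_kernel R (s : R[i]) (t : R) : 0 < t ->
  {for t, continuous (fun t => Re (euler_kernel s t))} /\
  {for t, continuous (fun t => Im (euler_kernel s t))}.
Proof.
move=> t0; have [] := is_derive_euler_kernel (s - 1) t0; rewrite subrK.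
by move=> /is_derive_continuous ? /is_derive_continuous.
Qed.

(** The boundary terms t^x exp(-t) at the ends of [log_itv n]. *)
Lemma gamma_weight_ends R (x : R) : 0 < x -> exists2 C : R, 0 <= C &
  forall n : nat, gamma_weight (x + 1) (expR n.+1%:R) + gamma_weight (x + 1) (expR (- n.+1%:R))
    <= C * n.+1%:R^-1.
Proof.
move=> x0; set c := expR ((x + 1) * ln (x + 1) - (x + 1)).
exists (c + x^-1) => [|n]; first by rewrite addr_ge0 ?expR_ge0// invr_ge0 ltW.
set N : R := n.+1%:R.
have N0 : 0 < N by rewrite ltr0n.
have h (k : R) : 0 < k -> expR (- (k * N)) <= (k * N)^-1.
  move=> k0; rewrite expRN lef_pV2 ?posrE ?expR_gt0 ?mulr_gt0//.
  by apply: le_trans (expR_ge1Dx _); rewrite lerDr.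
rewrite mulrDl; apply: lerD.
- apply: (@le_trans _ _ (c * expR (- (1 * N)))); last first.
    by rewrite ler_wpM2l ?expR_ge0//; have := h 1 ltr01; rewrite mul1r.
  rewrite /c -expRD ler_expR expRK.
  have := @ln_le_linear R (x + 1) (expR N); rewrite expRK => /(_ _ (expR_gt0 _)).
  by rewrite addr_gt0// => /(_ isT); lra.
- apply: (@le_trans _ _ (expR (- (x * N)))); last first.
    by rewrite -invfM h.
  by rewrite ler_expR expRK; have := expR_gt0 (- N); lra.
Qed.

(** The function s t^(s-1) exp(-t) - t^s exp(-t) is the derivative of
    t^s exp(-t), which vanishes at both ends of the half line. *)
Lemma euler_gammaS R (s : R[i]) : 0 < Re s ->
  euler_gamma (s + 1) = s * euler_gamma s.
Proof.
move=> s0.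
pose f t := s * euler_kernel s t - euler_kernel (s + 1) t.
have mD : measurable (`]0, +oo[%classic : set (measurableTypeR R)) by exact: measurable_itv.
have s10 : 0 < Re (s + 1) by rewrite !cE addr_gt0.
have i1 := cintegrable_euler_kernel s0.
have i2 := cintegrable_euler_kernel s10.
have fi : cintegrable (leb R) `]0, +oo[ f.
  by apply: cintegrableB => //; exact: cintegrableZ.
have fE : cintegral (leb R) `]0, +oo[ f = s * euler_gamma s - euler_gamma (s + 1).
  by rewrite cintegralB ?cintegralZ//; exact: cintegrableZ.
suff f0 : cintegral (leb R) `]0, +oo[ f = 0.
  by apply/eqP; rewrite eq_sym -subr_eq0 -fE f0.
have cf t : 0 < t -> {for t, continuous (fun t => Re (f t))} /\
    {for t, continuous (fun t => Im (f t))}.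
  move=> t0; have [a1 a2] := continuous_euler_kernel s t0.
  have [b1 b2] := continuous_euler_kernel (s + 1) t0.
  split.
  - have -> : (fun t => Re (f t)) = (fun t => (Re s * Re (euler_kernel s t)
       - Im s * Im (euler_kernel s t)) - Re (euler_kernel (s + 1) t)).
      by apply/funext => u; rewrite /f ReD ReM ReN.
    by apply: cvgB => //; apply: cvgB; apply: cvgM => //; exact: cvg_cst.
  - have -> : (fun t => Im (f t)) = (fun t => (Re s * Im (euler_kernel s t)
       + Im s * Re (euler_kernel s t)) - Im (euler_kernel (s + 1) t)).
      by apply/funext => u; rewrite /f ImD ImM ImN.
    by apply: cvgB => //; apply: cvgD; apply: cvgM => //; exact: cvg_cst.
have [C C0 hC] := gamma_weight_ends s0.
have key (V g : R -> R) : (forall t : R, 0 < t -> is_derive t 1 V (g t)) ->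
    (forall t : R, 0 < t -> {for t, continuous g}) ->
    (forall t, `|V t| <= gamma_weight (Re s + 1) t) ->
    (leb R).-integrable `]0, +oo[ (EFin \o g) -> Rintegral (leb R) `]0, +oo[ g = 0.
  move=> dV cg hV ig.
  have cv := @cvg_Rintegral_exhaustion _ _ R (leb R) `]0, +oo[%classic (@log_itv R) g mD
    (fun n => measurable_itv _) (@log_itv_sub R) (@log_itv_near R) ig.
  apply: (cvg_unique _ cv) => //.
  have E n : Rintegral (leb R) (log_itv n) g = V (expR n.+1%:R) - V (expR (- n.+1%:R)).
    apply: Rintegral_derivative.
    - by rewrite ltr_expR; apply: (@lt_trans _ _ 0); rewrite ?oppr_lt0 ltr0n.
    - by move=> t /andP[a _]; apply: dV; apply: lt_le_trans a; exact: expR_gt0.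
    - apply: continuous_in_subspaceT => t /set_mem/log_itv_sub /=.
      by rewrite in_itv/= andbT; exact: cg.
  apply: (@cvg0_harmonic_bound _ _ C) => n; rewrite E.
  apply: le_trans (ler_normB _ _) _; apply: le_trans (lerD (hV _) (hV _)) _.
  exact: hC.
have nV t : normc (euler_kernel (s + 1) t) = gamma_weight (Re s + 1) t.
  by rewrite normc_euler_kernel !cE.
apply: complexP; rewrite /cintegral /=.
- apply: (key (fun t => Re (euler_kernel (s + 1) t)) (fun t => Re (f t))).
  + by move=> t t0; have [] := is_derive_euler_kernel s t0.
  + by move=> t /cf[].
  + by move=> t; rewrite -nV Re_le_normc.
  + by case: fi.
- apply: (key (fun t => Im (euler_kernel (s + 1) t)) (fun t => Im (f t))).
  + by move=> t t0; have [] := is_derive_euler_kernel s t0.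
  + by move=> t /cf[].
  + by move=> t; rewrite -nV Im_le_normc.
  + by case: fi.
Qed.

Lemma euler_gamma1 R : euler_gamma (1 : R[i]) = 1.
Proof.
have Im0 : Rintegral (leb R) `]0, +oo[ (fun t => Im (euler_kernel 1 t)) = 0.
  rewrite (@eq_Rintegral _ _ _ _ _ (fun=> 0)) ?Rintegral_cst ?mul0r//.
  by move=> t _; rewrite Im_euler_kernel /= mul0r sin0 mulr0.
suff Re1 : Rintegral (leb R) `]0, +oo[ (fun t => Re (euler_kernel 1 t)) = 1.
  by rewrite euler_gammaE /cintegral Im0 Re1.
transitivity (Rintegral (leb R) `]0, +oo[ (fun t : R => expR (- t))).
  apply: eq_Rintegral => t _; rewrite Re_euler_kernel /= mul0r cos0 mulr1 /gamma_weight.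
  by rewrite subrr mul0r sub0r.
rewrite Rintegral_itv_obnd_cbnd; last first.
  have := gamma_weight_integrable (@ltr01 R); apply: eq_integrable; first exact: measurable_itv.
  by move=> t _; rewrite /= /gamma_weight subrr mul0r sub0r.
have dF (t : R) : is_derive t 1 (fun t => - expR (- t)) (expR (- t)).
  have h : is_derive t 1 (fun t : R => - t) (- 1) by apply: is_derive_eq.
  have h2 := is_derive1_comp (f := expR) (g := fun t : R => - t) _ h.
  have {}h2 := h2 _ (is_derive_expR _).
  have -> : (fun t : R => - expR (- t)) = - (expR \o (fun t : R => - t)) by [].
  by apply: is_derive_eq; rewrite mulrN1 opprK.
rewrite (@Rintegral_ge0_continuous_FTC2y R (fun t => expR (- t)) (fun t => - expR (- t)) 0 0).
- by rewrite oppr0 expR0 opprK add0r.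
- by move=> x _; exact: expR_ge0.
- apply: continuous_subspaceT => x; apply: continuous_comp; first exact: opp_continuous.
  exact: continuous_expR.
- rewrite -oppr0; apply: cvgN; exact: cvgr_expR.
- by move=> x _; exact: ex_derive.
- apply: cvg_at_right_filter; exact: is_derive_continuous (dF 0).
- by move=> x _; rewrite derive1E; exact: derive_val.
Qed.

(** * Size of the Gamma function on vertical lines *)

Definition rgamma R (x : R) : R :=
  Rintegral (leb R) `]0, +oo[ (gamma_weight x).

Lemma euler_gamma_real R (x : R) : euler_gamma x%:C = (rgamma x)%:C.
Proof.
rewrite euler_gammaE /cintegral; congr (_ +i* _).
- apply: eq_Rintegral => t _; rewrite Re_euler_kernel /=.
  by rewrite mul0r cos0 mulr1.
- rewrite (@eq_Rintegral _ _ _ _ _ (fun=> 0)) ?Rintegral_cst ?mul0r//.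
  by move=> t _; rewrite Im_euler_kernel /= mul0r sin0 mulr0.
Qed.

Lemma rgammaS R (x : R) : 0 < x -> rgamma (x + 1) = x * rgamma x.
Proof.
move=> x0; have := @euler_gammaS R x%:C x0.
have -> : x%:C + 1 = (x + 1)%:C :> R[i] by rewrite rmorphD.
rewrite !euler_gamma_real => /(congr1 (@complex.Re R)).
by rewrite ReM /= mul0r subr0.
Qed.

Lemma euler_gamma_le_rgamma R (s : R[i]) : 0 < Re s ->
  normc (euler_gamma s) <= 2 * rgamma (Re s).
Proof.
move=> s0; rewrite euler_gammaE; apply: normc_cintegral_le.
- exact: measurable_itv.
- exact: cintegrable_euler_kernel.
- exact: gamma_weight_integrable.
- by move=> t _; rewrite normc_euler_kernel.
Qed.

(** It suffices to integrate over [1/e, e], where the integrand is bounded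
    below uniformly in x. *)
Lemma rgamma_lower R (x1 : R) : exists2 c : R, 0 < c &
  forall x, 0 < x <= x1 -> c <= rgamma x.
Proof.
set a : R := expR (- 1%:R); set b : R := expR 1%:R.
have ab : a < b by rewrite ltr_expR; apply: (@lt_trans _ _ 0); rewrite ?oppr_lt0 ltr0n.
pose e := expR (- (x1 + 1) - b).
have mE : measurable (@log_itv R 0 : set (measurableTypeR R)) by exact: measurable_itv.
have mD : measurable (`]0, +oo[%classic : set (measurableTypeR R)) by exact: measurable_itv.
exists (e * (b - a)) => [|x /andP[x0 xx]]; first by rewrite mulr_gt0 ?expR_gt0// subr_gt0.
have iD := gamma_weight_integrable x0.
have iE : (leb R).-integrable (log_itv 0) (EFin \o gamma_weight x).
  by apply: integrableS iD => //; exact: log_itv_sub.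
have h1 : Rintegral (leb R) (log_itv 0) (gamma_weight x) <= rgamma x.
  rewrite /rgamma /Rintegral fine_le//; [exact: integrable_fin_num|exact: integrable_fin_num|].
  apply: ge0_subset_integral => //.
  - by apply/measurable_EFinP; exact: measurable_gamma_weight.
  - by move=> t _; rewrite lee_fin gamma_weight_ge0.
  - exact: log_itv_sub.
apply: le_trans h1.
have lE : fine (leb R (log_itv 0)) = b - a.
  have := @lebesgue_measure_itv R `[a, b]; rewrite /= lte_fin ab => h.
  by rewrite [leb R _]h.
have <- : Rintegral (leb R) (log_itv 0) (fun=> e) = e * (b - a) by rewrite Rintegral_cst// lE.
apply: le_Rintegral => //.
- apply: (@continuous_compact_integrable R (fun=> e)); first exact: segment_compact.
  by apply: continuous_subspaceT => ?; exact: cvg_cst.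
- move=> t; rewrite /log_itv /= in_itv /= => /andP[ta tb].
  have t0 : 0 < t by apply: lt_le_trans ta; exact: expR_gt0.
  rewrite /gamma_weight ler_expR; apply: lerB => //.
  have : -1 <= ln t.
    by rewrite -[-1]expRK ler_ln ?posrE ?expR_gt0.
  have : ln t <= 1.
    by rewrite -[1]expRK ler_ln ?posrE ?expR_gt0.
  by nra.
Qed.

Lemma rgamma_gt0 R (x : R) : 0 < x -> 0 < rgamma x.
Proof.
move=> x0; have [c c0 h] := rgamma_lower x; apply: lt_le_trans c0 (h x _).
by rewrite x0 lexx.
Qed.

(** With u = exp(2 w), this is |w| <= |exp(w) - exp(-w)|. *)
Lemma ln_sqr_le R (u : R) : 0 < u -> ln u ^+ 2 <= 4 * (u - 2 + u^-1).
Proof.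
move=> u0; pose w := ln u / 2.
have hu : u = expR w * expR w by rewrite -expRD -[LHS]lnK ?posrE// /w; congr expR; lra.
have hv : u^-1 = expR (- w) * expR (- w).
  by rewrite hu invfM -!expRN.
have e1 : expR w * expR (- w) = 1 by rewrite -expRD subrr expR0.
have -> : ln u = 2 * w by rewrite /w mulrC divfK.
have h1 := expR_ge1Dx w; have h2 := expR_ge1Dx (- w).
have p1 := expR_gt0 w; have p2 := expR_gt0 (- w).
have -> : u - 2 + u^-1 = (expR w - expR (- w)) ^+ 2.
  by rewrite hv hu -{1}(mulr1 2) -{1}e1; ring.
rewrite exprMn -natrX ler_pM2l// -[leLHS](real_normK (num_real _)) -[leRHS](real_normK (num_real _)).
rewrite lerXn2r ?nnegrE//; have [w0|w0] := leP 0 w.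
  have : expR (- w) <= 1 by rewrite -expR0 ler_expR oppr_le0.
  by move=> ?; rewrite ger0_norm// ger0_norm; lra.
have : expR w <= 1 by rewrite -expR0 ler_expR ltW.
by move=> ?; rewrite ltr0_norm// ler0_norm; lra.
Qed.

(** The weight of Gamma(X) concentrates near t = X; the integrand t/X - 2 + X/t
    is chosen because the recurrence of Gamma evaluates its integral exactly,
    while it dominates ln(t/X)^2 / 4. *)
Lemma gamma_weight_concentration R (X : R) : 1 < X ->
  (leb R).-integrable `]0, +oo[ (EFin \o (fun t => gamma_weight X t * (t / X - 2 + X / t))) /\
  Rintegral (leb R) `]0, +oo[ (fun t => gamma_weight X t * (t / X - 2 + X / t))
    = rgamma X / (X - 1).
Proof.
move=> X1; have X0 : 0 < X by lra.
have Y0 : 0 < X - 1 by lra.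
have Z0 : 0 < X + 1 by lra.
have mD : measurable (`]0, +oo[%classic : set (measurableTypeR R)) by exact: measurable_itv.
pose f1 t := X^-1 * gamma_weight (X + 1) t.
pose f2 t := 2 * gamma_weight X t.
pose f3 t := X * gamma_weight (X - 1) t.
have iZ (c x : R) : 0 < x -> (leb R).-integrable `]0, +oo[ (EFin \o (fun t => c * gamma_weight x t)).
  move=> x0; have := integrableZl mD c (gamma_weight_integrable x0).
  by apply: eq_integrable.
have i1 := iZ X^-1 _ Z0; have i2 := iZ 2 _ X0; have i3 := iZ X _ Y0.
have i12 : (leb R).-integrable `]0, +oo[ (EFin \o (fun t => f1 t - f2 t)).
  by have := integrableB mD i1 i2; apply: eq_integrable.
have i123 : (leb R).-integrable `]0, +oo[ (EFin \o (fun t => f1 t - f2 t + f3 t)).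
  by have := integrableD mD i12 i3; apply: eq_integrable.
have E t : 0 < t -> gamma_weight X t * (t / X - 2 + X / t) = f1 t - f2 t + f3 t.
  move=> t0; rewrite /f1 /f2 /f3 gamma_weightD1//.
  have := gamma_weightD1 (X - 1) t0; rewrite subrK => ->.
  by field; rewrite !gt_eqF.
split.
- apply: (eq_integrable mD) i123 => t; rewrite inE /= in_itv/= andbT => t0.
  by rewrite E.
- transitivity (Rintegral (leb R) `]0, +oo[ (fun t => f1 t - f2 t + f3 t)).
    by apply: eq_Rintegral => t; rewrite inE /= in_itv/= andbT => t0; rewrite E.
  rewrite RintegralD// RintegralB// !RintegralZl//; try exact: gamma_weight_integrable.
  rewrite -!/(rgamma _) rgammaS//.
  have := rgammaS Y0; rewrite subrK => ->.
  by field; rewrite !gt_eqF.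
Qed.

(** Multiplying by X^(-i y) turns the oscillating factor into
    cos(y ln(t/X)) >= 1 - y^2 ln(t/X)^2, and for X large compared with y^2 the
    integral of the loss is at most half of Gamma(X). *)
Lemma euler_gamma_ge_rgamma R (s : R[i]) :
  1 + 8 * Im s ^+ 2 < Re s -> rgamma (Re s) / 2 <= normc (euler_gamma s).
Proof.
set X := Re s; set y := Im s => hX.
have y2 : 0 <= y ^+ 2 := sqr_ge0 y.
have X1 : 1 < X by lra.
have X0 : 0 < X by lra.
have mD : measurable (`]0, +oo[%classic : set (measurableTypeR R)) by exact: measurable_itv.
(* The unimodular factor X^(-i y). *)
pose c : R[i] := cexp (0 +i* (- (y * ln X))).
have nc : normc c = 1 by rewrite normc_cexp /= expR0.
have ik := @cintegrable_euler_kernel R s X0.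
have -> : normc (euler_gamma s) =
    normc (cintegral (leb R) `]0, +oo[ (fun t => c * euler_kernel s t)).
  by rewrite cintegralZ// Normc.normcM nc mul1r.
apply: le_trans (le_trans (ler_norm _) (Re_le_normc _)).
rewrite /cintegral -[Re (_ +i* _)]/(Rintegral (leb R) `]0, +oo[ (fun t => Re (c * euler_kernel s t))).
have [iq rq] := gamma_weight_concentration X1.
have g0 := rgamma_gt0 X0.
have ick := cintegrableZ c mD ik.
pose q t := gamma_weight X t * (t / X - 2 + X / t).
have iq' : (leb R).-integrable `]0, +oo[ (EFin \o (fun t => 4 * y ^+ 2 * q t)).
  by have := integrableZl mD (4 * y ^+ 2) iq; apply: eq_integrable.
have iw := gamma_weight_integrable X0.
have ib : (leb R).-integrable `]0, +oo[ (EFin \o (fun t => gamma_weight X t - 4 * y ^+ 2 * q t)).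
  by have := integrableB mD iw iq'; apply: eq_integrable.
apply: (@le_trans _ _ (Rintegral (leb R) `]0, +oo[ (fun t => gamma_weight X t - 4 * y ^+ 2 * q t))).
  rewrite RintegralB// RintegralZl// rq -/(rgamma X).
  rewrite (_ : _ - _ = rgamma X * (1 - 4 * y ^+ 2 / (X - 1))); last by ring.
  rewrite ler_pM2l// lerBrDr -lerBrDl ler_pdivrMr; lra.
apply: le_Rintegral => //; first by case: ick.
move=> t tD; have t0 : 0 < t by move: tD; rewrite /= in_itv/= andbT.
have L : ln (t / X) = ln t - ln X by rewrite lnM ?posrE ?invr_gt0// lnV.
have -> : Re (c * euler_kernel s t) = gamma_weight X t * cos (y * ln (t / X)).
  rewrite ReM Re_euler_kernel Im_euler_kernel -/X -/y L mulrBr cosB /c /cexp.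
  by rewrite !cE /= expR0 cosN sinN; ring.
rewrite /q mulrCA -[X in X - _]mulr1 -mulrBr ler_wpM2l ?gamma_weight_ge0//.
have := cos_sub1_norm (y * ln (t / X)); rewrite ler_norml => /andP[h _].
have := @ln_sqr_le R (t / X); rewrite divr_gt0// => /(_ isT).
rewrite invf_div exprMn in h *; move=> h2.
by have := ler_wpM2l y2 h2; lra.
Qed.

(** Twice the logarithm of |u + i a| / u. *)
Definition log_factor R (a u : R) : R := ln (1 + (a / u) ^+ 2).
Definition log_factor_prim R (a u : R) : R :=
  u * log_factor a u - 2 * a * atan (a / u).

Lemma is_derive_log_factor_prim R (a u : R) : 0 < u ->
  is_derive u 1 (log_factor_prim a) (log_factor a u).
Proof.
move=> u0; have un0 : u != 0 by rewrite gt_eqF.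
have h1 : is_derive u 1 (fun u => a / u) (- (a / u ^+ 2)).
  have hv := @is_deriveV R id u 1 1 un0 (is_derive_id _ _).
  have -> : (fun u => a / u) = a \*: (fun u : R => u^-1) by [].
  by apply: is_derive_eq; rewrite /GRing.scale/= mulr1 mulrN.
have h2 : is_derive u 1 (fun u => 1 + (a / u) ^+ 2) (- 2 * a ^+ 2 / u ^+ 3).
  have -> : (fun u => 1 + (a / u) ^+ 2) = cst 1 + (fun u => a / u) ^+ 2.
    by apply/funext => v /=; rewrite -fctE.
  apply: is_derive_eq; rewrite /GRing.scale/= add0r expr1.
  by field.
have p0 : 0 < 1 + (a / u) ^+ 2 by rewrite ltr_wpDr ?sqr_ge0.
have h3 := is_derive1_comp (f := @ln R) (g := fun u => 1 + (a / u) ^+ 2) (is_derive1_ln p0) h2.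
have h4 := is_derive1_comp (f := @atan R) (g := fun u => a / u) (is_derive1_atan _) h1.
have -> : log_factor_prim a = (id * (@ln R \o (fun u => 1 + (a / u) ^+ 2)))
   - ((2 * a) \*: (@atan R \o (fun u => a / u))) by [].
apply: is_derive_eq; rewrite /GRing.scale/= -/(log_factor a u).
have q0 : u ^+ 2 + a ^+ 2 != 0 by rewrite gt_eqF// ltr_wpDr ?sqr_ge0// exprn_gt0.
by field; rewrite un0 q0.
Qed.

Lemma log_factor_ge0 R (a u : R) : 0 <= log_factor a u.
Proof. by rewrite ln_ge0// lerDl sqr_ge0. Qed.

Lemma log_factor_le R (a u : R) : log_factor a u <= (a / u) ^+ 2.
Proof. by rewrite le_ln1Dx// (lt_le_trans _ (sqr_ge0 _))// ltrN10. Qed.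

Lemma log_factor_decr R (a u v : R) : 0 < u <= v ->
  log_factor a v <= log_factor a u.
Proof.
move=> /andP[u0 uv]; have v0 := lt_le_trans u0 uv.
rewrite ler_ln ?posrE ?ltr_wpDr ?sqr_ge0// lerD2l !exprMn ler_wpM2l ?sqr_ge0//.
by rewrite lerXn2r ?nnegrE ?invr_ge0 ?(ltW u0) ?(ltW v0)// lef_pV2.
Qed.

Lemma log_factor_step R (a u : R) : 0 < u ->
  log_factor a (u + 1) <= log_factor_prim a (u + 1) - log_factor_prim a u <= log_factor a u.
Proof.
move=> u0; have uu : u <= u + 1 by rewrite lerDl.
have d (x : R) : u <= x -> is_derive x 1 (log_factor_prim a) (log_factor a x).
  by move=> ux; apply: is_derive_log_factor_prim; apply: lt_le_trans ux.
have [||c] := @MVT_segment R (log_factor_prim a) (log_factor a) u (u + 1) uu.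
- by move=> x; rewrite in_itv/= => /andP[/ltW ux _]; exact: d.
- apply: continuous_in_subspaceT => x /set_mem /=; rewrite in_itv/= => /andP[ux _].
  exact: is_derive_continuous (d x ux).
rewrite in_itv/= => /andP[uc cu] ->.
have -> : u + 1 - u = 1 by ring.
rewrite mulr1 !log_factor_decr ?uc ?u0 ?cu ?andbT//; exact: lt_le_trans uc.
Qed.

(** Comparison of a sum of a decreasing function with its integral. *)
Lemma log_factor_sum R (a u : R) (N : nat) : 0 < u ->
  log_factor_prim a (u + N%:R) - log_factor_prim a u <= \sum_(k < N) log_factor a (u + k%:R) /\
  \sum_(k < N.+1) log_factor a (u + k%:R) <=
    log_factor a u + (log_factor_prim a (u + N%:R) - log_factor_prim a u).
Proof.
move=> u0; elim: N => [|N [IH1 IH2]].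
  by rewrite big_ord0 big_ord1 !addr0 subrr addr0.
have uN : 0 < u + N%:R by rewrite ltr_wpDr.
have /andP[h1 h2] := log_factor_step a uN.
have E : u + N.+1%:R = u + N%:R + 1 by rewrite -natr1 addrA.
split.
- by rewrite big_ord_recr /= E; lra.
- by rewrite big_ord_recr /= E; lra.
Qed.

Lemma atan_ge0 R (x : R) : 0 <= x -> 0 <= atan x.
Proof. by move=> x0; rewrite -atan0 le_atan. Qed.

Lemma atan_le R (x : R) : 0 <= x -> atan x <= x.
Proof.
move=> x0; rewrite -subr_ge0.
have h (y : R) : is_derive y 1 (fun y : R => y - atan y) (1 - (1 + y ^+ 2)^-1).
  have h1 := is_derive1_atan y.
  have -> : (fun y : R => y - atan y) = id - @atan R by [].
  by apply: is_derive_eq.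
apply: (ge0_derive_ge0 h) => // [|y _]; first by rewrite atan0 subrr.
by rewrite subr_ge0 invf_le1 ?ltr_wpDr ?sqr_ge0// lerDl sqr_ge0.
Qed.

(** The primitive tends to 0 at infinity, which makes the estimates of
    [euler_gamma_two_sided] independent of the length of the product. *)
Lemma log_factor_prim_tail R (a u : R) : 0 <= a -> 0 < u ->
  `|log_factor_prim a u| <= 2 * a ^+ 2 / u.
Proof.
move=> a0 u0; rewrite /log_factor_prim.
have l0 := log_factor_ge0 a u; have l1 := log_factor_le a u.
have z0 : 0 <= a / u by rewrite divr_ge0// ltW.
have t0 := atan_ge0 z0; have t1 := atan_le z0.
have b1 : 0 <= u * log_factor a u by rewrite mulr_ge0// ltW.
have b2 : u * log_factor a u <= a ^+ 2 / u.
  apply: le_trans (ler_wpM2l (ltW u0) l1) _; apply: le_of_eq; field; exact: lt0r_neq0.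
have b3 : 0 <= 2 * a * atan (a / u) by rewrite !mulr_ge0.
have b4 : 2 * a * atan (a / u) <= 2 * a ^+ 2 / u.
  rewrite expr2 -!mulrA ler_pM2l// ler_wpM2l//.
have b5 : 0 <= a ^+ 2 / u by rewrite divr_ge0 ?sqr_ge0 ?ltW.
by rewrite ler_norml; apply/andP; split; lra.
Qed.

Lemma euler_gamma_shift R (s : R[i]) (N : nat) : 0 < Re s ->
  euler_gamma (s + N%:R) = \prod_(k < N) (s + k%:R) * euler_gamma s.
Proof.
move=> s0; elim: N => [|N IH]; first by rewrite addr0 big_ord0 mul1r.
rewrite -natr1 addrA euler_gammaS.
  by rewrite big_ord_recr /= IH mulrA [_ * \prod_(_ < _) _]mulrC.
rewrite ReD (_ : Re (N%:R) = N%:R) ?ltr_wpDr//.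
by rewrite -(rmorph_nat (real_complex R)).
Qed.

Lemma rgamma_shift R (x : R) (N : nat) : 0 < x ->
  rgamma (x + N%:R) = \prod_(k < N) (x + k%:R) * rgamma x.
Proof.
move=> x0; elim: N => [|N IH]; first by rewrite addr0 big_ord0 mul1r.
rewrite -natr1 addrA rgammaS ?ltr_wpDr//.
by rewrite big_ord_recr /= IH mulrA [_ * \prod_(_ < _) _]mulrC.
Qed.

Lemma Re_natr R (n : nat) : Re (n%:R : R[i]) = n%:R.
Proof. by rewrite -(rmorph_nat (real_complex R)). Qed.

Lemma Im_natr R (n : nat) : Im (n%:R : R[i]) = 0.
Proof. by rewrite -(rmorph_nat (real_complex R)). Qed.

Lemma normc_log_factor R (s : R[i]) : 0 < Re s ->
  normc s = Re s * expR (log_factor `|Im s| (Re s) / 2).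
Proof.
case: s => x y /= x0.
have p0 : 0 < 1 + (`|y| / x) ^+ 2 by rewrite ltr_wpDr ?sqr_ge0.
apply/eqP; rewrite -(@eqrXn2 _ 2)// ?sqrtr_ge0 ?mulr_ge0 ?expR_ge0 ?(ltW x0)//.
rewrite sqr_sqrtr ?addr_ge0 ?sqr_ge0// exprMn.
have -> : expR (log_factor `|y| x / 2) ^+ 2 = expR (log_factor `|y| x).
  by rewrite expr2 -expRD; congr expR; lra.
rewrite /log_factor lnK//.
rewrite exprMn (real_normK (num_real y)); apply/eqP; field; exact: lt0r_neq0.
Qed.

Lemma normc_prod_log_factor R (s : R[i]) (N : nat) : 0 < Re s ->
  normc (\prod_(k < N) (s + k%:R)) =
  \prod_(k < N) (Re s + k%:R) *
  expR ((\sum_(k < N) log_factor `|Im s| (Re s + k%:R)) / 2).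
Proof.
move=> s0; elim: N => [|N IH].
  by rewrite !big_ord0 Normc.normc1 mul0r expR0 mulr1.
rewrite !big_ord_recr /= Normc.normcM IH mulrDl expRD.
rewrite (@normc_log_factor _ (s + N%:R)) ?ReD ?ImD ?Re_natr ?Im_natr ?addr0 ?ltr_wpDr//.
by ring.
Qed.

(** The recurrence compares Gamma(s) with Gamma(s + N), where |Gamma| is within
    a factor 2 of Gamma at the real part once N is large compared with
    (Im s)^2.  The product of the |s + k| / (Re s + k) that appears is
    exp of half a sum of [log_factor], which is compared with an integral.
    The main term a * atan(a / x) of its primitive [log_factor_prim] is what
    produces the rate pi / 2. *)
Lemma euler_gamma_two_sided R (s : R[i]) : 0 < Re s ->
  normc (euler_gamma s) <= 2 * rgamma (Re s) *
     expR ((1 + log_factor_prim `|Im s| (Re s)) / 2) /\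
  rgamma (Re s) / 2 * expR (- (log_factor `|Im s| (Re s) + 1 + pi * `|Im s|) / 2)
     <= normc (euler_gamma s).
Proof.
move=> x0; set x := Re s in x0 *; set a := `|Im s|.
have a0 : 0 <= a := normr_ge0 _.
have g0 := rgamma_gt0 x0.
(* N is large enough for the lower bound at s + N and for the tail of the primitive to be at most 1. *)
have [N hN] : exists N : nat, 1 + 8 * a ^+ 2 < N%:R.
  exists (Num.truncn (1 + 8 * a ^+ 2)).+1; exact: truncnS_gt.
have aa := sqr_ge0 a.
have tail n : (N <= n)%N -> `|log_factor_prim a (x + n%:R)| <= 1.
  rewrite -(ler_nat R) => Nn; have xn : 0 < x + n%:R by rewrite ltr_wpDr.
  apply: le_trans (log_factor_prim_tail a0 xn) _.
  rewrite ler_pdivrMr// mul1r; lra.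
have ReN n : Re (s + n%:R) = x + n%:R by rewrite ReD Re_natr.
have ImN n : Im (s + n%:R) = Im s by rewrite ImD Im_natr addr0.
have pos n : 0 < \prod_(k < n) (x + k%:R).
  by apply: prodr_gt0 => k _; rewrite ltr_wpDr.
split.
- have xn : 0 < Re (s + N%:R) by rewrite ReN ltr_wpDr.
  have := euler_gamma_le_rgamma xn.
  rewrite ReN euler_gamma_shift// rgamma_shift// Normc.normcM normc_prod_log_factor//.
  rewrite -/x -/a; have [h1 _] := log_factor_sum a N x0.
  set L := \sum_(k < N) _ in h1 *; move=> h0.
  have h : expR (L / 2) * normc (euler_gamma s) <= 2 * rgamma x.
    by rewrite -(ler_pM2l (pos N)); lra.
  have h2 : expR ((- 1 - log_factor_prim a x) / 2) <= expR (L / 2).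
    rewrite ler_expR ler_pM2r ?invr_gt0//.
    by have := tail N (leqnn N); rewrite ler_norml => /andP[? _]; lra.
  rewrite (_ : (1 + _) / 2 = - ((- 1 - log_factor_prim a x) / 2)); last by lra.
  rewrite expRN ler_pdivlMr ?expR_gt0//; apply: le_trans _ h.
  by rewrite mulrC ler_wpM2r// normc_ge0.
- have := @euler_gamma_ge_rgamma R (s + N.+1%:R).
  rewrite ReN ImN => /(_ _); rewrite -(real_normK (num_real (Im s))) -/a.
  have xN : 1 + 8 * a ^+ 2 < x + N.+1%:R by rewrite -natr1; lra.
  move=> /(_ xN).
  rewrite euler_gamma_shift// rgamma_shift// Normc.normcM normc_prod_log_factor//.
  rewrite -/x -/a; have [_ h1] := log_factor_sum a N x0.
  set L := \sum_(k < N.+1) _ in h1 *; move=> h0.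
  have h : rgamma x / 2 <= expR (L / 2) * normc (euler_gamma s).
    by rewrite -(ler_pM2l (pos N.+1)); lra.
  have p2 : 2 * a * atan (a / x) <= a * pi.
    have h2 : 2 * atan (a / x) <= pi by have := ltW (atan_ltpi2 (a / x)); lra.
    by have := ler_wpM2l a0 h2; lra.
  have p3 : 0 <= x * log_factor a x by rewrite mulr_ge0 ?log_factor_ge0// ltW.
  have h2 : expR (L / 2) <= expR ((log_factor a x + 1 + pi * a) / 2).
    rewrite ler_expR ler_pM2r ?invr_gt0//.
    have := tail N (leqnn N); rewrite ler_norml => /andP[_ ?].
    rewrite {2}/log_factor_prim in h1; lra.
  rewrite mulNr expRN ler_pdivrMr ?expR_gt0//.
  apply: le_trans h _; rewrite mulrC ler_wpM2l ?normc_ge0//.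
Qed.

Lemma log_factor_linear R (x0 e : R) : 0 < x0 -> 0 < e ->
  exists2 C : R, 0 <= C & forall a x, 0 <= a -> x0 <= x ->
    log_factor a x <= 2 * (e * a) + C.
Proof.
move=> x00 e0; set K := 1 + (e * x0)^-1.
have K1 : 1 <= K by rewrite lerDl invr_ge0 ltW// mulr_gt0.
have K0 : 0 < K by lra.
exists (2 * ln K) => [|a x a0 xx]; first by rewrite mulr_ge0// ln_ge0.
have h : log_factor a x <= log_factor a x0 by rewrite log_factor_decr// x00.
apply: le_trans h _.
have -> : 2 * (e * a) + 2 * ln K = ln ((expR (e * a) * K) ^+ 2).
  rewrite expr2 !lnM ?posrE ?mulr_gt0 ?expR_gt0// expRK; ring.
rewrite ler_ln ?posrE ?exprn_gt0 ?mulr_gt0 ?expR_gt0 ?K0// ?ltr_wpDr ?sqr_ge0//.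
have z0 : 0 <= a / x0 by rewrite divr_ge0// ltW.
have h1 : 1 + a / x0 <= expR (e * a) * K.
  have h2 : 1 + e * a <= expR (e * a) := expR_ge1Dx _.
  have ea : 0 <= e * a by rewrite mulr_ge0// ltW.
  have h3 : (1 + e * a) * K <= expR (e * a) * K by rewrite ler_wpM2r// ltW.
  apply: le_trans h3; rewrite /K.
  have E : (1 + e * a) * (1 + (e * x0)^-1) = 1 + a / x0 + (e * a + (e * x0)^-1).
    by field; rewrite !gt_eqF.
  by rewrite E lerDl; apply: addr_ge0 => //; rewrite invr_ge0 ltW// mulr_gt0.
apply: (@le_trans _ _ ((1 + a / x0) ^+ 2)); first by nra.
have n1 : 0 <= 1 + a / x0 by lra.
by have n2 := le_trans n1 h1; rewrite lerXn2r.
Qed.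

(** For a large compared with x1, atan(a/x) is within e of pi/2; the constant C
    absorbs the remaining bounded range of a. *)
Lemma atan_near_pihalf R (x1 e : R) : 0 < x1 -> 0 < e ->
  exists2 C : R, 0 <= C & forall a x, 0 <= a -> 0 < x <= x1 ->
    (pi / 2 - e) * a - C <= a * atan (a / x).
Proof.
move=> x10 e0.
have [M [Mr hM]] : exists M : R, M \is Num.real /\ forall z, M < z -> pi / 2 - e < atan z.
  have := @cvgy_atan R; move/cvgrPdist_lt => /(_ e e0) [M [Mr h]]; exists M; split => // z /h /=.
  by rewrite ltr_norml => /andP[_]; lra.
have pi2 := @pihalf_ge1 R.
pose Y := x1 * `|M|.
have Y0 : 0 <= Y by rewrite mulr_ge0// ltW.
exists (pi / 2 * Y) => [|a x a0 /andP[x0 xx]]; first by rewrite mulr_ge0//; lra.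
have [h|h] := ltP Y a.
  have : M < a / x.
    apply: le_lt_trans (ler_norm M) _; rewrite ltr_pdivlMr// mulrC.
    by apply: le_lt_trans h; rewrite /Y ler_wpM2r.
  move=> /hM /ltW /(ler_wpM2l a0); have : 0 <= pi / 2 * Y by rewrite mulr_ge0//; lra.
  by lra.
apply: (@le_trans _ _ 0); last by rewrite mulr_ge0// atan_ge0// divr_ge0// ltW.
have : pi / 2 * a <= pi / 2 * Y by rewrite ler_wpM2l//; lra.
have : 0 <= e * a by rewrite mulr_ge0// ltW.
lra.
Qed.

Lemma rgamma_upper R (x0 x1 : R) : 0 < x0 -> exists2 C : R, 0 <= C &
  forall x, x0 <= x <= x1 -> rgamma x <= C.
Proof.
move=> x00; have [F' [C C0 h]] := @holo_euler_gamma R x0 x1 0 x00.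
exists C => // x xx.
have r : rect x0 x1 0 x%:C by split => //=; rewrite normr0.
have [+ _ _ _] := h _ _ r r; rewrite euler_gamma_real normc_real.
exact: le_trans (ler_norm _).
Qed.

Lemma euler_gamma_upper R (x0 x1 e : R) : 0 < x0 -> 0 < e ->
  exists2 C : R, 0 < C & forall s, x0 <= Re s <= x1 ->
    normc (euler_gamma s) <= C * expR (- ((pi / 2 - e) * `|Im s|)).
Proof.
move=> x00 e0.
have [x01|x01] := leP x0 x1; last by exists 1 => // s; lra.
have x10 : 0 < x1 := lt_le_trans x00 x01.
have [G G0 hG] := @rgamma_upper R x0 x1 x00.
have e2 : 0 < e / 2 by rewrite divr_gt0.
have e3 : 0 < e / (2 * x1) by rewrite divr_gt0// mulr_gt0.
have [A A0 hA] := atan_near_pihalf x10 e2.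
have [L L0 hL] := log_factor_linear x00 e3.
pose C := 2 * G * expR (1 / 2 + x1 * L / 2 + A).
exists (C + 1) => [|s xx].
  by rewrite ltr_wpDl// /C mulr_ge0 ?expR_ge0// mulr_ge0.
have /andP[h1 h2] := xx; have s0 := lt_le_trans x00 h1.
have [h _] := euler_gamma_two_sided s0; apply: le_trans h _.
set a := `|Im s|; have a0 : 0 <= a := normr_ge0 _.
apply: (@le_trans _ _ (C * expR (- ((pi / 2 - e) * a)))); last first.
  by rewrite ler_wpM2r ?expR_ge0// lerDl.
rewrite /C -[leRHS]mulrA -expRD.
apply: ler_pM; rewrite ?expR_ge0 ?mulr_ge0 ?(ltW (rgamma_gt0 s0))//.
  by rewrite ler_pM2l// hG.
rewrite ler_expR /log_factor_prim.
have k1 := hA a (Re s) a0; have {}k1 := k1 _; rewrite s0 h2 in k1; have {}k1 := k1 isT.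
have k2 := hL a (Re s) a0 h1.
have l0 := log_factor_ge0 a (Re s).
have k3 : Re s * log_factor a (Re s) <= x1 * (2 * (e / (2 * x1) * a) + L).
  by apply: ler_pM => //; exact: ltW.
have k4 : x1 * (2 * (e / (2 * x1) * a) + L) = e * a + x1 * L.
  by field; rewrite gt_eqF.
rewrite k4 in k3; lra.
Qed.

Lemma euler_gamma_lower R (x0 x1 e : R) : 0 < x0 -> 0 < e ->
  exists2 c : R, 0 < c & forall s, x0 <= Re s <= x1 ->
    c * expR (- ((pi / 2 + e) * `|Im s|)) <= normc (euler_gamma s).
Proof.
move=> x00 e0.
have [c c0 hc] := @rgamma_lower R x1.
have [L L0 hL] := log_factor_linear x00 e0.
exists (c / 2 * expR (- (L + 1) / 2)) => [|s /andP[h1 h2]].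
  by rewrite !mulr_gt0 ?expR_gt0.
have s0 := lt_le_trans x00 h1.
have [_ h] := euler_gamma_two_sided s0; apply: le_trans h.
set a := `|Im s|; have a0 : 0 <= a := normr_ge0 _.
rewrite -mulrA -expRD; apply: ler_pM; rewrite ?expR_ge0 ?divr_ge0 ?(ltW c0)//.
  by rewrite ler_pM2r// hc// s0.
rewrite ler_expR; have := hL a (Re s) a0 h1; lra.
Qed.

(** The continuation may be computed with any sufficiently large shift.  At a
    pole of Gamma both sides are 0, so that no point has to be excluded. *)
Lemma Gamma_shiftE R (s : R[i]) (N : nat) : - N%:R < Re s ->
  Gamma s = euler_gamma (s + N%:R) / \prod_(k < N) (s + k%:R).
Proof.
move=> sN; rewrite /Gamma; set n := (if _ then _ else _).
have n0 : 0 < Re s + n%:R.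
  rewrite /n; case: (ltP 0 (Re s)) => s0; first by rewrite addr0.
  by have := truncnS_gt (- Re s); lra.
have nN : (n <= N)%N.
  rewrite /n; case: (ltP 0 (Re s)) => // s0; rewrite -(ltr_nat R).
  apply: le_lt_trans (_ : - Re s < _); last by lra.
  by rewrite truncn_le// oppr_ge0.
have s0 : 0 < Re (s + n%:R) by rewrite ReD Re_natr.
have NE : s + N%:R = (s + n%:R) + (N - n)%:R.
  by rewrite -addrA -natrD subnKC.
rewrite NE (euler_gamma_shift (N - n) s0).
have -> : \prod_(k < N) (s + k%:R) =
    \prod_(k < n) (s + k%:R) * \prod_(k < N - n) (s + n%:R + k%:R).
  rewrite -[in LHS](subnKC nN) big_split_ord /=; congr (_ * _).
  by apply: eq_bigr => i _; rewrite natrD addrA.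
set Q := \prod_(k < N - n) _.
have Q0 : Q != 0.
  apply/prodf_neq0 => i _; apply/eqP => /(congr1 (@complex.Re R)); rewrite ReD Re_natr /=.
  by apply/eqP; rewrite gt_eqF// ltr_wpDr.
by rewrite invfM [_ * Q^-1]mulrC mulrACA divff// mul1r.
Qed.

Lemma Gamma_euler R (s : R[i]) : 0 < Re s -> Gamma s = euler_gamma s.
Proof.
by move=> s0; rewrite (@Gamma_shiftE _ _ 0) ?oppr0// big_ord0 divr1 addr0.
Qed.

(** * Moving the line of integration *)

(** The form in which the second order estimates of [holo_with] yield
    derivatives of real functions. *)
Lemma is_derive_quadratic R (f : R -> R) (x a C d : R) : 0 < d ->
  (forall h, `|h| < d -> `|f (h + x) - f x - a * h| <= C * h ^+ 2) ->
  is_derive x 1 f a.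
Proof.
move=> d0 hf.
have H : (fun h => h^-1 *: (f (h *: 1 + x) - f x)) @ 0^' --> a.
  apply/cvgrPdist_le => e e0.
  pose k := Num.min d (e / (`|C| + 1)).
  have C1 : 0 < `|C| + 1 by rewrite ltr_wpDl.
  have k0 : 0 < k by rewrite lt_min d0 divr_gt0.
  near=> h.
  have hn0 : h != 0 by near: h; exact: nbhs_dnbhs_neq.
  have hk : `|h| < k.
    by near: h; apply: dnbhs0_lt.
  have h1 : `|h| < d by apply: lt_le_trans hk _; rewrite ge_min lexx.
  have h2 : (`|C| + 1) * `|h| <= e.
    rewrite mulrC -ler_pdivlMr//; apply: le_trans (ltW hk) _.
    by rewrite ge_min lexx orbT.
  rewrite /GRing.scale/= mulr1.
  rewrite (_ : a - _ = - (h^-1 * (f (h + x) - f x - a * h))); last by field.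
  rewrite normrN normrM normfV ler_pdivrMl ?normr_gt0//.
  apply: le_trans (hf h h1) _; rewrite -(real_normK (num_real h)).
  apply: le_trans (_ : `|C| * `|h| ^+ 2 <= _).
    by rewrite ler_wpM2r ?exprn_ge0// ler_norm.
  by have := normr_ge0 h; have := normr_ge0 C; nra.
apply: DeriveDef; first by apply/cvg_ex; exists a.
exact: cvg_lim H.
Unshelve. all: by end_near. Qed.

Lemma rect_line R (A B T x t : R) : A <= x <= B -> `|t| <= T ->
  rect A B T (x +i* t).
Proof. by []. Qed.

Lemma holo_line_derive R (A B T x t : R) (F F' : R[i] -> R[i]) :
  holo_with (rect A B T) F F' -> A <= x <= B -> `|t| < T ->
  is_derive t 1 (fun t => Im (F (x +i* t))) (Re (F' (x +i* t))).
Proof.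
move=> [C C0 hF] xx tT.
have d0 : 0 < T - `|t| by rewrite subr_gt0.
apply: (@is_derive_quadratic _ _ _ _ C _ d0) => h hd.
have ht : `|h + t| <= T by apply: le_trans (ler_normD _ _) _; lra.
have [_ _ _] := hF _ _ (rect_line xx (ltW tT)) (rect_line xx ht).
have -> : (x +i* (h + t)) - (x +i* t) = h%:C * 'i.
  by apply: complexP; rewrite !cE /=; ring.
rewrite Normc.normcM normc_real normc_i mulr1 (real_normK (num_real h)).
apply: le_trans; apply: le_trans (Im_le_normc _); apply: le_of_eq; congr `| _ |.
by rewrite !cE /=; ring.
Qed.

(** Adding the Taylor estimates at s and at w. *)
Lemma holo_derivative_lipschitz R (D : set R[i]) (F F' : R[i] -> R[i]) :
  holo_with D F F' -> exists2 C : R, 0 <= C &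
    forall s w, D s -> D w -> normc (F' w - F' s) <= C * normc (w - s).
Proof.
move=> [C C0 h]; exists (2 * C) => [|s w Ds Dw]; first by rewrite mulr_ge0.
have [_ _ _ a1] := h s w Ds Dw; have [_ _ _ a2] := h w s Dw Ds.
have [->|ws] := eqVneq w s; first by rewrite !subrr Normc.normc0 mulr0.
have n0 : 0 < normc (w - s) by rewrite normc_gt0// subr_eq0.
rewrite -(ler_pM2r n0) -Normc.normcM.
rewrite (_ : (F' w - F' s) * (w - s) =
  (F w - F s - F' s * (w - s)) + (F s - F w - F' w * (s - w))); last by ring.
apply: le_trans (normcD_le _ _) _; rewrite (normc_distC s w) in a2.
by rewrite expr2 in a1 a2; lra.
Qed.

Lemma lipschitz_line_continuous R (A B T x t C : R) (F : R[i] -> R[i]) :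
  0 <= C -> (forall s w, rect A B T s -> rect A B T w -> normc (F w - F s) <= C * normc (w - s)) ->
  A <= x <= B -> `|t| < T ->
  {for t, continuous (fun t => Re (F (x +i* t)))} /\
  {for t, continuous (fun t => Im (F (x +i* t)))}.
Proof.
move=> C0 hF xx tT.
have lip h : `|h - t| < T - `|t| -> normc (F (x +i* t) - F (x +i* h)) <= C * `|t - h|.
  move=> hd; have ht : `|h| <= T.
    by rewrite -(subrK t h); apply: le_trans (ler_normD _ _) _; lra.
  have := hF _ _ (rect_line xx ht) (rect_line xx (ltW tT)).
  have -> : (x +i* t) - (x +i* h) = (t - h)%:C * 'i.
    by apply: complexP; rewrite !cE /=; ring.
  by rewrite Normc.normcM normc_real normc_i mulr1.
have d0 : 0 < T - `|t| by rewrite subr_gt0.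
have C1 : 0 < C + 1 by rewrite ltr_wpDl.
have key (g : R -> R) : (forall h, `|g t - g h| <= normc (F (x +i* t) - F (x +i* h))) ->
    {for t, continuous g}.
  move=> hg; apply/cvgrPdist_lt => e e0; near=> h.
  have h1 : `|t - h| < T - `|t| by near: h; exact: (@cvgr_dist_lt _ _ _ _ _ id t).
  have h2 : `|t - h| < e / (C + 1).
    by near: h; apply: (@cvgr_dist_lt _ _ _ _ _ id t) => //; rewrite divr_gt0.
  apply: le_lt_trans (hg h) _; apply: le_lt_trans (lip h _) _; first by rewrite distrC.
  apply: (@le_lt_trans _ _ ((C + 1) * `|t - h|)); first by rewrite ler_wpM2r// lerDl.
  by rewrite mulrC -ltr_pdivlMr.
by split; apply: key => h; rewrite -?ReN -?ImN -?ReD -?ImD ?Re_le_normc ?Im_le_normc.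
Unshelve. all: by end_near. Qed.

Lemma holo_line_continuous R (A B T x t : R) (F : R[i] -> R[i]) :
  holo (rect A B T) F -> A <= x <= B -> `|t| < T ->
  {for t, continuous (fun t => Re (F (x +i* t)))} /\
  {for t, continuous (fun t => Im (F (x +i* t)))}.
Proof.
move=> [F' [C C0 hF]]; apply: (lipschitz_line_continuous C0) => s w Ds Dw.
by have [] := hF s w Ds Dw.
Qed.

Lemma continuous_within_segment R (T : R) (f : R -> R) :
  (forall t, `|t| <= T -> {for t, continuous f}) -> {within `[- T, T], continuous f}.
Proof.
move=> h; apply: continuous_in_subspaceT => t /set_mem /=; rewrite in_itv /= => tT.
by apply: h; rewrite ler_norml.
Qed.

Lemma continuous_segment_integrable R (T : R) (f : R -> R) :
  (forall t, `|t| <= T -> {for t, continuous f}) ->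
  (leb R).-integrable `[- T, T] (EFin \o f).
Proof.
move=> h; apply: continuous_compact_integrable; first exact: segment_compact.
exact: continuous_within_segment.
Qed.

Lemma Rintegral_segment_cst R (T c : R) : 0 < T ->
  Rintegral (leb R) `[- T, T] (fun=> c) = 2 * T * c.
Proof.
move=> T0; rewrite Rintegral_cst; last exact: measurable_itv.
have := @lebesgue_measure_itv R `[- T, T]; rewrite /= lte_fin gtrN// => ->.
by rewrite -EFinB /=; ring.
Qed.

(** Cauchy's theorem on a rectangle without contour integrals: by the
    Cauchy-Riemann equations the derivative in x of the integral of
    Re F(x + i t) over [-T, T] is Im F(x + i T) - Im F(x - i T), hence bounded
    by 2 M. *)
Lemma Rintegral_horizontal_shift R (A B u v T M : R) (F : R[i] -> R[i]) :
  0 < T -> A < u -> u <= v -> v < B -> holo (rect A B (T + 1)) F ->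
  (forall x, u <= x <= v -> normc (F (x +i* T)) <= M /\ normc (F (x +i* - T)) <= M) ->
  `|Rintegral (leb R) `[- T, T] (fun t => Re (F (v +i* t))) -
    Rintegral (leb R) `[- T, T] (fun t => Re (F (u +i* t)))| <= 2 * M * (v - u).
Proof.
move=> T0 Au uv vB [F' hF] hM.
have holoF : holo (rect A B (T + 1)) F by exists F'.
have [L L0 lipF'] := holo_derivative_lipschitz hF.
have [C C0 qF] := hF.
have tT1 (t : R) : `|t| <= T -> `|t| < T + 1 by move=> ?; lra.
have mT : measurable (`[- T, T]%classic : set (measurableTypeR R)) by exact: measurable_itv.
pose J x := Rintegral (leb R) `[- T, T] (fun t => Re (F (x +i* t))).
pose a x := Im (F (x +i* T)) - Im (F (x +i* - T)).
have iF x : A <= x <= B -> (leb R).-integrable `[- T, T] (EFin \o (fun t => Re (F (x +i* t)))).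
  move=> xx; apply: continuous_segment_integrable => t /tT1 tT.
  by have [] := holo_line_continuous holoF xx tT.
have cF' x t : A <= x <= B -> `|t| <= T -> {for t, continuous (fun t => Re (F' (x +i* t)))}.
  by move=> xx /tT1 tT; have [] := lipschitz_line_continuous L0 lipF' xx tT.
have iF' x : A <= x <= B -> (leb R).-integrable `[- T, T] (EFin \o (fun t => Re (F' (x +i* t)))).
  by move=> xx; apply: continuous_segment_integrable => t; exact: cF'.
have aE x : A <= x <= B -> Rintegral (leb R) `[- T, T] (fun t => Re (F' (x +i* t))) = a x.
  move=> xx; apply: (@Rintegral_derivative R (fun t => Im (F (x +i* t)))).
  - by lra.
  - move=> t; rewrite -ler_norml => /tT1 tT.
    exact: holo_line_derive hF xx tT.
  - by apply: continuous_within_segment => t; exact: cF'.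
have dJ x : u <= x <= v -> is_derive x 1 J (a x).
  move=> /andP[ux xv].
  have xx : A <= x <= B by apply/andP; split; lra.
  have d0 : 0 < Num.min (x - A) (B - x) by rewrite lt_min; apply/andP; split; lra.
  apply: (@is_derive_quadratic _ _ _ _ (2 * T * C) _ d0) => h.
  rewrite lt_min => /andP[]; rewrite !ltr_norml => /andP[h1 h2] /andP[h3 h4].
  have hh : A <= h + x <= B by apply/andP; split; lra.
  have i1 := iF _ hh; have i2 := iF _ xx.
  have i3 : (leb R).-integrable `[- T, T] (EFin \o (fun t => h * Re (F' (x +i* t)))).
    by have := integrableZl mT h (iF' _ xx); apply: eq_integrable.
  have i4 : (leb R).-integrable `[- T, T]
      (EFin \o (fun t => Re (F ((h + x) +i* t)) - Re (F (x +i* t)))).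
    by have := integrableB mT i1 i2; apply: eq_integrable.
  have i5 : (leb R).-integrable `[- T, T]
      (EFin \o (fun t => Re (F ((h + x) +i* t)) - Re (F (x +i* t)) - h * Re (F' (x +i* t)))).
    by have := integrableB mT i4 i3; apply: eq_integrable.
  rewrite /J -RintegralB// -aE// mulrC -RintegralZl//; last exact: iF'.
  rewrite -RintegralB//.
  rewrite (_ : 2 * T * C * h ^+ 2 = 2 * T * (C * h ^+ 2)); last by ring.
  rewrite -Rintegral_segment_cst//; apply: normr_Rintegral_le => //.
    by apply: continuous_segment_integrable => t _; exact: cvg_cst.
  move=> t; rewrite /= in_itv /= -ler_norml => /tT1/ltW tT.
  have [_ _ _] := qF _ _ (rect_line xx tT) (rect_line hh tT).
  have -> : ((h + x) +i* t) - (x +i* t) = h%:C.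
    by apply: complexP; rewrite !cE /=; ring.
  rewrite normc_real (real_normK (num_real h)).
  apply: le_trans; apply: le_trans (Re_le_normc _); apply: le_of_eq; congr `| _ |.
  by rewrite !cE /=; ring.
rewrite -!/(J _).
have [||c] := @MVT_segment R J a u v uv.
- by move=> x; rewrite in_itv/= => /andP[/ltW h1 /ltW h2]; apply: dJ; rewrite h1 h2.
- apply: continuous_in_subspaceT => x /set_mem /=; rewrite in_itv/= => xx.
  exact: is_derive_continuous (dJ x xx).
rewrite in_itv/= => cc ->; rewrite normrM (ger0_norm (_ : 0 <= v - u)) ?subr_ge0//.
rewrite ler_wpM2r ?subr_ge0//; have [m1 m2] := hM c cc.
apply: le_trans (ler_normB _ _) _.
have := Im_le_normc (F (c +i* T)); have := Im_le_normc (F (c +i* - T)); lra.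
Qed.

(** The imaginary part of F is the real part of - i F. *)
Lemma cintegral_horizontal_shift R (A B u v T M : R) (F : R[i] -> R[i]) :
  0 < T -> A < u -> u <= v -> v < B -> holo (rect A B (T + 1)) F ->
  (forall x, u <= x <= v -> normc (F (x +i* T)) <= M /\ normc (F (x +i* - T)) <= M) ->
  normc (cintegral (leb R) `[- T, T] (fun t => F (v +i* t)) -
    cintegral (leb R) `[- T, T] (fun t => F (u +i* t))) <= 4 * M * (v - u).
Proof.
move=> T0 Au uv vB hF hM.
have h1 := Rintegral_horizontal_shift T0 Au uv vB hF hM.
have hG : holo (rect A B (T + 1)) (fun s => - 'i * F s).
  exact: holoM (holo_cst _ _) hF.
have ImE s : Im (F s) = Re (- 'i * F s).
  by rewrite !cE /=; ring.
have nG s : normc (- 'i * F s) = normc (F s).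
  by rewrite Normc.normcM normcN1 normc_i mul1r.
have hM' x : u <= x <= v ->
    normc (- 'i * F (x +i* T)) <= M /\ normc (- 'i * F (x +i* - T)) <= M.
  by rewrite !nG; exact: hM.
have h2 := Rintegral_horizontal_shift T0 Au uv vB hG hM'.
apply: le_trans (normc_le_ReIm _) _; rewrite /cintegral !cE.
rewrite (_ : 4 * M * (v - u) = 2 * M * (v - u) + 2 * M * (v - u)); last by ring.
apply: lerD => //; apply: le_trans h2; apply: le_of_eq; congr (`| _ - _ |);
  by apply: eq_Rintegral => t _; exact: ImE.
Qed.

Lemma rect_bounded R (A B T : R) s : rect A B T s ->
  normc s <= `|A| + `|B| + `|T|.
Proof.
move=> [/andP[a b] c]; apply: le_trans (normc_le_ReIm _) _; apply: lerD.
  have := ler_norm B; have := lerNnormlW (lexx `|A|).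
  by rewrite ler_norml; move=> h1 h2; apply/andP; split; have := normr_ge0 A; have := normr_ge0 B; lra.
by apply: le_trans c _; exact: ler_norm.
Qed.

Lemma holo_id_rect R (A B T : R) : holo (rect A B T) id.
Proof. by apply: (@holo_id _ _ (`|A| + `|B| + `|T|)) => s; exact: rect_bounded. Qed.

Lemma holo_subr_inv R (A B T : R) (c : R) : c < A \/ B < c ->
  holo (rect A B T) (fun s => (s - c%:C)^-1).
Proof.
move=> cAB.
have hs : holo (rect A B T) (fun s => s - c%:C).
  exact: (holoD (holo_id_rect A B T) (holo_cst _ (- c%:C))).
have key d : 0 < d -> (forall s, rect A B T s -> d <= `|Re s - c|) ->
    holo (rect A B T) (fun s => (s - c%:C)^-1).
  move=> d0 hd; apply: (holoV d0) hs => s /hd; move/le_trans; apply.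
  by have := Re_le_normc (s - c%:C); rewrite !cE.
case: cAB => h.
- apply: (key (A - c)); first by rewrite subr_gt0.
  by move=> s [/andP[a b] _]; rewrite ger0_norm; lra.
- apply: (key (c - B)); first by rewrite subr_gt0.
  by move=> s [/andP[a b] _]; rewrite ler0_norm; lra.
Qed.

(** Subtracting h(c) removes the pole of h(s) / (s - c) at c; the subtracted
    part h(c) / (s - c) is integrated explicitly. *)
Definition divided_difference R (h : R[i] -> R[i]) (c : R) (s : R[i]) : R[i] :=
  (h s - h c%:C) * (s - c%:C)^-1.

Lemma divided_difference_shift R (A B u v T C c : R) (h : R[i] -> R[i]) :
  0 < T -> A < u -> u <= v -> v < B -> c < u \/ v < c ->
  (forall T, holo (rect A B T) h) -> (forall s, u <= Re s <= v -> normc (h s) <= C) ->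
  normc (cintegral (leb R) `[- T, T] (fun t => divided_difference h c (v +i* t)) -
    cintegral (leb R) `[- T, T] (fun t => divided_difference h c (u +i* t)))
  <= 4 * ((C + normc (h c%:C)) / T) * (v - u).
Proof.
move=> T0 Au uv vB cuv hh hC.
(* Shrink the strip so that it stays away from c. *)
have [A' [B' [h1 h2 h3 h4 h5]]] : exists A' B', [/\ A <= A', A' < u, v < B', B' <= B & c < A' \/ B' < c].
  case: cuv => hc.
  - have [hA|hA] := leP A ((c + u) / 2).
      by exists ((c + u) / 2), B; split => //; [lra|left; lra].
    by exists A, B; split => //; left; lra.
  - have [hB|hB] := leP ((c + v) / 2) B.
      by exists A, ((c + v) / 2); split => //; [lra|right; lra].
    by exists A, B; split => //; right; lra.
apply: (cintegral_horizontal_shift T0 h2 uv h3).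
  apply: holoM; last exact: holo_subr_inv.
  apply: holoD; last exact: holo_cst.
  apply: holo_sub (hh (T + 1)) => s [/andP[a b] d]; split => //.
  by apply/andP; split; lra.
have bound x y : u <= x <= v -> `|y| = T ->
    normc (divided_difference h c (x +i* y)) <= (C + normc (h c%:C)) / T.
  move=> xx yT; rewrite /divided_difference Normc.normcM Normc.normcV.
  have y0 : T <= normc ((x +i* y) - c%:C).
    by have := Im_le_normc ((x +i* y) - c%:C); rewrite ImD ImN /= subr0 yT.
  apply: ler_pM; rewrite ?invr_ge0 ?normc_ge0//.
    by apply: le_trans (normcB_le _ _) _; rewrite lerD2r hC.
  by rewrite lef_pV2// posrE (lt_le_trans T0 y0).
by move=> x xx; split; apply: bound; rewrite ?normrN ?gtr0_norm.
Qed.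

Lemma Rintegral_poisson R (a T : R) : a != 0 -> 0 < T ->
  Rintegral (leb R) `[- T, T] (fun t => a / (a ^+ 2 + t ^+ 2)) = 2 * atan (T / a) /\
  (leb R).-integrable `[- T, T] (EFin \o (fun t => a / (a ^+ 2 + t ^+ 2))).
Proof.
move=> a0 T0.
have p0 (t : R) : 0 < a ^+ 2 + t ^+ 2 by rewrite ltr_wpDr ?sqr_ge0// exprn_even_gt0.
have d (t : R) : is_derive t 1 (fun t => atan (t / a)) (a / (a ^+ 2 + t ^+ 2)).
  have h1 : is_derive t 1 (fun t => t / a) a^-1.
    have -> : (fun t => t / a) = a^-1 \*: id by apply/funext => v /=; rewrite mulrC.
    by apply: is_derive_eq; rewrite /GRing.scale/= mulr1.
  have h2 := is_derive1_comp (f := @atan R) (g := fun t => t / a) (is_derive1_atan _) h1.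
  apply: is_derive_eq h2 _.
  have q0 : a ^+ 2 + t ^+ 2 != 0 by rewrite gt_eqF.
  by field; rewrite a0 q0.
have cf (t : R) : {for t, continuous (fun t : R => a / (a ^+ 2 + t ^+ 2))}.
  apply: cvgM; first exact: cvg_cst.
  apply: cvgV; first by rewrite gt_eqF.
  by apply: cvgD; [exact: cvg_cst|exact: exprn_continuous].
split; last by apply: continuous_segment_integrable => t _; exact: cf.
rewrite (@Rintegral_derivative R (fun t => atan (t / a)))//.
- by rewrite mulNr atanN; ring.
- by lra.
- by apply: continuous_subspaceT => t; exact: cf.
Qed.

Lemma holo_line_integrable R (x T : R) (F : R[i] -> R[i]) :
  holo (rect x x (T + 1)) F -> cintegrable (leb R) `[- T, T] (fun t => F (x +i* t)).
Proof.
move=> hF; split; apply: continuous_segment_integrable => t tT.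
- by have [] := @holo_line_continuous _ _ _ _ x t _ hF; rewrite ?lexx//; lra.
- by have [] := @holo_line_continuous _ _ _ _ x t _ hF; rewrite ?lexx//; lra.
Qed.

Lemma divided_difference_holo R (A B x c T : R) (h : R[i] -> R[i]) :
  (forall T, holo (rect A B T) h) -> A <= x <= B -> c < x \/ x < c ->
  holo (rect x x T) (divided_difference h c).
Proof.
move=> hh /andP[Ax xB] cx; apply: holoM; last exact: holo_subr_inv.
apply: holoD; last exact: holo_cst.
apply: holo_sub (hh T) => s [/andP[a b] d]; split => //.
by apply/andP; split; lra.
Qed.

(** The divided difference need not be known to be differentiable at c: it is
    enough that its integrals along the lines at distance e^2 on both sides of
    c differ by O(e).  At distance E from c the difference of the integrands is
    O(E / r), r the distance to c, and E / r is at most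
    (e + e * E / r^2) / 2 for E = e^2; the Poisson kernel E / r^2 has a bounded
    integral. *)
Lemma divided_difference_cross R (A B c T : R) (h : R[i] -> R[i]) :
  0 < T -> (forall T, holo (rect A B T) h) -> exists2 K : R, 0 <= K &
  forall e, 0 < e -> A <= c - e ^+ 2 -> c + e ^+ 2 <= B ->
  normc (cintegral (leb R) `[- T, T] (fun t => divided_difference h c ((c + e ^+ 2) +i* t)) -
    cintegral (leb R) `[- T, T] (fun t => divided_difference h c ((c - e ^+ 2) +i* t)))
  <= K * e.
Proof.
move=> T0 hh; have [F' [L L0 hL]] := hh T.
have pi0 := @pi_gt0 R.
exists (4 * L * (2 * T + pi)) => [|e e0 h1 h2].
  by rewrite !mulr_ge0// addr_ge0// ?mulr_ge0// ltW.
have E0 : 0 < e ^+ 2 by rewrite exprn_gt0.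
set E := e ^+ 2 in h1 h2 E0 *.
have mT : measurable (`[- T, T]%classic : set (measurableTypeR R)) by exact: measurable_itv.
have i1 : cintegrable (leb R) `[- T, T] (fun t => divided_difference h c ((c + E) +i* t)).
  apply: holo_line_integrable; apply: (divided_difference_holo _ hh).
  - by apply/andP; split; lra.
  - by left; lra.
have i2 : cintegrable (leb R) `[- T, T] (fun t => divided_difference h c ((c - E) +i* t)).
  apply: holo_line_integrable; apply: (divided_difference_holo _ hh).
  - by apply/andP; split; lra.
  - by right; lra.
have En0 : E != 0 by rewrite gt_eqF.
have [rP iP] := Rintegral_poisson En0 T0.
pose g t := 2 * L * e * (1 + E / (E ^+ 2 + t ^+ 2)).
have i1' : (leb R).-integrable `[- T, T] (EFin \o (fun=> 1 : R)).
  by apply: continuous_segment_integrable => t _; exact: cvg_cst.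
have i1P : (leb R).-integrable `[- T, T] (EFin \o (fun t => 1 + E / (E ^+ 2 + t ^+ 2))).
  by have := integrableD mT i1' iP; apply: eq_integrable.
have ig : (leb R).-integrable `[- T, T] (EFin \o g).
  by have := integrableZl mT (2 * L * e) i1P; apply: eq_integrable.
rewrite -cintegralB//.
apply: (@le_trans _ _ (2 * Rintegral (leb R) `[- T, T] g)); last first.
  rewrite /g RintegralZl// RintegralD// rP Rintegral_segment_cst//.
  have := ltW (atan_ltpi2 (T / E)).
  have : 0 <= L * e by rewrite mulr_ge0// ltW.
  nra.
apply: normc_cintegral_le => //; first exact: cintegrableB.
move=> t; rewrite /= in_itv /= -ler_norml => tT.
set s1 := (c + E) +i* t; set s2 := (c - E) +i* t.
have d1 : rect A B T s1 by apply: rect_line => //; apply/andP; split; lra.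
have d2 : rect A B T s2 by apply: rect_line => //; apply/andP; split; lra.
have dc : rect A B T c%:C.
  by split => /=; rewrite ?normr0 ?(ltW T0)//; apply/andP; split; lra.
have [_ _ l1 _] := hL _ _ d2 d1; have [_ _ l2 _] := hL _ _ dc d2.
set r := normc (s1 - c%:C).
have s1c : s1 - c%:C = E +i* t by apply: complexP; rewrite !cE /=; ring.
have s2c : s2 - c%:C = (- E) +i* t by apply: complexP; rewrite !cE /=; ring.
have s12 : s1 - s2 = (2 * E)%:C by apply: complexP; rewrite !cE /=; ring.
have r2 : r ^+ 2 = E ^+ 2 + t ^+ 2 by rewrite /r s1c sqr_normcE.
have rE : normc (s2 - c%:C) = r by rewrite /r s1c s2c /= sqrrN.
have r0 : 0 < r by rewrite /r normc_gt0// s1c eq_complex /= negb_and En0.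
have n1 : s1 - c%:C != 0 by rewrite -normc_eq0P gt_eqF.
have n2 : s2 - c%:C != 0 by rewrite -normc_eq0P rE gt_eqF.
rewrite s12 normc_real gtr0_norm ?mulr_gt0// in l1.
rewrite rE in l2.
rewrite /divided_difference (_ : _ - _ = (h s1 - h s2) * (s1 - c%:C)^-1 -
   (h s2 - h c%:C) * ((s1 - s2) * ((s1 - c%:C)^-1 * (s2 - c%:C)^-1))); last first.
  by field; rewrite n1 n2.
apply: le_trans (normcB_le _ _) _; rewrite !Normc.normcM !Normc.normcV rE -/r s12 normc_real.
rewrite gtr0_norm ?mulr_gt0//.
have t1 : normc (h s1 - h s2) * r^-1 <= 2 * L * (E / r).
  rewrite (_ : 2 * L * (E / r) = L * (2 * E) * r^-1); last by ring.
  by rewrite ler_pM2r ?invr_gt0.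
have t2 : normc (h s2 - h c%:C) * (2 * E * (r^-1 * r^-1)) <= 2 * L * (E / r).
  apply: (@le_trans _ _ (L * r * (2 * E * (r^-1 * r^-1)))).
    rewrite ler_wpM2r//; apply: mulr_ge0; first by rewrite mulr_ge0// ltW.
    by rewrite mulr_ge0// invr_ge0 ltW.
  by apply: le_of_eq; field; rewrite gt_eqF.
have amgm : E / r <= (e + e * (E / r ^+ 2)) / 2.
  have rn : r != 0 by rewrite gt_eqF.
  rewrite -subr_ge0 (_ : _ - _ = e / 2 * (1 - e / r) ^+ 2); last by rewrite /E; field.
  by rewrite mulr_ge0 ?sqr_ge0// divr_ge0// ltW.
rewrite /g -r2; have := ler_wpM2l L0 amgm; lra.
Qed.

(** Shift up to distance e^2 of c on both sides, cross c, and let e tend to 0. *)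
Lemma divided_difference_shift_across R (A B u v T C c : R) (h : R[i] -> R[i]) :
  0 < T -> A < u -> u < c -> c < v -> v < B ->
  (forall T, holo (rect A B T) h) -> (forall s, u <= Re s <= v -> normc (h s) <= C) ->
  normc (cintegral (leb R) `[- T, T] (fun t => divided_difference h c (v +i* t)) -
    cintegral (leb R) `[- T, T] (fun t => divided_difference h c (u +i* t)))
  <= 4 * ((C + normc (h c%:C)) / T) * (v - u).
Proof.
move=> T0 Au uc cv vB hh hC; have [K K0 hK] := divided_difference_cross c T0 hh.
set M := 4 * _; pose J x := cintegral (leb R) `[- T, T] (fun t => divided_difference h c (x +i* t)).
rewrite -!/(J _).
have M0 : 0 <= M.
  rewrite /M mulr_ge0// divr_ge0 ?(ltW T0)// addr_ge0 ?normc_ge0//.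
  by apply: le_trans (normc_ge0 _) (hC c%:C _) => /=; apply/andP; split; lra.
apply/ler_addgt0Pr => e0 e00.
pose d := Num.min (c - u) (v - c).
have d0 : 0 < d by rewrite lt_min; apply/andP; split; lra.
(* e <= 1 gives e^2 <= e, hence the lines at c - e^2 and c + e^2 stay between u and v. *)
pose e := Num.min (e0 / (K + 1)) (Num.min d 1).
have K1 : 0 < K + 1 by lra.
have ep : 0 < e by rewrite /e lt_min divr_gt0//= lt_min d0 ltr01.
have e1 : e <= e0 / (K + 1) by rewrite ge_min lexx.
have e2 : e <= 1 by rewrite !ge_min lexx !orbT.
have e3 : e <= c - u by rewrite !ge_min lexx !orbT.
have e4 : e <= v - c by rewrite !ge_min lexx !orbT.
have E1 : e ^+ 2 <= e by rewrite expr2 ler_piMr// ltW.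
have E0 : 0 < e ^+ 2 by rewrite exprn_gt0.
have b1 : normc (J v - J (c + e ^+ 2)) <= M * (v - (c + e ^+ 2)).
  apply: (divided_difference_shift T0 _ _ vB) => //; [lra|lra|left; lra|].
  by move=> s /andP[a b]; apply: hC; apply/andP; split; lra.
have b2 : normc (J (c - e ^+ 2) - J u) <= M * ((c - e ^+ 2) - u).
  apply: (@divided_difference_shift _ A B) => //; [lra|lra|right; lra|].
  by move=> s /andP[a b]; apply: hC; apply/andP; split; lra.
have b3 : normc (J (c + e ^+ 2) - J (c - e ^+ 2)) <= K * e.
  by apply: hK => //; lra.
rewrite (_ : J v - J u = (J v - J (c + e ^+ 2)) + (J (c + e ^+ 2) - J (c - e ^+ 2))
   + (J (c - e ^+ 2) - J u)); last by ring.
apply: le_trans (normcD_le _ _) _; apply: le_trans (lerD (normcD_le _ _) (lexx _)) _.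
have Ke : K * e <= e0.
  apply: (@le_trans _ _ ((K + 1) * e)); first by rewrite ler_wpM2r ?(ltW ep)// lerDl.
  by rewrite mulrC -ler_pdivlMr.
have := mulr_ge0 M0 (ltW E0); lra.
Qed.

Lemma integrable_expR_norm R :
  (leb R).-integrable setT (EFin \o (fun t : R => expR (- `|t|))).
Proof.
have pi0 := @pi_gt0 R.
have m : measurable_fun [set: measurableTypeR R] (fun t : R => expR (- `|t|)).
  apply: continuous_measurable_fun => t.
  apply: (@continuous_comp _ _ _ (fun t : R => - `|t|) (@expR R)); last exact: continuous_expR.
  by apply: cvgN; exact: norm_continuous.
apply: (@integrable_exhaustion _ _ R (leb R) setT (fun n => `[- n.+1%:R, n.+1%:R]%classic) _ (4 * pi)) => //.
- move=> n k nk; rewrite subsetEset => t; rewrite /= !in_itv /= -!ler_norml => /le_trans; apply.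
  by rewrite ler_nat.
- apply/seteqP; split => // t _; exists (Num.truncn `|t|) => //=.
  by rewrite in_itv/= -ler_norml ltW// truncnS_gt.
move=> n; set T : R := n.+1%:R.
have T0 : 0 < T by rewrite ltr0n.
have [r i] := Rintegral_poisson (oner_neq0 R) T0.
have mT : measurable (`[- T, T]%classic : set (measurableTypeR R)) by exact: measurable_itv.
have i4 : (leb R).-integrable `[- T, T] (EFin \o (fun t => 4 * (1 / (1 ^+ 2 + t ^+ 2)))).
  by have := integrableZl mT 4 i; apply: eq_integrable.
have h (t : R) : expR (- `|t|) <= 4 * (1 / (1 ^+ 2 + t ^+ 2)).
  have a1 : 1 + `|t| / 2 <= expR (`|t| / 2) := expR_ge1Dx _.
  have a2 : (1 + `|t| / 2) ^+ 2 <= expR `|t|.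
    rewrite (_ : expR `|t| = expR (`|t| / 2) ^+ 2); last by rewrite expr2 -expRD; congr expR; lra.
    by rewrite lerXn2r ?nnegrE ?expR_ge0// addr_ge0// divr_ge0.
  rewrite expRN mul1r expr1n ler_pdivlMr ?ltr_wpDr ?sqr_ge0//.
  rewrite mulrC ler_pdivrMr ?expR_gt0//.
  by have := normr_ge0 t; rewrite -(real_normK (num_real t)); nra.
pose g (t : R) : R := 4 * (1 / (1 ^+ 2 + t ^+ 2)).
apply: (@le_trans _ _ (\int[leb R]_(t in `[(- T)%R, T]) (g t)%:E)%E).
  apply: ge0_le_integral => //.
  - by apply/measurable_EFinP; apply: measurable_funTS.
  - exact: measurable_int i4.
  - by move=> t _; rewrite lee_fin h.
have := integrable_fin_num mT i4 => /fineK <-; rewrite lee_fin.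
change (Rintegral (leb R) `[- T, T] (fun t : R => 4 * (1 / (1 ^+ 2 + t ^+ 2))) <= 4 * pi).
rewrite RintegralZl// r.
have := ltW (atan_ltpi2 (T / 1)); lra.
Qed.

(** An odd integrand: the primitive takes equal values at -T and T. *)
Lemma Rintegral_odd_kernel R (a T : R) : a != 0 -> 0 < T ->
  Rintegral (leb R) `[- T, T] (fun t => - (t / (a ^+ 2 + t ^+ 2))) = 0 /\
  (leb R).-integrable `[- T, T] (EFin \o (fun t => - (t / (a ^+ 2 + t ^+ 2)))).
Proof.
move=> a0 T0.
have p0 (t : R) : 0 < a ^+ 2 + t ^+ 2 by rewrite ltr_wpDr ?sqr_ge0// exprn_even_gt0.
have d (t : R) : is_derive t 1 (fun t => - 2^-1 * ln (a ^+ 2 + t ^+ 2)) (- (t / (a ^+ 2 + t ^+ 2))).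
  have h1 : is_derive t 1 (fun t => a ^+ 2 + t ^+ 2) (2 * t).
    have h0 : is_derive t 1 (fun t : R => t ^+ 2) (2 * t).
      apply: DeriveDef; first exact: exprn_derivable.
      by rewrite exp_derive /= /GRing.scale/= mulr1 expr1.
    have -> : (fun t => a ^+ 2 + t ^+ 2) = cst (a ^+ 2) + (fun t : R => t ^+ 2) by [].
    by apply: is_derive_eq; rewrite add0r.
  have h2 := is_derive1_comp (f := @ln R) (g := fun t => a ^+ 2 + t ^+ 2) (is_derive1_ln (p0 t)) h1.
  have -> : (fun t => - 2^-1 * ln (a ^+ 2 + t ^+ 2)) =
    (- 2^-1) \*: (@ln R \o (fun t => a ^+ 2 + t ^+ 2)) by [].
  apply: is_derive_eq; rewrite /GRing.scale/=.
  have q0 : a ^+ 2 + t ^+ 2 != 0 by rewrite gt_eqF.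
  by field.
have cf (t : R) : {for t, continuous (fun t : R => - (t / (a ^+ 2 + t ^+ 2)))}.
  apply: cvgN; apply: cvgM; first exact: cvg_id.
  apply: cvgV; first by rewrite gt_eqF.
  by apply: cvgD; [exact: cvg_cst|exact: exprn_continuous].
split; last by apply: continuous_segment_integrable => t _; exact: cf.
rewrite (@Rintegral_derivative R (fun t => - 2^-1 * ln (a ^+ 2 + t ^+ 2)))//.
- by rewrite sqrrN subrr.
- by lra.
- by apply: continuous_subspaceT => t; exact: cf.
Qed.

Lemma cintegral_line_inv R (x c T : R) : x != c -> 0 < T ->
  cintegral (leb R) `[- T, T] (fun t => ((x +i* t) - c%:C)^-1) = (2 * atan (T / (x - c)))%:C /\
  cintegrable (leb R) `[- T, T] (fun t => ((x +i* t) - c%:C)^-1).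
Proof.
rewrite -subr_eq0 => a0 T0.
have [r1 i1] := Rintegral_poisson a0 T0; have [r2 i2] := Rintegral_odd_kernel a0 T0.
have E t : ((x +i* t) - c%:C)^-1 = ((x - c) / ((x - c) ^+ 2 + t ^+ 2)) +i*
    (- (t / ((x - c) ^+ 2 + t ^+ 2))).
  have -> : (x +i* t) - c%:C = (x - c) +i* t by apply: complexP; rewrite !cE /=; ring.
  by [].
have -> : (fun t => ((x +i* t) - c%:C)^-1) = (fun t => ((x - c) / ((x - c) ^+ 2 + t ^+ 2)) +i*
    (- (t / ((x - c) ^+ 2 + t ^+ 2)))) by apply/funext => t; exact: E.
by split; [rewrite /cintegral r1 r2|split].
Qed.

(** The residue theorem for two vertical lines.  On [-T, T] the integrals of
    the divided difference along the two lines differ by O(1/T), and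
    the integral of h(c) / (s - c) is 2 h(c) atan(T / (x - c)), which tends to
    pi h(c) on the right of c and to - pi h(c) on the left. *)
Lemma residue_shift R (A B u v c C : R) (h : R[i] -> R[i]) :
  A < u -> u < c -> c < v -> v < B ->
  (forall T, holo (rect A B T) h) ->
  (forall s, u <= Re s <= v -> normc (h s) <= C * expR (- `|Im s|)) ->
  cintegral (leb R) setT (fun t => h (v +i* t) * ((v +i* t) - c%:C)^-1) -
  cintegral (leb R) setT (fun t => h (u +i* t) * ((u +i* t) - c%:C)^-1) =
  (2 * pi)%:C * h c%:C.
Proof.
move=> Au uc cv vB hh hC.
have C0 : 0 <= C.
  have := hC c%:C; rewrite /= normr0 oppr0 expR0 mulr1 => /(_ _).
  by move=> H; apply: le_trans (normc_ge0 _) (H _); apply/andP; split; lra.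
have hC1 s : u <= Re s <= v -> normc (h s) <= C.
  move=> /hC /le_trans; apply; rewrite ler_piMr// -expR0 ler_expR oppr_le0//.
pose f x t := h (x +i* t) * ((x +i* t) - c%:C)^-1.
have mT T : measurable (`[- T, T]%classic : set (measurableTypeR R)) by exact: measurable_itv.
have ifx x : u <= x <= v -> x != c -> cintegrable (leb R) setT (f x).
  move=> /andP[ux xv] xc.
  have holo_f T : holo (rect x x T) (fun s => h s * (s - c%:C)^-1).
    apply: holoM; last first.
      apply: holo_subr_inv; case: (ltgtP x c) xc => // ? _; by [right|left].
    apply: holo_sub (hh T) => s [/andP[a b] d]; split => //.
    by apply/andP; split; lra.
  have cf (t : R) : {for t, continuous (fun t => Re (f x t))} /\
      {for t, continuous (fun t => Im (f x t))}.
    apply: (@holo_line_continuous _ x x (`|t| + 1) x t (fun s => h s * (s - c%:C)^-1)) => //.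
    - by rewrite lexx.
    - by rewrite ltrDl.
  have d0 : 0 < `|x - c| by rewrite normr_gt0 subr_eq0.
  apply: (@cintegrable_dominated _ _ R (leb R) setT (f x) (fun t => C / `|x - c| * expR (- `|t|))) => //.
  - split; apply: continuous_measurable_fun => t; by have [] := cf t.
  - by have := integrableZl measurableT (C / `|x - c|) (integrable_expR_norm R); apply: eq_integrable.
  - move=> t _; rewrite /f Normc.normcM Normc.normcV mulrAC.
    apply: ler_pM; rewrite ?invr_ge0 ?normc_ge0//.
      by apply: hC => /=; rewrite ux xv.
    rewrite lef_pV2 ?posrE//.
      by have := Re_le_normc ((x +i* t) - c%:C); rewrite !cE.
    by apply: lt_le_trans d0 _; have := Re_le_normc ((x +i* t) - c%:C); rewrite !cE.
have uv : u <= u <= v by apply/andP; split; lra.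
have vv : u <= v <= v by apply/andP; split; lra.
have uc' : u != c by rewrite lt_eqF.
have vc' : v != c by rewrite gt_eqF.
have i1 := ifx _ vv vc'; have i2 := ifx _ uv uc'.
pose S x n := cintegral (leb R) `[- n.+1%:R, n.+1%:R] (f x).
have SE x n : u <= x <= v -> x != c ->
    cintegral (leb R) `[- n.+1%:R, n.+1%:R] (fun t => divided_difference h c (x +i* t)) =
    S x n - h c%:C * (2 * atan (n.+1%:R / (x - c)))%:C.
  move=> xx xc; have T0 : 0 < n.+1%:R :> R by rewrite ltr0n.
  have [<- i3] := cintegral_line_inv xc T0.
  have isub : cintegrable (leb R) `[- n.+1%:R, n.+1%:R] (f x).
    have [j1 j2] := ifx x xx xc.
    by split; [apply: integrableS j1|apply: integrableS j2].
  rewrite /S -cintegralZ// -cintegralB//; last exact: cintegrableZ.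
  by apply: eq_cintegral => t _; rewrite /divided_difference /f mulrBl.
(* The difference of the truncated integrals, minus the explicit part. *)
pose D n := (S v n - S u n) - h c%:C * (2 * atan (n.+1%:R / (v - c)) - 2 * atan (n.+1%:R / (u - c)))%:C.
have hD n : normc (D n) <= (4 * (C + normc (h c%:C)) * (v - u)) * n.+1%:R^-1.
  have T0 : 0 < n.+1%:R :> R by rewrite ltr0n.
  have := divided_difference_shift_across T0 Au uc cv vB hh hC1.
  rewrite !SE// (_ : _ - _ = D n); last by rewrite /D rmorphB /=; ring.
  by move/le_trans; apply; apply: le_of_eq; ring.
have cvg_atan k : 0 < k -> (fun n : nat => 2 * atan (n.+1%:R / k)) @ \oo --> (pi : R).
  move=> k0; have -> : pi = 2 * (pi / 2) :> R by rewrite mulrC divfK.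
  apply: cvgM; first exact: cvg_cst.
  apply: cvg_comp (@cvgy_atan R).
  apply/cvgryPge => M; near=> n.
  rewrite ler_pdivlMr//; apply: ltW; near: n.
  exists (Num.truncn `|M * k|) => // n /= hn.
  apply: le_lt_trans (ler_norm _) _; apply: lt_le_trans (truncnS_gt _) _.
  by rewrite ler_nat ltnS.
have atan_v : (fun n : nat => 2 * atan (n.+1%:R / (v - c))) @ \oo --> (pi : R).
  by apply: cvg_atan; rewrite subr_gt0.
have atan_u : (fun n : nat => 2 * atan (n.+1%:R / (u - c))) @ \oo --> (- pi : R).
  have -> : (fun n : nat => 2 * atan (n.+1%:R / (u - c))) =
      (fun n : nat => - (2 * atan (n.+1%:R / (c - u)))).
    apply/funext => n; rewrite -mulrN -atanN; congr (_ * atan _).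
    by rewrite -opprB invrN mulrN.
  by apply: cvgN; apply: cvg_atan; rewrite subr_gt0.
have exh (g : R -> R) : (leb R).-integrable setT (EFin \o g) ->
    (fun n : nat => Rintegral (leb R) `[- n.+1%:R, n.+1%:R] g) @ \oo --> Rintegral (leb R) setT g.
  move=> ig; apply: (@cvg_Rintegral_exhaustion _ _ R (leb R) setT
     (fun n : nat => `[- n.+1%:R, n.+1%:R]%classic)) => //.
  move=> t _; exists (Num.truncn `|t|) => // n /= hn; rewrite in_itv /= -ler_norml.
  apply: ltW; apply: lt_le_trans (truncnS_gt _) _; by rewrite ler_nat ltnS.
set W := h c%:C in D hD *.
pose th n := 2 * atan (n.+1%:R / (v - c)) - 2 * atan (n.+1%:R / (u - c)) : R.
have thc : th @ \oo --> (2 * pi : R).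
  have -> : 2 * pi = pi - (- pi) :> R by rewrite opprK; ring.
  exact: cvgB.
(* The limit is taken separately for the real and the imaginary part. *)
have key (p : R[i] -> R) (pB : forall a b, p (a - b) = p a - p b)
   (pZ : forall a (r : R), p (a * r%:C) = p a * r) (pn : forall a, `|p a| <= normc a)
   (pS : forall x, u <= x <= v -> x != c -> (fun n => p (S x n)) @ \oo --> p (cintegral (leb R) setT (f x))) :
   p (cintegral (leb R) setT (f v) - cintegral (leb R) setT (f u)) = p ((2 * pi)%:C * W).
  have l1 : (fun n => p (D n)) @ \oo --> 0.
    by apply: (@cvg0_harmonic_bound _ _ (4 * (C + normc W) * (v - u))) => n; apply: le_trans (pn _) (hD n).
  have l2 : (fun n => p (D n)) @ \oo --> p (cintegral (leb R) setT (f v)) -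
       p (cintegral (leb R) setT (f u)) - p W * (2 * pi).
    under eq_fun do rewrite /D !pB pZ.
    apply: cvgB; first by apply: cvgB; exact: pS.
    by apply: cvgM; [exact: cvg_cst|exact: thc].
  have := cvg_unique _ l1 l2 => /(_ (@Rhausdorff R)) e.
  by rewrite pB [_ * W]mulrC pZ; apply/eqP; rewrite -subr_eq0 -e.
apply: complexP.
- apply: (key (@complex.Re R)).
  + by move=> a b; rewrite ReD ReN.
  + by move=> a r; rewrite ReM /= mulr0 subr0.
  + exact: Re_le_normc.
  + by move=> x xx xc; apply: exh; have [] := ifx x xx xc.
- apply: (key (@complex.Im R)).
  + by move=> a b; rewrite ImD ImN.
  + by move=> a r; rewrite ImM /= mulr0 add0r.
  + exact: Im_le_normc.
  + by move=> x xx xc; apply: exh; have [] := ifx x xx xc.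
Unshelve. all: by end_near. Qed.

(** * Expansion of the generalized Wright function at the origin *)

(** The remainder cos x - 1 + x^2 / 2 is nonnegative; at x = pi / 2 this says
    that x^2 >= 2. *)
Lemma pihalf_ge54 R : 5 / 4 <= pi / 2 :> R.
Proof.
rewrite leNgt; apply/negP => h.
have := cos_rest_ge0 1 (pi / 2 : R).
rewrite /cos_rest /cos_taylor big_ord_recl big_ord1 /= /bump /= cos_pihalf.
rewrite muln0 muln1 !expr0 fact0 expr1 (_ : (2`!)%:R = 2 :> R)//.
have p0 : 0 < pi / 2 :> R by rewrite divr_gt0// pi_gt0.
by move: (pi / 2 : R) h p0 => x h p0; nra.
Qed.

Lemma holo_affine_rect R (x0 x1 T c k : R) (F : R[i] -> R[i]) : 0 < k ->
  holo (rect (c - k * x1) (c - k * x0) (k * T)) F ->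
  holo (rect x0 x1 T) (fun s => F (c%:C - k%:C * s)).
Proof.
move=> k0 hF; apply: eq_holo (holo_affine (b := c%:C) (c := - k%:C) _ hF) => [s _|s].
  by rewrite mulNr.
move=> [/andP[a b] d]; rewrite mulNr; split.
  rewrite !cE /= mul0r subr0.
  by have := ler_wpM2l (ltW k0) a; have := ler_wpM2l (ltW k0) b; lra.
by rewrite !cE /= mul0r addr0 add0r normrN normrM gtr0_norm// ler_pM2l.
Qed.

Lemma Re_affine R (c k : R) (s : R[i]) :
  Re (c%:C - k%:C * s) = c - k * Re s.
Proof. by rewrite !cE /= mul0r subr0. Qed.

Lemma Im_affine_norm R (c k : R) (s : R[i]) : 0 < k ->
  `|Im (c%:C - k%:C * s)| = k * `|Im s|.
Proof. by move=> k0; rewrite !cE /= mul0r addr0 add0r normrN normrM gtr0_norm. Qed.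

Lemma holo_Gamma_affine R (x0 x1 T c k : R) : 0 < k -> k * x1 < c ->
  holo (rect x0 x1 T) (fun s => Gamma (c%:C - k%:C * s)).
Proof.
move=> k0 kc.
apply: (@eq_holo _ _ (fun s => euler_gamma (c%:C - k%:C * s))).
  move=> s [/andP[a b] d]; rewrite Gamma_euler// Re_affine.
  by have := ler_wpM2l (ltW k0) b; lra.
by apply: holo_affine_rect => //; apply: holo_euler_gamma; lra.
Qed.

Lemma Gamma_affine_upper R (x0 x1 c k e : R) : 0 < k -> k * x1 < c -> 0 < e ->
  exists2 C : R, 0 <= C & forall s, x0 <= Re s <= x1 ->
   normc (Gamma (c%:C - k%:C * s)) <= C * expR (- ((pi / 2 - e) * k) * `|Im s|).
Proof.
move=> k0 kc e0; have d0 : 0 < c - k * x1 by lra.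
have [C C0 hC] := @euler_gamma_upper R (c - k * x1) (c - k * x0) e d0 e0.
exists C => [|s /andP[a b]]; first exact: ltW.
have h1 := ler_wpM2l (ltW k0) a; have h2 := ler_wpM2l (ltW k0) b.
rewrite Gamma_euler ?Re_affine; last by lra.
have := hC (c%:C - k%:C * s); rewrite Re_affine Im_affine_norm// => /(_ _)/le_trans; apply.
  by apply/andP; split; lra.
by rewrite ler_pM2l// ler_expR; apply: le_of_eq; ring.
Qed.

Lemma Gamma_invE R (s : R[i]) (N : nat) : - N%:R < Re s ->
  (Gamma s)^-1 = \prod_(k < N) (s + k%:R) * (euler_gamma (s + N%:R))^-1.
Proof. by move=> h; rewrite (Gamma_shiftE h) invf_div mulrC. Qed.

Lemma nat_shift_exists R (x : R) : exists N : nat, 0 < x + N%:R.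
Proof.
exists (Num.truncn `|x|).+1; have := truncnS_gt `|x|.
have : - x <= `|x| by rewrite -normrN ler_norm.
by lra.
Qed.

(** Unlike Gamma, its inverse is entire, so that k * x1 need not lie below c:
    the shifted form is a polynomial divided by a nonvanishing Gamma. *)
Lemma holo_Gamma_inv_affine R (x0 x1 T c k : R) : 0 < k ->
  holo (rect x0 x1 T) (fun s => (Gamma (c%:C - k%:C * s))^-1).
Proof.
move=> k0; have [N N0] := nat_shift_exists (c - k * x1).
have low s : rect x0 x1 T s -> c - k * x1 <= Re (c%:C - k%:C * s).
  by move=> [/andP[a b] d]; rewrite Re_affine lerD2l lerN2 ler_pM2l.
apply: (@eq_holo _ _ (fun s => \prod_(l < N) ((c%:C - k%:C * s) + l%:R) *
   (euler_gamma ((c + N%:R)%:C - k%:C * s))^-1)).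
  move=> s Ds; rewrite (@Gamma_invE _ _ N); last by have := low s Ds; lra.
  by rewrite rmorphD /= (rmorph_nat (real_complex R)) addrAC.
have hid := holo_id_rect x0 x1 T.
apply: holoM.
  apply: holo_prod => l; apply: holoD; last exact: holo_cst.
  apply: eq_holo (holoD (holo_cst _ c%:C) (holoM (holo_cst _ (- k%:C)) hid)) => s _.
  by rewrite mulNr.
have hG : holo (rect x0 x1 T) (fun s => euler_gamma ((c + N%:R)%:C - k%:C * s)).
  by apply: holo_affine_rect => //; apply: holo_euler_gamma; lra.
have d0 : 0 < c + N%:R - k * x1 by lra.
have [C C0 hC] := @euler_gamma_lower R (c + N%:R - k * x1) (c + N%:R - k * x0) 1 d0 ltr01.
apply: (holoV (c := C * expR (- ((pi / 2 + 1) * (k * `|T|))))) hG.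
  by rewrite mulr_gt0// expR_gt0.
move=> s [/andP[a b] d].
have h1 := ler_wpM2l (ltW k0) a; have h2 := ler_wpM2l (ltW k0) b.
have := hC ((c + N%:R)%:C - k%:C * s); rewrite Re_affine Im_affine_norm// => /(_ _).
move=> H; apply: le_trans (H _); last by apply/andP; split; lra.
rewrite ler_pM2l// ler_expR lerN2; apply: ler_wpM2l; first by have := @pi_gt0 R; lra.
by apply: ler_wpM2l; [exact: ltW|apply: le_trans d _; exact: ler_norm].
Qed.

(** Polynomial growth is absorbed by an exponential with small rate. *)
Lemma normc_shift_le_exp R (x0 x1 e : R) (l : nat) : 0 < e ->
  exists2 C : R, 0 <= C & forall s, x0 <= Re s <= x1 ->
    normc (s + l%:R) <= C * expR (e * `|Im s|).
Proof.
move=> e0; pose K := `|x0| + `|x1| + l%:R.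
have K0 : 0 <= K by rewrite !addr_ge0.
exists (K + e^-1) => [|s /andP[a b]]; first by rewrite addr_ge0// invr_ge0 ltW.
apply: le_trans (normc_le_ReIm _) _; rewrite ReD ImD Re_natr Im_natr addr0.
have h1 : `|Re s + l%:R| <= K.
  apply: le_trans (ler_normD _ _) _; rewrite (ger0_norm (ler0n R l)) /K lerD2r.
  rewrite ler_norml; have := ler_norm x1; have : - x0 <= `|x0| by rewrite -normrN ler_norm.
  by have := normr_ge0 x0; have := normr_ge0 x1; move=> *; apply/andP; split; lra.
have h2 : 1 + e * `|Im s| <= expR (e * `|Im s|) := expR_ge1Dx _.
have n0 := normr_ge0 (Im s).
have h3 : 1 <= expR (e * `|Im s|) by have := mulr_ge0 (ltW e0) n0; lra.
rewrite mulrDl; apply: lerD.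
  by apply: le_trans h1 _; rewrite ler_peMr.
rewrite -ler_pdivrMl ?invr_gt0// invrK; lra.
Qed.

Lemma prod_exp_bound R (D : set R[i]) I (r : seq I) (F : I -> R[i] -> R[i]) (c : I -> R) :
  (forall i, exists2 C : R, 0 <= C & forall s, D s -> normc (F i s) <= C * expR (c i * `|Im s|)) ->
  exists2 C : R, 0 <= C & forall s, D s ->
    normc (\prod_(i <- r) F i s) <= C * expR ((\sum_(i <- r) c i) * `|Im s|).
Proof.
move=> h; elim: r => [|i r [C C0 hC]].
  by exists 1 => // s _; rewrite !big_nil Normc.normc1 mul0r expR0 mulr1.
have [K K0 hK] := h i; exists (K * C) => [|s Ds]; first by rewrite mulr_ge0.
rewrite !big_cons Normc.normcM mulrDl expRD mulrACA.
by apply: ler_pM; rewrite ?normc_ge0 ?hK ?hC.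
Qed.

(** The total loss e is shared among the N linear factors of the shifted form
    and the lower bound of Gamma. *)
Lemma Gamma_inv_affine_upper R (x0 x1 c k e : R) : 0 < k -> 0 < e ->
  exists2 C : R, 0 <= C & forall s, x0 <= Re s <= x1 ->
   normc ((Gamma (c%:C - k%:C * s))^-1) <= C * expR (((pi / 2 + e) * k) * `|Im s|).
Proof.
move=> k0 e0; have [N N0] := nat_shift_exists (c - k * x1).
pose d := e / N.+1%:R.
have d0 : 0 < d by rewrite divr_gt0.
have dN : N%:R * d + d = e by rewrite /d -natr1; field; rewrite natr1 pnatr_eq0.
have [K K0 hK] := @euler_gamma_lower R (c - k * x1 + N%:R) (c - k * x0 + N%:R) d N0 d0.
have [P P0 hP] := @prod_exp_bound R [set w | c - k * x1 <= Re w <= c - k * x0] _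
   (index_enum 'I_N) (fun l w => w + (l : nat)%:R) (fun=> d)
   (fun l => normc_shift_le_exp _ _ l d0).
exists (P / K) => [|s /andP[a b]]; first by rewrite divr_ge0// ltW.
have h1 := ler_wpM2l (ltW k0) a; have h2 := ler_wpM2l (ltW k0) b.
set w := c%:C - k%:C * s.
have Rw : Re w = c - k * Re s by exact: Re_affine.
have Iw : `|Im w| = k * `|Im s| by exact: Im_affine_norm.
rewrite (@Gamma_invE _ w N) ?Rw; last by lra.
have Hw : c - k * x1 <= Re w <= c - k * x0 by rewrite Rw; apply/andP; split; lra.
have q1 := hP w Hw.
have := hK (w + N%:R); rewrite ReD ImD Re_natr Im_natr addr0 => /(_ _).
move=> /(_ _) q2; have {}q2 : K * expR (- ((pi / 2 + d) * `|Im w|)) <= normc (euler_gamma (w + N%:R)).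
  by apply: q2; move: Hw => /andP[? ?]; apply/andP; split; lra.
rewrite Normc.normcM Normc.normcV.
apply: (@le_trans _ _ (P * expR ((\sum_(l < N) d) * `|Im w|) *
   (K * expR (- ((pi / 2 + d) * `|Im w|)))^-1)).
  apply: ler_pM; rewrite ?invr_ge0 ?normc_ge0//.
  rewrite lef_pV2// posrE ?mulr_gt0 ?expR_gt0//.
  by apply: lt_le_trans q2; rewrite mulr_gt0 ?expR_gt0.
rewrite invfM -expRN opprK mulrACA -expRD Iw sumr_const card_ord -(mulr_natl d N).
apply: ler_wpM2l; first by rewrite divr_ge0// ltW.
by rewrite ler_expR -dN; apply: le_of_eq; ring.
Qed.

Definition dual_ratio R (p m : nat) (a alpha : 'I_p -> R)
    (b beta : 'I_m -> R) (s : R[i]) : R[i] :=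
  (\prod_(j < m) Gamma ((b j + beta j)%:C - (beta j)%:C * s)) /
  (\prod_(i < p) Gamma ((a i + alpha i)%:C - (alpha i)%:C * s)).

Lemma holo_dual_ratio R (p m : nat) (a alpha : 'I_p -> R)
    (b beta : 'I_m -> R) (x0 x1 T : R) :
  (forall i, 0 < alpha i) -> (forall j, 0 < beta j) ->
  (forall j, beta j * x1 < b j + beta j) ->
  holo (rect x0 x1 T) (dual_ratio a alpha b beta).
Proof.
move=> al0 be0 hx; rewrite /dual_ratio.
under eq_fun do rewrite -prodfV.
apply: holoM; apply: holo_prod => i; first exact: holo_Gamma_affine.
exact: holo_Gamma_inv_affine.
Qed.

Lemma dual_ratio_upper R (p m : nat) (a alpha : 'I_p -> R)
    (b beta : 'I_m -> R) (x0 x1 e : R) :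
  (forall i, 0 < alpha i) -> (forall j, 0 < beta j) ->
  (forall j, beta j * x1 < b j + beta j) -> 0 < e ->
  exists2 C : R, 0 <= C & forall s, x0 <= Re s <= x1 ->
    normc (dual_ratio a alpha b beta s) <= C * expR
     ((- ((pi / 2 - e) * \sum_(j < m) beta j) + (pi / 2 + e) * \sum_(i < p) alpha i) * `|Im s|).
Proof.
move=> al0 be0 hx e0.
have [C C0 hC] := @prod_exp_bound R [set s | x0 <= Re s <= x1] _ (index_enum 'I_m)
   (fun j s => Gamma ((b j + beta j)%:C - (beta j)%:C * s)) (fun j => - ((pi / 2 - e) * beta j))
   (fun j => Gamma_affine_upper x0 (be0 j) (hx j) e0).
have [K K0 hK] := @prod_exp_bound R [set s | x0 <= Re s <= x1] _ (index_enum 'I_p)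
   (fun i s => (Gamma ((a i + alpha i)%:C - (alpha i)%:C * s))^-1)
   (fun i => (pi / 2 + e) * alpha i)
   (fun i => Gamma_inv_affine_upper x0 x1 _ (al0 i) e0).
exists (C * K) => [|s xs]; first by rewrite mulr_ge0.
rewrite /dual_ratio -prodfV Normc.normcM mulrDl expRD mulrACA.
apply: ler_pM; rewrite ?normc_ge0//.
- by have := hC s xs; rewrite sumrN mulr_sumr.
- by have := hK s xs; rewrite mulr_sumr.
Qed.

(** The product (s + k) Gamma(s), written so that it is regular for
    Re s > - k - 1 and off the points 0, -1, ..., 1 - k. *)
Definition gamma_reg R (k : nat) (s : R[i]) : R[i] :=
  euler_gamma (s + k.+1%:R) * \prod_(l < k) (s - (- (l : nat)%:R : R)%:C)^-1.

Lemma subr_opp_natC R (s : R[i]) (l : nat) :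
  s - (- l%:R : R)%:C = s + l%:R.
Proof. by rewrite rmorphN /= opprK (rmorph_nat (real_complex R)). Qed.

Lemma Gamma_regE R (k : nat) (s : R[i]) : - k.+1%:R < Re s ->
  Gamma s = gamma_reg k s * (s - (- k%:R : R)%:C)^-1.
Proof.
move=> h; rewrite (Gamma_shiftE h) /gamma_reg -mulrA prodfV -invfM; congr (_ / _).
rewrite big_ord_recr /= subr_opp_natC; congr (_ * _).
by apply: eq_bigr => l _; rewrite subr_opp_natC.
Qed.

Lemma holo_gamma_reg R (k : nat) (x0 x1 T : R) : - k.+1%:R < x0 ->
  (forall l, (l < k)%N -> x1 < - l%:R) -> holo (rect x0 x1 T) (@gamma_reg R k).
Proof.
move=> h0 h1; apply: holoM.
  have h2 : 0 < x0 + k.+1%:R by lra.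
  apply: eq_holo (holo_affine (b := k.+1%:R) (c := 1) (D := rect (x0 + k.+1%:R) (x1 + k.+1%:R) T) _ _) => [s _||].
  - by rewrite mul1r addrC.
  - move=> s [/andP[a b] d]; rewrite mul1r; split; last by rewrite ImD Im_natr add0r.
    by rewrite ReD Re_natr; apply/andP; split; lra.
  - exact: holo_euler_gamma.
apply: holo_prod => l; apply: holo_subr_inv; right; exact: h1.
Qed.

Lemma gamma_reg_upper R (k : nat) (x0 x1 e : R) : - k.+1%:R < x0 ->
  (forall l, (l < k)%N -> x1 < - l%:R) -> 0 < e ->
  exists2 C : R, 0 <= C & forall s, x0 <= Re s <= x1 ->
   normc (gamma_reg k s) <= C * expR (- (pi / 2 - e) * `|Im s|).
Proof.
move=> h0 h1 e0; have d0 : 0 < x0 + k.+1%:R by lra.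
have [C C0 hC] := @euler_gamma_upper R (x0 + k.+1%:R) (x1 + k.+1%:R) e d0 e0.
have hl (l : 'I_k) : exists2 K : R, 0 <= K & forall s, x0 <= Re s <= x1 ->
    normc ((s - (- (l : nat)%:R : R)%:C)^-1) <= K * expR (0 * `|Im s|).
  have xl := h1 l (ltn_ord l).
  exists (- l%:R - x1)^-1 => [|s /andP[a b]]; first by rewrite invr_ge0; lra.
  rewrite mul0r expR0 mulr1 Normc.normcV.
  have q : - l%:R - x1 <= normc (s - (- l%:R : R)%:C).
    apply: le_trans (Re_le_normc _); rewrite subr_opp_natC ReD Re_natr.
    by rewrite ler0_norm; lra.
  by rewrite lef_pV2// posrE; lra.
have [K K0 hK] := @prod_exp_bound R [set s | x0 <= Re s <= x1] _ (index_enum 'I_k) _ _ hl.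
exists (C * K) => [|s xs]; first by rewrite mulr_ge0// ltW.
have := hK s xs; rewrite big1_eq mul0r expR0 mulr1 => q.
rewrite /gamma_reg Normc.normcM mulrAC.
apply: ler_pM; rewrite ?normc_ge0//.
have := hC (s + k.+1%:R); rewrite ReD ImD Re_natr Im_natr addr0 mulNr; apply.
by move: xs => /andP[? ?]; apply/andP; split; lra.
Qed.

(** The exponents add up to - (pi / 2) (1 + a_star) plus a multiple of e that
    the choice of e makes at most 1/4; as pi / 2 >= 5/4 and a_star >= 0, the decay
    rate is at least 1. *)
Lemma gamma_reg_dual_ratio_upper R (p m : nat) (a alpha : 'I_p -> R)
    (b beta : 'I_m -> R) (k : nat) (x0 x1 : R) :
  (forall i, 0 < alpha i) -> (forall j, 0 < beta j) -> 0 <= astar alpha beta ->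
  (forall j, beta j * x1 < b j + beta j) ->
  - k.+1%:R < x0 -> (forall l, (l < k)%N -> x1 < - l%:R) ->
  exists2 C : R, 0 <= C & forall s, x0 <= Re s <= x1 ->
    normc (gamma_reg k s * dual_ratio a alpha b beta s) <= C * expR (- `|Im s|).
Proof.
move=> al0 be0 as0 hx h0 h1.
set Sa := \sum_(i < p) alpha i; set Sb := \sum_(j < m) beta j.
have Sa0 : 0 <= Sa by apply: sumr_ge0 => i _; exact: ltW.
have Sb0 : 0 <= Sb by apply: sumr_ge0 => i _; exact: ltW.
have as0' : 0 <= Sb - Sa := as0.
(* Small enough for the total loss e (1 + Sa + Sb) to be 1/4. *)
pose e : R := (4 * (1 + Sa + Sb))^-1.
have den : 0 < 4 * (1 + Sa + Sb) by lra.
have e0 : 0 < e by rewrite invr_gt0.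
have eS : e * (1 + Sa + Sb) = 1 / 4 by rewrite /e; field; rewrite gt_eqF//; lra.
have [C C0 hC] := gamma_reg_upper h0 h1 e0.
have [K K0 hK] := dual_ratio_upper a x0 al0 be0 hx e0.
exists (C * K) => [|s xs]; first by rewrite mulr_ge0.
rewrite Normc.normcM.
apply: (@le_trans _ _ (C * expR (- (pi / 2 - e) * `|Im s|) * (K * expR
     ((- ((pi / 2 - e) * Sb) + (pi / 2 + e) * Sa) * `|Im s|)))).
  by apply: ler_pM; rewrite ?normc_ge0 ?hC ?hK.
rewrite mulrACA -expRD; apply: ler_wpM2l; first by rewrite mulr_ge0.
rewrite ler_expR -mulrDl -[leRHS]mulN1r; apply: ler_wpM2r => //.
have pi54 := pihalf_ge54 R; have pi2 : 0 <= pi / 2 :> R by lra.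
have := mulr_ge0 as0' pi2; lra.
Qed.

Definition wright_integrand R (p m : nat) (a alpha : 'I_p -> R)
    (b beta : 'I_m -> R) (z : R) (s : R[i]) : R[i] :=
  Gamma s * dual_ratio a alpha b beta s * cpow z (- s).

Definition wright_line R (p m : nat) (a alpha : 'I_p -> R)
    (b beta : 'I_m -> R) (z x : R) : R[i] :=
  cintegral (leb R) setT (fun t => wright_integrand a alpha b beta z (x +i* t)).

Lemma cpowN_inv R (z : R) (s : R[i]) : 0 < z -> cpow z (- s) = cpow z^-1 s.
Proof. by move=> z0; rewrite /cpow lnV ?posrE// rmorphN /= mulrN mulNr. Qed.

Lemma cpow_nat R (z : R) (k : nat) : 0 < z -> cpow z k%:R = (z ^+ k)%:C.
Proof.
move=> z0; elim: k => [|k IH]; first by rewrite /cpow mul0r cexp0.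
rewrite -natr1 cpowD IH exprSr rmorphM /=; congr (_ * _).
by rewrite /cpow mul1r cexp_real lnK.
Qed.

Lemma prod_opp_fact R (k : nat) :
  \prod_(l < k) ((- k%:R : R)%:C - (- (l : nat)%:R : R)%:C) = ((-1) ^+ k * (k`!)%:R : R)%:C.
Proof.
transitivity (\prod_(l < k) (- ((k - l)%N%:R : R[i]))).
  apply: eq_bigr => l _; rewrite subr_opp_natC rmorphN /= (rmorph_nat (real_complex R)).
  by rewrite natrB ?(ltnW (ltn_ord l))// opprB addrC.
rewrite prodrN card_ord rmorphM rmorphXn rmorphN1 (rmorph_nat (real_complex R)); congr (_ * _).
elim: k => [|k IH]; first by rewrite big_ord0.
by rewrite big_ord_recl subn0 factS natrM -IH.
Qed.

(** The residue of Gamma at - k. *)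
Lemma gamma_reg_pole R (k : nat) :
  gamma_reg k (- k%:R : R)%:C = ((-1) ^+ k / (k`!)%:R : R)%:C.
Proof.
rewrite /gamma_reg prodfV prod_opp_fact.
have -> : (- k%:R : R)%:C + k.+1%:R = 1 :> R[i].
  by rewrite rmorphN /= (rmorph_nat (real_complex R)) -natr1 addKr.
rewrite euler_gamma1 mul1r -fmorphV; congr (_%:C).
by rewrite invfM invr_sign.
Qed.

Lemma mulr_rot3 (R : comPzRingType) (w x y z : R) : w * x * y * z = w * y * z * x.
Proof. by ring. Qed.

(** The residue theorem for the pole at - k; the lines are kept inside a strip
    [A, B] that contains no other pole. *)
Lemma wright_line_shift R (p m : nat) (a alpha : 'I_p -> R)
    (b beta : 'I_m -> R) (z u v A B : R) (k : nat) :
  (forall i, 0 < alpha i) -> (forall j, 0 < beta j) -> 0 <= astar alpha beta ->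
  (forall j, beta j * B < b j + beta j) -> 0 < z ->
  - k.+1%:R < A -> A < u -> u < - k%:R -> - k%:R < v -> v < B ->
  (forall l, (l < k)%N -> B < - l%:R) ->
  wright_line a alpha b beta z v - wright_line a alpha b beta z u =
  (2 * pi)%:C * (((-1) ^+ k / (k`!)%:R * z ^+ k)%:C * dual_ratio a alpha b beta (- k%:R : R)%:C).
Proof.
move=> al0 be0 as0 hB z0 kA Au uk kv vB hl.
pose h s := gamma_reg k s * dual_ratio a alpha b beta s * cpow z^-1 s.
have lineE x : A < x ->
    wright_line a alpha b beta z x =
    cintegral (leb R) setT (fun t => h (x +i* t) * ((x +i* t) - (- k%:R : R)%:C)^-1).
  move=> Ax; apply: eq_cintegral => t _; rewrite /wright_integrand /h cpowN_inv//.
  rewrite (@Gamma_regE _ k) /=; last by lra.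
  exact: mulr_rot3.
rewrite (lineE u)// (lineE v); last by lra.
have hv j : beta j * v < b j + beta j.
  by apply: lt_trans (hB j); rewrite ltr_pM2l.
have [C C0 hC] := @gamma_reg_dual_ratio_upper R p m a alpha b beta k u v al0 be0 as0 hv
   (lt_trans kA Au) (fun l lk => lt_trans vB (hl l lk)).
pose E := expR (u * ln z^-1) + expR (v * ln z^-1).
rewrite (@residue_shift R A B u v (- k%:R) (C * E) h)//.
- rewrite /h gamma_reg_pole -cpowN_inv// -rmorphN opprK rmorph_nat cpow_nat//.
  by congr (_ * _); rewrite rmorphM /=; ring.
- move=> T; apply: holoM; last exact: holo_cpow.
  by apply: holoM; [exact: holo_gamma_reg|exact: holo_dual_ratio].
- move=> s xs; rewrite /h Normc.normcM normc_cpow.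
  rewrite (_ : C * E * _ = C * expR (- `|Im s|) * E); last by rewrite mulrAC.
  apply: ler_pM; rewrite ?normc_ge0 ?expR_ge0 ?hC//.
  move: xs => /andP[us sv]; have [L0|L0] := leP 0 (ln z^-1).
    apply: (@le_trans _ _ (expR (v * ln z^-1))); last by rewrite lerDr expR_ge0.
    by rewrite ler_expR ler_wpM2r.
  apply: (@le_trans _ _ (expR (u * ln z^-1))); last by rewrite lerDl expR_ge0.
  by rewrite ler_expR ler_wnM2r// ltW.
Qed.

(** The bound in z comes from |z^(-s)| = z^(-x) on the line Re s = x. *)
Lemma wright_integrand_line R (p m : nat) (a alpha : 'I_p -> R)
    (b beta : 'I_m -> R) (x : R) (k : nat) :
  (forall i, 0 < alpha i) -> (forall j, 0 < beta j) -> 0 <= astar alpha beta ->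
  (forall j, beta j * x < b j + beta j) ->
  - k.+1%:R < x -> x != - k%:R -> (forall l, (l < k)%N -> x < - l%:R) ->
  exists2 C : R, 0 <= C & forall z, 0 < z ->
    cintegrable (leb R) setT (fun t => wright_integrand a alpha b beta z (x +i* t)) /\
    normc (wright_line a alpha b beta z x) <= C * expR (- (x * ln z)).
Proof.
move=> al0 be0 as0 hx kx xk hl.
have xx : x <= x by [].
have [C C0 hC] := @gamma_reg_dual_ratio_upper R p m a alpha b beta k x x al0 be0 as0 hx kx hl.
pose I := Rintegral (leb R) setT (fun t => expR (- `|t|)).
have I0 : 0 <= I by apply: Rintegral_ge0 => t _; exact: expR_ge0.
have d0 : 0 < `|x + k%:R| by rewrite normr_gt0 addr_eq0.
exists (2 * (C / `|x + k%:R| * I)) => [|z z0]; first by rewrite !mulr_ge0// invr_ge0.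
have E t : wright_integrand a alpha b beta z (x +i* t) =
    gamma_reg k (x +i* t) * dual_ratio a alpha b beta (x +i* t) * cpow z^-1 (x +i* t) *
    ((x +i* t) - (- k%:R : R)%:C)^-1.
  rewrite /wright_integrand cpowN_inv// (@Gamma_regE _ k)//.
  exact: mulr_rot3.
pose g (t : R) := C / `|x + k%:R| * expR (- (x * ln z)) * expR (- `|t|).
have ig : (leb R).-integrable setT (EFin \o g).
  by have := integrableZl measurableT (C / `|x + k%:R| * expR (- (x * ln z)))
    (integrable_expR_norm R); apply: eq_integrable.
have bound t : normc (wright_integrand a alpha b beta z (x +i* t)) <= g t.
  rewrite E !(Normc.normcM _ (_^-1)) Normc.normcM normc_cpow Normc.normcV /=.
  have h1 := hC (x +i* t); have {}h1 := h1 _; rewrite /= lexx in h1; have {}h1 := h1 isT.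
  have h2 : `|x + k%:R| <= normc ((x +i* t) - (- k%:R : R)%:C).
    by apply: le_trans (Re_le_normc _); rewrite subr_opp_natC ReD Re_natr.
  have h3 : (normc ((x +i* t) - (- k%:R : R)%:C))^-1 <= `|x + k%:R|^-1.
    by rewrite lef_pV2// posrE (lt_le_trans d0).
  rewrite lnV// mulrN.
  rewrite /g (_ : _ * expR (- `|t|) = C * expR (- `|t|) * expR (- (x * ln z)) * `|x + k%:R|^-1); last by ring.
  apply: ler_pM => //; rewrite ?invr_ge0 ?normc_ge0// ?mulr_ge0 ?normc_ge0 ?expR_ge0//.
  by apply: ler_wpM2r => //; exact: expR_ge0.
have hol T : holo (rect x x T) (fun s => gamma_reg k s * dual_ratio a alpha b beta s *
    cpow z^-1 s * (s - (- k%:R : R)%:C)^-1).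
  apply: holoM; last first.
    by apply: holo_subr_inv; case: (ltgtP x (- k%:R)) xk => // ? _; [right|left].
  apply: holoM; last exact: holo_cpow.
  by apply: holoM; [exact: holo_gamma_reg|exact: holo_dual_ratio].
have cm (t : R) := @holo_line_continuous R x x (`|t| + 1) x t _ (hol _) _ _.
have fE : (fun t => wright_integrand a alpha b beta z (x +i* t)) =
  (fun t => gamma_reg k (x +i* t) * dual_ratio a alpha b beta (x +i* t) * cpow z^-1 (x +i* t) *
    ((x +i* t) - (- k%:R : R)%:C)^-1) by apply/funext => t; exact: E.
have ci : cintegrable (leb R) setT (fun t => wright_integrand a alpha b beta z (x +i* t)).
  apply: (cintegrable_dominated measurableT _ ig) => //.
  have xxx : x <= x <= x by rewrite lexx.
  have tt1 (t : R) : `|t| < `|t| + 1 by rewrite ltrDl.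
  rewrite fE; split; apply: continuous_measurable_fun => t; by have [] := cm xxx tt1 t.
split => //.
apply: le_trans (normc_cintegral_le measurableT ci ig (fun t _ => bound t)) _.
rewrite /g RintegralZl//; last exact: integrable_expR_norm.
by rewrite -/I; apply: le_of_eq; ring.
Qed.

(** It provides room to the right of the line Re s = gamma for all the
    finitely many Gamma functions of the numerator at once. *)
Lemma finite_gap R (I : finType) (f : I -> R) (c : R) :
  (forall i, c < f i) -> exists2 B : R, c < B & forall i, B < f i.
Proof.
move=> hf.
have [B cB h] : exists2 B : R, c < B & forall i, i \in enum I -> B < f i.
  elim: (enum I) => [|i r [B cB h]]; first by exists (c + 1) => //; rewrite ltrDl.
  have ci := hf i.
  exists (Num.min B ((c + f i) / 2)) => [|j]; first by rewrite lt_min cB /=; lra.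
  rewrite inE gt_min => /orP[/eqP->|/h ->//].
  by apply/orP; right; lra.
by exists B => // i; apply: h; rewrite mem_enum.
Qed.

Definition wright_taylor R (p m : nat) (a alpha : 'I_p -> R)
    (b beta : 'I_m -> R) (n : nat) (z : R) : R[i] :=
  \sum_(k < n) ((-1) ^+ k / (k`!)%:R * z ^+ k)%:C * dual_ratio a alpha b beta (- k%:R : R)%:C.

Lemma wright_taylorS R (p m : nat) (a alpha : 'I_p -> R)
    (b beta : 'I_m -> R) (n : nat) (z : R) :
  wright_taylor a alpha b beta n.+1 z = wright_taylor a alpha b beta n z +
  ((-1) ^+ n / (n`!)%:R * z ^+ n)%:C * dual_ratio a alpha b beta (- n%:R : R)%:C.
Proof. by rewrite /wright_taylor big_ord_recr. Qed.

(** The line is moved across one pole at a time, from - n - 1/2 to - n - 3/2. *)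
Lemma wright_line_expansion R (p m : nat) (a alpha : 'I_p -> R)
    (b beta : 'I_m -> R) (gamma z : R) (n : nat) :
  (forall i, 0 < alpha i) -> (forall j, 0 < beta j) -> 0 <= astar alpha beta ->
  (forall j, 0 < b j + beta j) -> 0 < gamma ->
  (forall j, gamma < (b j + beta j) / beta j) -> 0 < z ->
  wright_line a alpha b beta z gamma =
  (2 * pi)%:C * wright_taylor a alpha b beta n.+1 z +
  wright_line a alpha b beta z (- n%:R - 1 / 2).
Proof.
move=> al0 be0 as0 bb0 g0 hg z0.
have [B gB hB] := finite_gap hg.
elim: n => [|n IH].
  rewrite /wright_taylor big_ord1; apply/eqP; rewrite -subr_eq; apply/eqP.
  apply: (@wright_line_shift R p m a alpha b beta z (- 0%:R - 1 / 2) gamma (- (3 / 4)) B 0) => //.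
  - by move=> j; rewrite mulrC -ltr_pdivlMr.
  - by rewrite ltrN2; lra.
  - by rewrite oppr0; lra.
  - by rewrite oppr0; lra.
  - by rewrite oppr0; lra.
rewrite IH (wright_taylorS _ _ _ _ n.+1) [(2 * pi)%:C * (_ + _)]mulrDr -[RHS]addrA.
congr (_ + _).
apply/eqP; rewrite -subr_eq; apply/eqP.
have n1 : n.+1%:R = n%:R + 1 :> R by rewrite -natr1.
apply: (@wright_line_shift _ _ _ _ _ _ _ _ _ _ (- n.+1%:R - 3 / 4) (- n.+1%:R + 3 / 4)) => //.
- move=> j; apply: (@lt_trans _ _ 0) => //; rewrite pmulr_rlt0//.
  by have := ler0n R n; lra.
- by rewrite -[n.+2%:R]natr1; lra.
- lra.
- lra.
- lra.
- lra.
- move=> l; rewrite ltnS -(ler_nat R) => ln; lra.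
Qed.

Lemma wrightPsi_line R (p m : nat) (a alpha : 'I_p -> R)
    (b beta : 'I_m -> R) (gamma z : R) : 0 < z ->
  cintegrable (leb R) setT (fun t => wright_integrand a alpha b beta z (gamma +i* t)) ->
  wrightPsi a alpha b beta gamma (- z) =
  ((2 * pi)%:C)^-1 * wright_line a alpha b beta z gamma.
Proof.
move=> z0 ci; rewrite /wrightPsi oppr_eq0 gt_eqF// opprK /mellin_barnes.
transitivity ((2 * pi%:C * 'i)^-1 * ('i * wright_line a alpha b beta z gamma)).
  congr (_ * _); rewrite /wright_line -cintegralZ//.
  by apply: eq_cintegral => t _; rewrite /wright_integrand mulrC.
have i0 : 'i != 0 :> R[i] by rewrite -normc_eq0P normc_i oner_neq0.
rewrite invfM -mulrA mulKf//; congr (_^-1 * _).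
by rewrite rmorphM /= (rmorph_nat (real_complex R)).
Qed.

(** An asymptotic expansion at 0 to every order, also when the power series of
    Psi diverges. *)
Lemma wrightPsi_expansion R (p m : nat) (a alpha : 'I_p -> R)
    (b beta : 'I_m -> R) (gamma : R) (n : nat) :
  (forall i, 0 < alpha i) -> (forall j, 0 < beta j) -> 0 <= astar alpha beta ->
  (forall j, 0 < b j + beta j) -> 0 < gamma ->
  (forall j, gamma < (b j + beta j) / beta j) ->
  exists2 C : R, 0 <= C & forall z, 0 < z ->
    normc (wrightPsi a alpha b beta gamma (- z) - wright_taylor a alpha b beta n.+1 z)
    <= C * expR ((n%:R + 1 / 2) * ln z).
Proof.
move=> al0 be0 as0 bb0 g0 hg.
have pi0 : (2 * pi : R)%:C != 0 :> R[i].
  by rewrite -normc_eq0P normc_real normr_eq0 gt_eqF// mulr_gt0// pi_gt0.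
have hgj j : beta j * gamma < b j + beta j by rewrite mulrC -ltr_pdivlMr.
have g1 : - 1%:R < gamma by lra.
have g2 : gamma != - 0%:R by rewrite oppr0 gt_eqF.
have g3 l : (l < 0)%N -> gamma < - l%:R by [].
have [C0 _ ci] := @wright_integrand_line R p m a alpha b beta gamma 0 al0 be0 as0 hgj g1 g2 g3.
have n0 := ler0n R n.
have x0 : - n%:R - 1 / 2 < 0 :> R by lra.
have hxj j : beta j * (- n%:R - 1 / 2) < b j + beta j.
  by apply: (@lt_trans _ _ 0) => //; rewrite pmulr_rlt0.
have n1 : - n.+1%:R < - n%:R - 1 / 2 :> R by rewrite -natr1; lra.
have n2 : - n%:R - 1 / 2 != - n%:R :> R by rewrite lt_eqF//; lra.
have n3 l : (l < n)%N -> - n%:R - 1 / 2 < - l%:R :> R.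
  by rewrite -(ltr_nat R) => ln; lra.
have [C Cp hC] := @wright_integrand_line R p m a alpha b beta (- n%:R - 1 / 2) n al0 be0 as0 hxj n1 n2 n3.
exists (normc ((2 * pi : R)%:C)^-1 * C) => [|z z0]; first by rewrite mulr_ge0// normc_ge0.
have [cz _] := ci z z0; have [_ bz] := hC z z0.
rewrite wrightPsi_line// (@wright_line_expansion R p m a alpha b beta gamma z n)//.
set W := (2 * pi)%:C in pi0 *; rewrite [W^-1 * (_ + _)]mulrDr mulKf//.
rewrite [_ + _ * _]addrC addrK Normc.normcM -mulrA; apply: ler_wpM2l; first exact: normc_ge0.
apply: le_trans bz _; apply: le_of_eq; congr (_ * expR _); ring.
Qed.

(** * Moments from the characteristic function *)

Lemma Rintegral_lincomb (d : measure_display) (T : measurableType d) R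
    (mu : {measure set T -> \bar R}) (I : Type) (r : seq I) (c : I -> R) (f : I -> T -> R) :
  (forall i, mu.-integrable setT (EFin \o f i)) ->
  mu.-integrable setT (EFin \o (fun x => \sum_(i <- r) c i * f i x)) /\
  Rintegral mu setT (fun x => \sum_(i <- r) c i * f i x) =
  \sum_(i <- r) c i * Rintegral mu setT (f i).
Proof.
move=> hf; elim: r => [|i r [IH1 IH2]].
  split.
    apply: (eq_integrable measurableT (cst 0%E)); last exact: integrable0.
    by move=> x _; rewrite /= big_nil.
  rewrite big_nil (@eq_Rintegral _ _ _ _ _ (fun=> 0)) ?Rintegral_cst ?mul0r//.
  by move=> x _; rewrite big_nil.
have i1 : mu.-integrable setT (EFin \o (fun x => c i * f i x)).
  by have := integrableZl measurableT (c i) (hf i); apply: eq_integrable.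
split.
  have := integrableD measurableT i1 IH1; apply: eq_integrable => // x _.
  by rewrite /= big_cons EFinD.
rewrite big_cons -IH2 -RintegralZl// -RintegralD//.
by apply: eq_Rintegral => x _; rewrite big_cons.
Qed.

(** A real random variable X whose mean cosine has, for every n, an expansion
    with coefficients e k up to the order 2 n, and whose mean sine is
    O(h^(2n+1)) for every n. *)
Section moments.
Context (d : measure_display) (T : measurableType d) (R : realType).
Context (P : probability T R) (X : T -> R) (mX : measurable_fun setT X).

Let mean (f : T -> R) : R := Rintegral P setT f.
Let has_mean (f : T -> R) := P.-integrable setT (EFin \o f).

Let measurable_powX n : measurable_fun setT (fun x => X x ^+ n).
Proof. exact: measurable_funX. Qed.

Let measurable_cosX h : measurable_fun setT (fun x => cos (h * X x)).
Proof.
apply: measurableT_comp; first by apply: continuous_measurable_fun; exact: continuous_cos.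
exact: measurable_funM.
Qed.

Let measurable_sinX h : measurable_fun setT (fun x => sin (h * X x)).
Proof.
apply: measurableT_comp; first by apply: continuous_measurable_fun; exact: continuous_sin.
exact: measurable_funM.
Qed.

Let integrable_cst1 : has_mean (fun=> 1).
Proof. exact: finite_measure_integrable_cst. Qed.

Let integrable_cosX h : has_mean (fun x => cos (h * X x)).
Proof.
apply: integrable_dominated integrable_cst1 _ => //.
by move=> x _; rewrite ler_norml cos_geN1 cos_le1.
Qed.

Let integrable_sinX h : has_mean (fun x => sin (h * X x)).
Proof.
apply: integrable_dominated integrable_cst1 _ => //.
by move=> x _; rewrite ler_norml sin_geN1 sin_le1.
Qed.

Let mean_cos_rest n h :
  (forall k, (k < n)%N -> has_mean (fun x => X x ^+ (2 * k))) ->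
  has_mean (fun x => cos_rest n (h * X x)) /\
  mean (fun x => cos_rest n (h * X x)) = (-1) ^+ n * (mean (fun x => cos (h * X x)) -
     \sum_(k < n) (-1) ^+ k * h ^+ (2 * k) / ((2 * k)`!)%:R * mean (fun x => X x ^+ (2 * k))).
Proof.
move=> hi.
have [i1 e1] := @Rintegral_lincomb _ _ _ P _ (index_enum 'I_n)
  (fun k : 'I_n => (-1) ^+ k * h ^+ (2 * k) / ((2 * k)`!)%:R) (fun k x => X x ^+ (2 * k))
  (fun k => hi k (ltn_ord k)).
have E x : cos_taylor n (h * X x) = \sum_(k < n) (-1) ^+ k * h ^+ (2 * k) / ((2 * k)`!)%:R * X x ^+ (2 * k).
  by apply: eq_bigr => k _; rewrite exprMn; ring.
have i2 : has_mean (fun x => cos (h * X x) - cos_taylor n (h * X x)).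
  have := integrableB measurableT (integrable_cosX h) i1.
  by apply: eq_integrable => // x _; rewrite /= E.
split.
  by have := integrableZl measurableT ((-1) ^+ n) i2; apply: eq_integrable.
rewrite /mean /cos_rest RintegralZl//; congr (_ * _).
rewrite -e1 -RintegralB//; last exact: integrable_cosX.
by apply: eq_Rintegral => x _; rewrite E.
Qed.

Context (e : nat -> R)
  (he : forall n, exists2 C : R, 0 <= C & forall h : R, 0 < h <= 1 ->
    `|mean (fun x => cos (h * X x)) - \sum_(k < n.+1) e k * h ^+ (2 * k)| <= C * h ^+ (2 * n).+1)
  (hs : forall n, exists2 C : R, 0 <= C & forall h : R, 0 < h <= 1 ->
    `|mean (fun x => sin (h * X x))| <= C * h ^+ (2 * n).+1).

Let even_moment_spec n := has_mean (fun x => X x ^+ (2 * n)) /\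
  mean (fun x => X x ^+ (2 * n)) = (-1) ^+ n * ((2 * n)`!)%:R * e n.

Let fact_neq0R k : (k`!)%:R != 0 :> R.
Proof. by rewrite pnatr_eq0 -lt0n fact_gt0. Qed.

(** Once the moments of order below 2 n are known to be the coefficients of the
    expansion, subtracting them leaves the term e n * h^(2n). *)
Let mean_rest_limit n : (forall k, (k < n)%N -> even_moment_spec k) ->
  (fun j : nat => (j.+1%:R ^+ (2 * n)) * mean (fun x => cos_rest n (j.+1%:R^-1 * X x))) @ \oo -->
  (-1) ^+ n * e n.
Proof.
move=> gk; have [C C0 hC] := he n.
apply: (@cvg_harmonic_bound _ _ _ C) => j.
  have j0 : 0 < j.+1%:R :> R by rewrite ltr0n.
  set h : R := j.+1%:R^-1; have h0 : 0 < h by rewrite invr_gt0.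
  have h1 : 0 < h <= 1 by rewrite h0 invf_le1//= ler1n.
  have [_ ->] := @mean_cos_rest n h (fun k kn => (gk k kn).1).
  have -> : j.+1%:R = h^-1 by rewrite invrK.
  have hn : h ^+ (2 * n) != 0 by rewrite expf_neq0// gt_eqF.
  have -> : \sum_(k < n) (-1) ^+ k * h ^+ (2 * k) / ((2 * k)`!)%:R * mean (fun x => X x ^+ (2 * k))
     = \sum_(k < n) e k * h ^+ (2 * k).
    apply: eq_bigr => k _; rewrite (gk k (ltn_ord k)).2.
    have s1 : (-1) ^+ k * (-1) ^+ k = 1 :> R by rewrite -expr2 sqrr_sign.
    move: (fact_neq0R (2 * k)) s1; move: ((-1) ^+ k : R) (((2 * k)`!)%:R : R) => s f f0 s1.
    transitivity (s * s * (e k * h ^+ (2 * k))); last by rewrite s1 mul1r.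
    by field.
  have := hC h h1; rewrite big_ord_recr /= => q.
  rewrite exprVn mulrCA -mulrBr normrM normrX normrN1 expr1n mul1r.
  rewrite (_ : _ - _ = (h ^+ (2 * n))^-1 * (mean (fun x => cos (h * X x)) -
     (\sum_(k < n) e k * h ^+ (2 * k) + e n * h ^+ (2 * n)))); last by field.
  rewrite normrM ger0_norm ?invr_ge0 ?exprn_ge0 ?(ltW h0)//.
  rewrite ler_pdivrMl ?exprn_gt0//; apply: le_trans q _.
  by apply: le_of_eq; rewrite exprS; ring.
Qed.

(** The remainder divided by h^(2n), with h = 1 / (j + 1). *)
Let scaled_rest n (j : nat) (x : T) : R :=
  j.+1%:R ^+ (2 * n) * cos_rest n (j.+1%:R^-1 * X x).

Let scaled_rest_cvg n x : (fun j => scaled_rest n j x) @ \oo -->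
  X x ^+ (2 * n) / ((2 * n)`!)%:R.
Proof.
apply: (@cvg_harmonic_bound _ _ _ (X x ^+ (2 * n.+1) / ((2 * n.+1)`!)%:R)) => j.
  set h : R := j.+1%:R^-1.
  have j0 : 0 < j.+1%:R :> R by rewrite ltr0n.
  have h0 : 0 < h by rewrite invr_gt0.
  have h1 : h <= 1 by rewrite invf_le1// ler1n.
  have jE : j.+1%:R = h^-1 :> R by rewrite invrK.
  have E : scaled_rest n j x - X x ^+ (2 * n) / ((2 * n)`!)%:R =
      - (j.+1%:R ^+ (2 * n) * cos_rest n.+1 (h * X x)).
    have := cos_restS n (h * X x); rewrite /scaled_rest -/h exprMn => q.
    have hn : h ^+ (2 * n) != 0 by rewrite expf_neq0// gt_eqF.
    have -> : cos_rest n (h * X x) = h ^+ (2 * n) * X x ^+ (2 * n) / ((2 * n)`!)%:R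
       - cos_rest n.+1 (h * X x) by rewrite -q; ring.
    rewrite jE exprVn mulrBr; rewrite !mulrA mulVf// mul1r; ring.
  rewrite E normrN ger0_norm; last first.
    by rewrite mulr_ge0 ?exprn_ge0 ?cos_rest_ge0.
  have := cos_rest_le n.+1 (h * X x); rewrite exprMn.
  move/(ler_wpM2l (exprn_ge0 (2 * n) (ltW j0))) => q; apply: le_trans q _.
  rewrite jE (_ : (2 * n.+1)%N = (2 * n + 2)%N); last by rewrite mulnS addnC.
  have X2 : 0 <= X x ^+ (2 * n + 2) / ((2 * n + 2)`!)%:R.
    by rewrite divr_ge0// -[(2 * n + 2)%N]/(2 * n + 2 * 1)%N -mulnDr exprM exprn_ge0 ?sqr_ge0.
  rewrite [h ^+ _]exprD exprVn.
  rewrite (_ : _ * (_ / _) = h ^+ 2 * (X x ^+ (2 * n + 2) / ((2 * n + 2)`!)%:R)); last first.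
    rewrite -!mulrA; rewrite mulKf// expf_neq0// gt_eqF//.
  rewrite mulrC; apply: ler_wpM2l => //.
  by rewrite expr2 ler_piMr// ltW.
Qed.

Let measurable_scaled_rest n j : measurable_fun setT (scaled_rest n j).
Proof.
apply: measurable_funM => //.
have mc : measurable_fun setT (@cos_rest R n).
  apply: continuous_measurable_fun => u; case: n => [|n].
    rewrite (_ : @cos_rest R 0 = @cos R); first exact: continuous_cos.
    by apply/funext => v; rewrite /cos_rest /cos_taylor big_ord0 subr0 mul1r.
  exact: is_derive_continuous (is_derive_cos_rest n u).
by apply: (measurableT_comp mc); exact: measurable_funM.
Qed.

Let integrable_scaled_rest n : (forall k, (k < n)%N -> even_moment_spec k) ->
  forall j, has_mean (scaled_rest n j) /\
  mean (scaled_rest n j) = j.+1%:R ^+ (2 * n) * mean (fun x => cos_rest n (j.+1%:R^-1 * X x)).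
Proof.
move=> gk j; have [i1 _] := @mean_cos_rest n j.+1%:R^-1 (fun k kn => (gk k kn).1).
split; last by rewrite /mean /scaled_rest RintegralZl.
by have := integrableZl measurableT (j.+1%:R ^+ (2 * n)) i1; apply: eq_integrable.
Qed.

(** Fatou's lemma applies because the remainders are nonnegative.  The case n = 0
    is separate since cos_rest 0 is the cosine itself. *)
Let pow_integrable n : (forall k, (k < n)%N -> even_moment_spec k) -> has_mean (fun x => X x ^+ (2 * n)).
Proof.
case: n => [|n] gk; first by rewrite muln0; apply: eq_integrable integrable_cst1.
have hE j := @integrable_scaled_rest n.+1 gk j.
pose Y x : R := X x ^+ (2 * n.+1) / ((2 * n.+1)`!)%:R.
have Y0 x : 0 <= Y x by rewrite divr_ge0// exprM exprn_ge0// sqr_ge0.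
have mY : measurable_fun setT Y by apply: measurable_funM.
have iY : has_mean Y.
  apply/integrableP; split; first exact/measurable_EFinP.
  rewrite (eq_integral (fun x => (Y x)%:E)); last first.
    by move=> x _; rewrite /= ger0_norm.
  have Z0 (j : nat) (x : T) : setT x -> (0%:E <= (scaled_rest n.+1 j x)%:E)%E.
    by move=> _; rewrite lee_fin mulr_ge0 ?exprn_ge0 ?cos_rest_ge0.
  have mZ (j : nat) : measurable_fun setT (fun x => (scaled_rest n.+1 j x)%:E).
    by apply/measurable_EFinP; exact: measurable_scaled_rest.
  have F := fatou P measurableT mZ Z0.
  rewrite (eq_integral (fun x => limn_einf (fun j => (scaled_rest n.+1 j x)%:E))); last first.
    move=> x _; have cv : (fun j => (scaled_rest n.+1 j x)%:E) @ \oo --> (Y x)%:E.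
      by apply: cvg_EFin; [exact: nearW|exact: scaled_rest_cvg].
    by rewrite (cvg_limn_einf_sup cv).1.
  apply: le_lt_trans F _.
  have cv : (fun j => (\int[P]_x (scaled_rest n.+1 j x)%:E)%E) @ \oo --> ((-1) ^+ n.+1 * e n.+1)%:E.
    have L := mean_rest_limit gk.
    apply: (@cvg_trans _ ((fun j => (mean (scaled_rest n.+1 j))%:E) @ \oo)).
      apply: near_eq_cvg; apply: nearW => j; rewrite /mean /Rintegral fineK//.
      by apply: integrable_fin_num => //; case: (hE j).
    apply: cvg_EFin; first exact: nearW.
    apply: cvg_trans L; apply: near_eq_cvg; apply: nearW => j.
    by case: (hE j).
  by rewrite (cvg_limn_einf_sup cv).1 ltry.
have := integrableZl measurableT (((2 * n.+1)`!)%:R : R) iY.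
apply: eq_integrable => // x _.
by rewrite /= -EFinM /Y mulrC divfK.
Qed.

(** Now that X^(2n) is known to be integrable, it dominates the scaled
    remainders by [cos_rest_le]. *)
Let even_moment n : even_moment_spec n.
Proof.
elim/ltn_ind: n => n gk; have iX := pow_integrable gk; split => //.
have hE j := @integrable_scaled_rest n gk j.
pose Y x : R := X x ^+ (2 * n) / ((2 * n)`!)%:R.
have iY : has_mean Y.
  have := integrableZl measurableT ((((2 * n)`!)%:R : R)^-1) iX.
  by apply: eq_integrable => // x _; rewrite /= -EFinM /Y mulrC.
have Yn0 x : 0 <= Y x by rewrite divr_ge0// exprM exprn_ge0// sqr_ge0.
have D : (fun j => (\int[P]_x (scaled_rest n j x)%:E)%E) @ \oo --> (\int[P]_x (Y x)%:E)%E.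
  apply: (@dominated_cvg _ _ _ _ _ measurableT (fun j x => (scaled_rest n j x)%:E) _
     (fun x => (Y x + 1)%:E)).
  - by move=> j; apply/measurable_EFinP; exact: measurable_scaled_rest.
  - by move=> x _; apply: cvg_EFin; [exact: nearW|exact: scaled_rest_cvg].
  - by [].
  - have := integrableD measurableT iY integrable_cst1.
    by apply: eq_integrable.
  - move=> j x _; rewrite /= lee_fin /scaled_rest.
    have j0 : 0 < j.+1%:R :> R by rewrite ltr0n.
    case: n gk iX hE @Y iY Yn0 => [|n] gk iX hE Y iY Yn0.
      rewrite muln0 expr0 mul1r /cos_rest /cos_taylor big_ord0 subr0 expr0 mul1r.
      by apply: (@le_trans _ _ 1); [rewrite ler_norml cos_geN1 cos_le1|rewrite lerDr].
    rewrite ger0_norm; last by rewrite mulr_ge0 ?exprn_ge0 ?cos_rest_ge0.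
    apply: (@le_trans _ _ (Y x)); last by rewrite lerDl.
    have := cos_rest_le n.+1 (j.+1%:R^-1 * X x); rewrite exprMn.
    move/(ler_wpM2l (exprn_ge0 (2 * n.+1) (ltW j0))); move/le_trans; apply.
    by rewrite exprVn -mulrA mulVKf// expf_neq0// gt_eqF.
have L := mean_rest_limit gk.
have L2 : (fun j => (\int[P]_x (scaled_rest n j x)%:E)%E) @ \oo --> ((-1) ^+ n * e n)%:E.
  apply: (@cvg_trans _ ((fun j => (mean (scaled_rest n j))%:E) @ \oo)).
    apply: near_eq_cvg; apply: nearW => j; rewrite /mean /Rintegral fineK//.
    by apply: integrable_fin_num => //; case: (hE j).
  apply: cvg_EFin; first exact: nearW.
  apply: cvg_trans L; apply: near_eq_cvg; apply: nearW => j.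
  by case: (hE j).
have Q : (\int[P]_x (Y x)%:E)%E = ((-1) ^+ n * e n)%:E.
  exact: (cvg_unique _ D L2).
have EY : mean Y = (-1) ^+ n * e n by rewrite /mean /Rintegral Q.
rewrite mulrAC -EY /mean -RintegralZr//.
by apply: eq_Rintegral => x _; rewrite /Y divfK.
Qed.

Lemma even_moments_of_charfun n :
  Rintegral P setT (fun x => X x ^+ (2 * n)) = (-1) ^+ n * ((2 * n)`!)%:R * e n.
Proof. exact: (even_moment n).2. Qed.

Let norm_pow_integrable n : has_mean (fun x => `|X x| ^+ n).
Proof.
apply: (@integrable_dominated _ _ _ P setT _ (fun x => 1 + X x ^+ (2 * n))) => //.
- apply: measurable_funX; exact: measurableT_comp.
- have := integrableD measurableT integrable_cst1 (even_moment n).1.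
  exact: eq_integrable.
move=> x _; rewrite mulnC exprM expr2 ger0_norm ?exprn_ge0//.
have -> : X x ^+ n * X x ^+ n = `|X x| ^+ n * `|X x| ^+ n.
  by rewrite -!expr2 -normrX real_normK// num_real.
set y := _ ^+ n; have y0 : 0 <= y by rewrite exprn_ge0.
have := sqr_ge0 (y - 1); nra.
Qed.

Lemma powers_integrable n : P.-integrable setT (EFin \o (fun x => X x ^+ n)).
Proof.
apply: (@integrable_dominated _ _ _ P setT _ (fun x => `|X x| ^+ n)) => // [|x _].
  exact: norm_pow_integrable.
by rewrite normrX.
Qed.

Let mean_sin_rest n h :
  (forall k, (k < n)%N -> mean (fun x => X x ^+ (2 * k).+1) = 0) ->
  has_mean (fun x => sin_rest n (h * X x)) /\
  mean (fun x => sin_rest n (h * X x)) = (-1) ^+ n * mean (fun x => sin (h * X x)).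
Proof.
move=> h0.
have [i1 e1] := @Rintegral_lincomb _ _ _ P _ (index_enum 'I_n)
  (fun k : 'I_n => (-1) ^+ k * h ^+ (2 * k).+1 / ((2 * k).+1`!)%:R) (fun k x => X x ^+ (2 * k).+1)
  (fun k => powers_integrable (2 * k).+1).
have E x : sin_taylor n (h * X x) =
    \sum_(k < n) (-1) ^+ k * h ^+ (2 * k).+1 / ((2 * k).+1`!)%:R * X x ^+ (2 * k).+1.
  by apply: eq_bigr => k _; rewrite exprMn; ring.
have i2 : has_mean (fun x => sin (h * X x) - sin_taylor n (h * X x)).
  have := integrableB measurableT (integrable_sinX h) i1.
  by apply: eq_integrable => // x _; rewrite /= E.
split.
  by have := integrableZl measurableT ((-1) ^+ n) i2; apply: eq_integrable.
rewrite /mean /sin_rest RintegralZl//; congr (_ * _).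
rewrite (@eq_Rintegral _ _ _ _ _ (fun x => sin (h * X x) -
   \sum_(k < n) (-1) ^+ k * h ^+ (2 * k).+1 / ((2 * k).+1`!)%:R * X x ^+ (2 * k).+1)); last first.
  by move=> x _; rewrite E.
rewrite RintegralB//; last exact: integrable_sinX.
rewrite e1 big1 ?subr0// => k _.
by have := h0 k (ltn_ord k); rewrite /mean => ->; rewrite mulr0.
Qed.

(** By induction on n, h^(2n+1) E X^(2n+1) is the sum of a multiple of
    E sin(h X) and of the mean of a remainder of order 2n+3, so that
    E X^(2n+1) = O(h^2). *)
Lemma odd_moments_of_charfun n : Rintegral P setT (fun x => X x ^+ (2 * n).+1) = 0.
Proof.
elim/ltn_ind: n => n IH.
have [C C0 hC] := hs n.+1.
pose q : R := Rintegral P setT (fun x => X x ^+ (2 * n).+1).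
pose A : R := Rintegral P setT (fun x => `|X x| ^+ (2 * n.+1).+1 / ((2 * n.+1).+1`!)%:R).
have bound (h : R) : 0 < h <= 1 -> `|h ^+ (2 * n).+1 / ((2 * n).+1`!)%:R * q|
    <= (C + A) * h ^+ (2 * n.+1).+1.
  move=> h01; have /andP[h0 _] := h01.
  have [i1 e1] := @mean_sin_rest n h IH.
  have i3 : has_mean (fun x => (h * X x) ^+ (2 * n).+1 / ((2 * n).+1`!)%:R).
    have := integrableZl measurableT (h ^+ (2 * n).+1 / ((2 * n).+1`!)%:R) (powers_integrable (2 * n).+1).
    by apply: eq_integrable => // x _; rewrite /= exprMn -EFinM; congr EFin; ring.
  have i2 : has_mean (fun x => sin_rest n.+1 (h * X x)).
    have := integrableB measurableT i3 i1.
    by apply: eq_integrable => // x _; rewrite /= -EFinB -sin_restS addrAC subrr add0r.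
  have iA : has_mean (fun x => `|X x| ^+ (2 * n.+1).+1 / ((2 * n.+1).+1`!)%:R).
    have := integrableZl measurableT (((2 * n.+1).+1`!)%:R^-1 : R) (norm_pow_integrable (2 * n.+1).+1).
    by apply: eq_integrable => // x _; rewrite /= -EFinM mulrC.
  have -> : h ^+ (2 * n).+1 / ((2 * n).+1`!)%:R * q =
      mean (fun x => sin_rest n (h * X x)) + mean (fun x => sin_rest n.+1 (h * X x)).
    rewrite /mean -RintegralD// /q -RintegralZl//; last exact: powers_integrable.
    by apply: eq_Rintegral => x _; rewrite sin_restS exprMn; ring.
  apply: le_trans (ler_normD _ _) _; rewrite mulrDl; apply: lerD.
    by rewrite e1 normrM normrX normrN1 expr1n mul1r; exact: hC.
  have iA' : has_mean (fun x => h ^+ (2 * n.+1).+1 * (`|X x| ^+ (2 * n.+1).+1 / ((2 * n.+1).+1`!)%:R)).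
    by have := integrableZl measurableT (h ^+ (2 * n.+1).+1) iA; apply: eq_integrable.
  rewrite /A mulrC -RintegralZl//.
  apply: normr_Rintegral_le => // x _.
  apply: le_trans (sin_rest_norm _ _) _.
  by apply: le_of_eq; rewrite normrM exprMn (gtr0_norm h0) -mulrA.
have F0 : 0 < ((2 * n).+1`!)%:R :> R by rewrite ltr0n fact_gt0.
have : (fun _ : nat => q) @ \oo --> (0 : R).
  apply: (@cvg0_harmonic_bound _ _ (((2 * n).+1`!)%:R * (C + A))) => j.
  set h : R := j.+1%:R^-1.
  have j0 : 0 < j.+1%:R :> R by rewrite ltr0n.
  have h0 : 0 < h by rewrite invr_gt0.
  have h1 : h <= 1 by rewrite invf_le1// ler1n.
  have A0 : 0 <= A.
    by apply: Rintegral_ge0 => x _; rewrite divr_ge0// exprn_ge0.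
  have := bound h; rewrite h0 h1 => /(_ isT).
  rewrite normrM (ger0_norm (divr_ge0 _ _)) ?exprn_ge0 ?(ltW h0)//.
  rewrite (_ : (2 * n.+1).+1 = ((2 * n).+1 + 2)%N); last by rewrite mulnS addnC.
  rewrite exprD mulrCA -[_ / _ * `|q|]mulrA ler_pM2l ?exprn_gt0//.
  rewrite ler_pdivrMl// => /le_trans; apply.
  rewrite -mulrA; apply: ler_wpM2l; first exact: ltW.
  apply: ler_wpM2l; first exact: addr_ge0.
  by rewrite expr2 ler_piMr// ltW.
move=> L; apply: (cvg_unique _ _ L) => //; exact: cvg_cst.
Qed.

End moments.

(** * Polarization *)

(** Multinomial theorem in exponential form, by comparing the coefficients of
    degree M in the product of the truncated exponentials of u_i X: up to
    degree M they multiply like exponentials. *)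
Lemma multinomial_expn R (I : finType) (M : nat) (u : I -> R) :
  (\sum_i u i) ^+ M / (M`!)%:R =
  \sum_(f : {ffun I -> 'I_M.+1} | (\sum_i f i)%N == M) \prod_i (u i ^+ f i / ((f i)`!)%:R).
Proof.
(* K p v: up to degree M, p has the coefficients of the series exp(v X). *)
pose K (p : {poly R}) (v : R) := forall j, (j <= M)%N -> p`_j = v ^+ j / (j`!)%:R.
have K0 : K 1 0.
  move=> j _; rewrite coef1; case: j => [|j]; first by rewrite fact0 expr0 divr1.
  by rewrite expr0n mul0r.
have KD p v q w : K p v -> K q w -> K (p * q) (v + w).
  move=> hp hq j jM; rewrite coefM [v + w]addrC exprDn mulr_suml; apply: eq_bigr => i _.
  have ij : (i <= j)%N by rewrite -ltnS.
  rewrite hp ?(leq_trans ij)// hq ?(leq_trans (leq_subr _ _))//.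
  have E : ('C(j, i))%:R * (i`!)%:R * ((j - i)`!)%:R = (j`!)%:R :> R.
    by rewrite -!natrM -mulnA bin_fact.
  have f0 l : (l`!)%:R != 0 :> R by rewrite pnatr_eq0 -lt0n fact_gt0.
  have b0 : ('C(j, i))%:R != 0 :> R by rewrite pnatr_eq0 -lt0n bin_gt0.
  rewrite -[_ *+ 'C(_, _)]mulr_natr -E.
  by field; rewrite b0 !f0.
have Kp : K (\prod_i \poly_(k < M.+1) (u i ^+ k / (k`!)%:R)) (\sum_i u i).
  apply: (big_ind2 K) => // i _ j jM; by rewrite coef_poly ltnS jM.
rewrite -Kp//.
rewrite (eq_bigr (fun i => \sum_(k < M.+1) (u i ^+ k / (k`!)%:R) *: 'X^k)); last first.
  by move=> i _; rewrite poly_def.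
rewrite bigA_distr_bigA /= coef_sum [RHS]big_mkcond /=; apply: eq_bigr => f _.
rewrite scaler_prod prodrXr coefZ coefXn eq_sym.
by case: eqP => _; rewrite ?mulr1 ?mulr0.
Qed.

(** Numbers w k l for which the sum over l of w k l * q(l) is the coefficient of
    degree k of q, for every polynomial q of degree at most M; they are the
    entries of an inverse Vandermonde matrix. *)
Lemma vandermonde_weights R (M : nat) :
  exists w : nat -> 'I_M.+1 -> R, forall j k, (j <= M)%N -> (k <= M)%N ->
    \sum_(l < M.+1) w k l * l%:R ^+ j = (j == k)%:R.
Proof.
pose a : 'rV[R]_M.+1 := \row_l l%:R.
pose V := Vandermonde M.+1 a.
have Vu : V \in unitmx.
  rewrite unitmxE det_Vandermonde unitfE; apply/prodf_neq0 => i _.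
  apply/prodf_neq0 => j ij; rewrite !mxE subr_eq0 eqr_nat.
  by rewrite gt_eqF//; move: ij; rewrite ltEnat.
exists (fun k l => (invmx V) l (inord k)) => j k jM kM.
have := congr1 (fun A : 'M[R]_(M.+1) => A (inord j) (inord k)) (mulmxV Vu).
rewrite !mxE => E; transitivity ((inord j == inord k :> 'I_M.+1)%:R : R); last first.
  by rewrite -val_eqE /= !inordK.
rewrite -E; apply: eq_bigr => l _.
by rewrite !mxE inordK// mulrC.
Qed.

(** Products of one-variable weights extract coefficients of polynomials in d
    variables. *)
Lemma polarization_weights R (d M : nat) (n : 'I_d -> nat) :
  (forall i, (n i <= M)%N) ->
  exists w : {ffun 'I_d -> 'I_M.+1} -> R, forall k : 'I_d -> nat,
    (forall i, (k i <= M)%N) ->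
    \sum_y w y * \prod_i (y i)%:R ^+ k i = [forall i, k i == n i]%:R.
Proof.
move=> nM; have [w hw] := @vandermonde_weights R M.
exists (fun y => \prod_i w (n i) (y i)) => k kM.
under eq_bigr do rewrite -big_split /=.
rewrite -(@bigA_distr_bigA _ _ _ _ _ _ _ (fun i (l : 'I_M.+1) => w (n i) l * l%:R ^+ k i)) /=.
under eq_bigr => i _ do rewrite hw//.
have [/forallP h|] := boolP [forall i, k i == n i].
  by rewrite big1// => i _; rewrite h.
rewrite negb_forall => /existsP[i /negbTE h].
by rewrite (bigD1 i)//= h mul0r.
Qed.

(** The weights extract the coefficient of y^n.  In the multinomial
    expansion of (y, x)^M it is a multiple of the monomial x^n; in that of
    (y, y)^N it vanishes unless all exponents n i are even. *)
Lemma monomial_polarization R (d : nat) (n : 'I_d -> nat) :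
  let M := (\sum_i n i)%N in
  exists w : {ffun 'I_d -> 'I_M.+1} -> R,
  [/\ forall x : d.-tuple R, monomial n x = (\prod_i ((n i)`!)%:R) *
        \sum_y w y * (inner [tuple (y i)%:R | i < d] x ^+ M / (M`!)%:R),
      forall N, M = (2 * N)%N -> (exists i, odd (n i)) ->
        \sum_y w y * inner [tuple (y i)%:R | i < d] [tuple (y i)%:R | i < d] ^+ N = 0 &
      forall m : 'I_d -> nat, (forall i, n i = (2 * m i)%N) ->
        let N := (\sum_i m i)%N in
        \sum_y w y * inner [tuple (y i)%:R | i < d] [tuple (y i)%:R | i < d] ^+ N =
        (N`!)%:R / \prod_i ((m i)`!)%:R].
Proof.
move=> M; have f0 l : (l`!)%:R != 0 :> R by rewrite pnatr_eq0 -lt0n fact_gt0.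
have nM i : (n i <= M)%N by rewrite /M (bigD1 i)//= leq_addr.
have [w hw] := @polarization_weights R d M n nM.
have sq N : (2 * N <= M)%N ->
   \sum_y w y * inner [tuple (y i)%:R | i < d] [tuple (y i)%:R | i < d] ^+ N =
   (N`!)%:R * \sum_(f : {ffun 'I_d -> 'I_N.+1} | (\sum_i f i)%N == N)
      (\prod_i ((f i)`!)%:R^-1) * [forall i, (2 * f i)%N == n i]%:R.
  move=> NM.
  pose c (f : {ffun 'I_d -> 'I_N.+1}) : R := \prod_i ((f i)`!)%:R^-1.
  transitivity (\sum_y \sum_(f : {ffun 'I_d -> 'I_N.+1} | (\sum_i f i)%N == N)
     (N`!)%:R * (c f * (w y * \prod_i (y i)%:R ^+ (2 * f i)))).
    apply: eq_bigr => y _.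
    have -> : inner [tuple (y i)%:R | i < d] [tuple (y i)%:R | i < d] = \sum_i ((y i)%:R ^+ 2 : R).
      by apply: eq_bigr => i _; rewrite !tnth_mktuple.
    rewrite -[_ ^+ N](divfK (f0 N)) multinomial_expn mulr_suml mulr_sumr.
    apply: eq_bigr => f _; rewrite big_split /= -/(c f).
    under eq_bigr do rewrite -exprM.
    by move: (c f) (\prod_i _) => u v; ring.
  rewrite exchange_big /= mulr_sumr; apply: eq_bigr => f _.
  rewrite -mulr_sumr -mulr_sumr hw// => i.
  by apply: leq_trans NM; rewrite leq_mul2l /= -ltnS.
exists w; split.
- move=> x; pose c (k : {ffun 'I_d -> 'I_M.+1}) : R := \prod_i (tnth x i ^+ k i / ((k i)`!)%:R).
  have -> : \sum_y w y * (inner [tuple (y i)%:R | i < d] x ^+ M / (M`!)%:R) =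
    \sum_(k : {ffun 'I_d -> 'I_M.+1} | (\sum_i k i)%N == M) c k * [forall i, k i == n i :> nat]%:R.
    transitivity (\sum_y \sum_(k : {ffun 'I_d -> 'I_M.+1} | (\sum_i k i)%N == M)
      c k * (w y * \prod_i (y i)%:R ^+ k i)).
      apply: eq_bigr => y _; rewrite /inner multinomial_expn mulr_sumr.
      apply: eq_bigr => k _; rewrite mulrCA; congr (_ * _).
      rewrite /c -big_split /=; apply: eq_bigr => i _.
      by rewrite tnth_mktuple exprMn; ring.
    rewrite exchange_big /=; apply: eq_bigr => k _.
    by rewrite -mulr_sumr hw// => i; rewrite -ltnS.
  (* The only multi-index that survives. *)
  pose k0 : {ffun 'I_d -> 'I_M.+1} := [ffun i => inord (n i)].
  have k0E i : k0 i = n i :> nat by rewrite ffunE inordK ?ltnS.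
  have k0s : (\sum_i k0 i)%N == M by apply/eqP; apply: eq_bigr => i _.
  rewrite (bigD1 k0)//= [X in _ + X]big1 ?addr0; last first.
    move=> k /andP[_ kk]; case: forallP => [h|_]; last by rewrite mulr0.
    case/eqP: kk; apply/ffunP => i; apply/val_inj; rewrite /= k0E; exact/eqP/h.
  have -> : [forall i, k0 i == n i :> nat] by apply/forallP => i; rewrite k0E.
  rewrite mulr1 /c -big_split /=; apply: eq_bigr => i _.
  by rewrite k0E mulrC divfK.
- move=> N MN [i oi]; rewrite sq ?MN// big1 ?mulr0// => f _.
  case: forallP => [/(_ i)/eqP h|_]; last by rewrite mulr0.
  by move: oi; rewrite -h oddM.
- move=> m nm N.
  have MN : M = (2 * N)%N by rewrite /M big_distrr /=; apply: eq_bigr => i _; rewrite nm.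
  rewrite sq ?MN//; congr (_ * _).
  have mN i : (m i <= N)%N by rewrite /N (bigD1 i)//= leq_addr.
  pose f1 : {ffun 'I_d -> 'I_N.+1} := [ffun i => inord (m i)].
  have f1E i : f1 i = m i :> nat by rewrite ffunE inordK ?ltnS.
  have f1s : (\sum_i f1 i)%N == N by apply/eqP; apply: eq_bigr => i _.
  rewrite (bigD1 f1)//= [X in _ + X]big1 ?addr0; last first.
    move=> f /andP[_ ff]; case: forallP => [h|_]; last by rewrite mulr0.
    case/eqP: ff; apply/ffunP => i; apply/val_inj; rewrite /= f1E; apply/eqP.
    by have := h i; rewrite nm eqn_mul2l.
  have -> : [forall i, (2 * f1 i)%N == n i] by apply/forallP => i; rewrite f1E nm.
  by rewrite mulr1 prodfV; congr (_^-1); apply: eq_bigr => i _; rewrite f1E.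
Qed.

(** A measure whose projections (y, x) have moments depending only on (y, y) has
    the mixed moments of a rotation invariant one. *)
Lemma moments_of_projections R (d : nat) (P : probability (d.-tuple R) R)
    (g : nat -> R) :
  (forall y n, P.-integrable setT (EFin \o (fun x => inner y x ^+ n))) ->
  (forall y n, Rintegral P setT (fun x => inner y x ^+ (2 * n)) = g n * inner y y ^+ n) ->
  (forall y n, Rintegral P setT (fun x => inner y x ^+ (2 * n).+1) = 0) ->
  [/\ forall n : 'I_d -> nat, P.-integrable setT (EFin \o monomial n),
      forall n : 'I_d -> nat, (exists i, odd (n i)) -> moment P n = 0 &
      forall n : 'I_d -> nat, let N := (\sum_i n i)%N in
        moment P (fun i => (2 * n i)%N) = g N * ((N`!)%:R / ((2 * N)`!)%:R) *
          ((\prod_i ((2 * n i)`!)%:R) / \prod_i ((n i)`!)%:R)].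
Proof.
move=> hi he ho.
have he' y M N : M = (2 * N)%N -> Rintegral P setT (fun x => inner y x ^+ M) = g N * inner y y ^+ N.
  by move=> ->.
have ho' y M N : M = (2 * N).+1 -> Rintegral P setT (fun x => inner y x ^+ M) = 0.
  by move=> ->.
pose yv M (y : {ffun 'I_d -> 'I_M.+1}) : d.-tuple R := [tuple (y i)%:R | i < d].
have key n : let M := (\sum_i n i)%N in forall w : {ffun 'I_d -> 'I_M.+1} -> R,
    (forall x : d.-tuple R, monomial n x = (\prod_i ((n i)`!)%:R) *
        \sum_y w y * (inner (yv _ y) x ^+ M / (M`!)%:R)) ->
    P.-integrable setT (EFin \o monomial n) /\
    moment P n = (\prod_i ((n i)`!)%:R) / (M`!)%:R *
        \sum_y w y * Rintegral P setT (fun x => inner (yv _ y) x ^+ M).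
  move=> M w hw.
  have [i1 e1] := @Rintegral_lincomb _ _ _ P _ (index_enum {ffun 'I_d -> 'I_M.+1}) w
     (fun y x => inner (yv _ y) x ^+ M) (fun y => hi _ _).
  have E x : monomial n x = (\prod_i ((n i)`!)%:R) / (M`!)%:R *
      \sum_y w y * inner (yv _ y) x ^+ M.
    rewrite hw -mulrA [_^-1 * _]mulrC mulr_suml; congr (_ * _).
    by apply: eq_bigr => y _; rewrite mulrA.
  split.
    have := integrableZl measurableT ((\prod_i ((n i)`!)%:R) / (M`!)%:R) i1.
    by apply: eq_integrable => // x _; rewrite /= E.
  by rewrite -e1 -RintegralZl//; apply: eq_Rintegral => x _; exact: E.
split=> [n|n on|n N].
- by have [w [hw _ _]] := @monomial_polarization R d n; case: (key _ _ hw).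
- have [w [hw h0 _]] := @monomial_polarization R d n; have [_ ->] := key _ _ hw.
  set M := (\sum_i n i)%N in w hw h0 *.
  have [oM|eM] := boolP (odd M).
    rewrite [X in _ * X]big1 ?mulr0// => y _.
    have ME : M = (2 * M./2).+1 by rewrite mul2n -[LHS]odd_double_half oM.
    by rewrite (ho' _ _ _ ME) mulr0.
  have ME : M = (2 * M./2)%N by rewrite mul2n even_halfK.
  rewrite (eq_bigr (fun y => g M./2 * (w y * inner (yv _ y) (yv _ y) ^+ M./2))); last first.
    by move=> y _; rewrite (he' _ _ _ ME) mulrCA.
  by rewrite -mulr_sumr (h0 _ ME on) !mulr0.
- have [w [hw _ h1]] := @monomial_polarization R d (fun i => (2 * n i)%N).
  have [_ ->] := key _ _ hw.
  have ME : (\sum_i 2 * n i)%N = (2 * N)%N by rewrite /N big_distrr.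
  rewrite (eq_bigr (fun y => g N * (w y * inner (yv _ y) (yv _ y) ^+ N))); last first.
    by move=> y _; rewrite (he' _ _ _ ME) mulrCA.
  rewrite -mulr_sumr (h1 n (fun=> erefl)) -/N.
  rewrite (_ : ((\sum_i 2 * n i)%N)`! = (2 * N)`!); last by rewrite ME.
  by move: (\prod_i _)  (\prod_i _) => u v; ring.
Qed.

(** * The generalized Wright measure *)

(** The coefficient c_k of the Wright series, as a real number. *)
Definition wright_ratio R (p m : nat) (a alpha : 'I_p -> R)
    (b beta : 'I_m -> R) (k : nat) : R :=
  (\prod_(j < m) rgamma (b j + beta j * (k%:R + 1))) /
  \prod_(i < p) rgamma (a i + alpha i * (k%:R + 1)).

Lemma Gamma_real R (x : R) : 0 < x -> Gamma x%:C = (rgamma x)%:C.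
Proof. by move=> x0; rewrite Gamma_euler// euler_gamma_real. Qed.

Lemma wright_arg_gt0 R (a alpha : R) (k : nat) :
  0 < alpha -> 0 < a + alpha -> 0 < a + alpha * (k%:R + 1).
Proof.
move=> al0 aal0; rewrite mulrDr mulr1 addrCA ltr_wpDl//.
by rewrite mulr_ge0// ltW.
Qed.

Lemma charfun_ReIm R (d : nat) (P : probability (d.-tuple R) R) (y : d.-tuple R) :
  Re (charfun P y) = Rintegral P setT (fun x => cos (inner y x)) /\
  Im (charfun P y) = Rintegral P setT (fun x => sin (inner y x)).
Proof.
have E (u : R) : cexp ('i * u%:C) = cos u +i* sin u.
  rewrite /cexp (_ : 'i * u%:C = 0 +i* u); last by apply: complexP; rewrite !cE /=; ring.
  by rewrite /= expR0 mul1r.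
by split; apply: eq_Rintegral => x _; rewrite E.
Qed.

Definition scale_tuple R (d : nat) (h : R) (y : d.-tuple R) : d.-tuple R :=
  [tuple h * tnth y i | i < d].

Lemma inner_scalel R (d : nat) (h : R) (y x : d.-tuple R) :
  inner (scale_tuple h y) x = h * inner y x.
Proof.
by rewrite /inner mulr_sumr; apply: eq_bigr => i _; rewrite tnth_mktuple mulrA.
Qed.

Lemma inner_scaler R (d : nat) (h : R) (y x : d.-tuple R) :
  inner x (scale_tuple h y) = h * inner x y.
Proof.
by rewrite /inner mulr_sumr; apply: eq_bigr => i _; rewrite tnth_mktuple mulrCA.
Qed.

Lemma measurable_inner R (d : nat) (y : d.-tuple R) :
  measurable_fun setT (inner y).
Proof.
rewrite /inner; apply: measurable_sum => i; apply: measurable_funM => //.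
exact: measurable_tnth.
Qed.

Section wright_measure.
Context (R : realType) (p m : nat) (a alpha : 'I_p -> R) (b beta : 'I_m -> R).
Context (al0 : forall i, 0 < alpha i) (aal0 : forall i, 0 < a i + alpha i).
Context (be0 : forall j, 0 < beta j) (bbe0 : forall j, 0 < b j + beta j).

Lemma gamma_ratio_nat (k : nat) :
  (\prod_(j < m) Gamma ((b j + beta j * (k%:R + 1))%:C)) /
  (\prod_(i < p) Gamma ((a i + alpha i * (k%:R + 1))%:C)) =
  (wright_ratio a alpha b beta k)%:C.
Proof.
rewrite /wright_ratio rmorphM fmorphV !rmorph_prod.
by congr (_ / _); apply: eq_bigr => i _; rewrite Gamma_real// wright_arg_gt0.
Qed.

Lemma wright_ratio_gt0 (k : nat) :
  0 < wright_ratio a alpha b beta k.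
Proof.
apply: divr_gt0; apply: prodr_gt0 => i _;
  by rewrite rgamma_gt0// wright_arg_gt0.
Qed.

Lemma wrightK_ratio :
  wrightK a alpha b beta = (wright_ratio a alpha b beta 0)%:C.
Proof.
rewrite -gamma_ratio_nat//.
by congr (_ / _); apply: eq_bigr => i _; rewrite add0r mulr1.
Qed.

(** At s = - k the arguments of the Gamma functions become
    b_j + beta_j (k + 1) and a_i + alpha_i (k + 1). *)
Lemma dual_ratio_nat (k : nat) :
  dual_ratio a alpha b beta (- k%:R)%:C = (wright_ratio a alpha b beta k)%:C.
Proof.
rewrite -gamma_ratio_nat// /dual_ratio.
by congr (_ / _); apply: eq_bigr => i _; congr Gamma;
  rewrite -rmorphM -rmorphB; congr (_%:C); ring.
Qed.

Context (gamma : R) (d : nat) (P : probability (d.-tuple R) R).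
Context (as0 : 0 <= astar alpha beta) (g0 : 0 < gamma).
Context (hg : forall j, gamma < (b j + beta j) / beta j).
Context (hP : is_wright_measure a alpha b beta gamma P).

(** Psi is evaluated at - h^2 (y, y) / 2, which turns the powers of
    z into even powers of h and the error z^(n + 1/2) into h^(2n+1). *)
Lemma charfun_expansion (y : d.-tuple R) (n : nat) :
  exists2 C : R, 0 <= C & forall h : R, 0 < h <= 1 ->
    normc (charfun P (scale_tuple h y) -
      (\sum_(k < n.+1) (-1) ^+ k / (k`!)%:R * (inner y y / 2) ^+ k *
        (wright_ratio a alpha b beta k / wright_ratio a alpha b beta 0) * h ^+ (2 * k))%:C)
    <= C * h ^+ (2 * n).+1.
Proof.
set r := wright_ratio a alpha b beta.
have r0 : r 0%N != 0 by rewrite gt_eqF// wright_ratio_gt0.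
have KE : wrightK a alpha b beta = (r 0%N)%:C by apply: wrightK_ratio.
have [C C0 hC] := @wrightPsi_expansion R p m a alpha b beta gamma n al0 be0 as0 bbe0 g0 hg.
set rho := inner y y / 2.
have yy0 : 0 <= inner y y by apply: sumr_ge0 => i _; rewrite -expr2 sqr_ge0.
have chE h : charfun P (scale_tuple h y) =
    (r 0%N)^-1%:C * wrightPsi a alpha b beta gamma (- (h ^+ 2 * rho)).
  rewrite hP KE fmorphV inner_scalel inner_scaler; congr (_ * wrightPsi _ _ _ _ _ (- _)).
  by rewrite /rho; ring.
(* For y = 0, the value Psi(0) = K is part of the definition. *)
have [rho0|rho0] := eqVneq rho 0.
  exists 0 => // h _; rewrite chE mul0r rho0 mulr0 oppr0 {1}/wrightPsi eqxx KE.
  have -> : \sum_(k < n.+1) (-1) ^+ k / (k`!)%:R * 0 ^+ k * (r k / r 0%N) * h ^+ (2 * k) = 1.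
    rewrite big_ord_recl big1 => [|i _]; last by rewrite /= expr0n mulr0 !mul0r.
    by rewrite /= muln0 fact0 !expr0 divr1 !mul1r mulr1 divff// addr0.
  by rewrite fmorphV mulVf ?subrr ?Normc.normc0// -normc_eq0P normc_real normr_eq0.
have rho1 : 0 < rho by rewrite lt_neqAle eq_sym rho0 /rho divr_ge0.
exists (`|(r 0%N)^-1| * (C * expR ((n%:R + 1 / 2) * ln rho))) => [|h /andP[h0 h1]].
  by rewrite mulr_ge0// mulr_ge0// expR_ge0.
have z0 : 0 < h ^+ 2 * rho by rewrite mulr_gt0// exprn_gt0.
have := hC _ z0; rewrite chE => q.
have -> : (\sum_(k < n.+1) (-1) ^+ k / (k`!)%:R * rho ^+ k * (r k / r 0%N) * h ^+ (2 * k))%:C =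
    (r 0%N)^-1%:C * wright_taylor a alpha b beta n.+1 (h ^+ 2 * rho).
  rewrite /wright_taylor mulr_sumr rmorph_sum; apply: eq_bigr => k _.
  rewrite dual_ratio_nat// -/(r k) -!rmorphM; congr (_%:C).
  by rewrite [(_ * rho) ^+ k]exprMn [h ^+ (2 * k)]exprM; move: ((h ^+ 2) ^+ k) => u; ring.
rewrite -mulrBr Normc.normcM normc_real -[leRHS]mulrA -[C * _ * _]mulrA; apply: ler_wpM2l => //.
apply: le_trans q _; apply: ler_wpM2l => //; apply: le_of_eq.
rewrite lnM ?posrE ?exprn_gt0// lnXn// mulrDr expRD mulrC; congr (_ * _).
rewrite -[in RHS](lnK h0) -expRM_natl; congr expR.
by rewrite (mulr2n (ln h)) -(natr1 (2 * n)) natrM; field.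
Qed.

Lemma wright_projection_moments (y : d.-tuple R) (n : nat) :
  [/\ P.-integrable setT (EFin \o (fun x => inner y x ^+ n)),
      Rintegral P setT (fun x => inner y x ^+ (2 * n)) =
        ((2 * n)`!)%:R / ((n`!)%:R * 2 ^+ n) *
        (wright_ratio a alpha b beta n / wright_ratio a alpha b beta 0) * inner y y ^+ n &
      Rintegral P setT (fun x => inner y x ^+ (2 * n).+1) = 0].
Proof.
set r := wright_ratio a alpha b beta.
pose e k : R := (-1) ^+ k / (k`!)%:R * (inner y y / 2) ^+ k * (r k / r 0%N).
have mX := @measurable_inner R d y.
have hN N := charfun_expansion y N.
have he N : exists2 C : R, 0 <= C & forall h : R, 0 < h <= 1 ->
    `|Rintegral P setT (fun x => cos (h * inner y x)) - \sum_(k < N.+1) e k * h ^+ (2 * k)|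
    <= C * h ^+ (2 * N).+1.
  have [C C0 hC] := hN N; exists C => // h h01; apply: le_trans (hC h h01).
  apply: le_trans (Re_le_normc _); rewrite ReD ReN (charfun_ReIm _ _).1.
  by under [in X in _ <= X]eq_Rintegral do rewrite inner_scalel.
have hs N : exists2 C : R, 0 <= C & forall h : R, 0 < h <= 1 ->
    `|Rintegral P setT (fun x => sin (h * inner y x))| <= C * h ^+ (2 * N).+1.
  have [C C0 hC] := hN N; exists C => // h h01; apply: le_trans (hC h h01).
  apply: le_trans (Im_le_normc _); rewrite ImD ImN (charfun_ReIm _ _).2 subr0.
  by under [in X in _ <= X]eq_Rintegral do rewrite inner_scalel.
split.
- exact: (powers_integrable mX he).
- rewrite (even_moments_of_charfun mX he) /e.
  have s1 : (-1) ^+ n * (-1) ^+ n = 1 :> R by rewrite -expr2 sqrr_sign.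
  have f0 : (n`!)%:R != 0 :> R by rewrite pnatr_eq0 -lt0n fact_gt0.
  have t0 : 2 ^+ n != 0 :> R by rewrite expf_neq0// pnatr_eq0.
  have r0 : r 0%N != 0 by rewrite gt_eqF// wright_ratio_gt0.
  rewrite expr_div_n; move: ((-1) ^+ n : R) s1 => s s1.
  transitivity (s * s * (((2 * n)`!)%:R / ((n`!)%:R * 2 ^+ n) * (r n / r 0%N) * inner y y ^+ n)).
    by field; rewrite f0 t0 r0.
  by rewrite s1 mul1r.
- exact: (odd_moments_of_charfun mX he hs).
Qed.

End wright_measure.

Theorem lemma2p12 (R : realType) (p m : nat)
    (a alpha : 'I_p -> R) (b beta : 'I_m -> R)
    (alpha_gt0 : forall i, 0 < alpha i)
    (aalpha_gt0 : forall i, 0 < a i + alpha i)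
    (beta_gt0 : forall j, 0 < beta j)
    (bbeta_gt0 : forall j, 0 < b j + beta j)
    (hstar : 0 < astar alpha beta \/
             astar alpha beta = 0 /\ mustar a b < -1)
    (gammaH : R) (gammaH_itv : 0 < gammaH < 1)
    (gammaH_poles : forall (j : 'I_m) (k : nat),
       - (b j + k%:R) / beta j < gammaH)
    (H_ge0 : forall tau : R, 0 < tau ->
       0 <= foxH a alpha b beta gammaH tau)
    (gammaPsi : R) (gammaPsi_itv : 0 < gammaPsi < 1)
    (gammaPsi_lt : forall j : 'I_m, gammaPsi < (b j + beta j) / beta j)
    (d : nat) (d_gt0 : (0 < d)%N)
    (P : probability (d.-tuple R) R)
    (hP : is_wright_measure a alpha b beta gammaPsi P) :
  [/\ forall n : 'I_d -> nat,
        P.-integrable setT (EFin \o monomial n),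
      forall n : 'I_d -> nat, (exists i, odd (n i)) -> moment P n = 0 &
      forall n : 'I_d -> nat,
        let N := (\sum_(i < d) n i)%N in
        (moment P (fun i => (2 * n i)%N))%:C =
        (wrightK a alpha b beta)^-1 *
        ((\prod_(j < m) Gamma ((b j + beta j * (N%:R + 1))%:C)) /
         (\prod_(i < p) Gamma ((a i + alpha i * (N%:R + 1))%:C))) *
        ((\prod_(i < d) ((2 * n i)`!)%:R) /
         ((\prod_(i < d) ((n i)`!)%:R) * 2 ^+ N))].

Proof.
have as0 : 0 <= astar alpha beta by case: hstar => [/ltW//|[-> _]].
have /andP[g0 _] := gammaPsi_itv.
set r := wright_ratio a alpha b beta.
have r0 : r 0%N != 0 by rewrite gt_eqF// wright_ratio_gt0.
pose g k : R := ((2 * k)`!)%:R / ((k`!)%:R * 2 ^+ k) * (r k / r 0%N).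
have hy y n := wright_projection_moments alpha_gt0 aalpha_gt0 beta_gt0 bbeta_gt0
  as0 g0 gammaPsi_lt hP y n.
have [hi ho he] := @moments_of_projections R d P g (fun y n => let: And3 h _ _ := hy y n in h)
  (fun y n => let: And3 _ h _ := hy y n in h) (fun y n => let: And3 _ _ h := hy y n in h).
split=> // n N; rewrite he -/N gamma_ratio_nat// wrightK_ratio// -/r.
have f0 l : (l`!)%:R != 0 :> R by rewrite pnatr_eq0 -lt0n fact_gt0.
have cn l : (l%:R : R[i]) = (l%:R : R)%:C by rewrite (rmorph_nat (real_complex R)).
have cp (k : 'I_d -> nat) : \prod_(i < d) ((k i)%:R : R[i]) = (\prod_(i < d) (k i)%:R)%:C.
  by rewrite rmorph_prod; apply: eq_bigr => i _; rewrite cn.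
rewrite !cp cn -rmorphXn -fmorphV -!rmorphM -fmorphV -!rmorphM; congr (_%:C).
have P0 : \prod_(i < d) ((n i)`!)%:R != 0 :> R by apply/prodf_neq0.
have t0 : 2 ^+ N != 0 :> R by rewrite expf_neq0// pnatr_eq0.
rewrite /g; move: (f0 N) (f0 (2 * N)%N) r0 P0 t0 => F1 F2 F3 F4 F5.
by field; rewrite F1 F2 F3 F4 F5.
Qed.
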